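(* As $n\to\infty$, $$n-F_{2,4}(n)\sim n-f_{2,4}(n)\sim C_4\,\sqrt n\,\log n,$$ where $$C_4=\frac{\pi^2}{12}\prod_p\left(1-\frac6{p^2}+\frac8{p^3}-\frac3{p^4}\right)=0.0944883\ldots,$$ the product being over all primes $p$. More generally, for every integer $d\geq4$, the assertion $$n^{2/d}\ll n-F_{2,d}(n)\leq n-f_{2,d}(n)\ll n^{2/d}$$ is false.
   Context: Write $[n]=\{1,\dots,n\}$. For an integer $d\ge 3$: $F_{2,d}(n)$ is the largest size of a set $A\subseteq[n]$ such that there are no two distinct elements $a,b\in A$ with $ab=x^d$ for some positive integer $x$; $f_{2,d}(n)$ is the largest size of a set $A\subseteq[n]$ such that there are no $a,b\in A$, not necessarily distinct, with $ab=x^d$ for some positive integer $x$. $\log$ is the natural logarithm. The notation $g(n)\ll h(n)$ means that there is a constant $c>0$ (which may depend on $d$) such that $g(n)\le c\,h(n)$ for all sufficiently large $n$. *)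

(* Defs.v *)
From HB Require Import structures.
From mathcomp Require Import all_boot all_order all_algebra.
From mathcomp Require Import ring lra.
From mathcomp Require Import all_classical all_reals all_analysis.

Set Implicit Arguments.
Unset Strict Implicit.
Unset Printing Implicit Defensive.

Import Order.TTheory GRing.Theory Num.Theory.
Import numFieldNormedType.Exports.

Local Open Scope ring_scope.
Local Open Scope classical_set_scope.

Definition pos_power (d m : nat) : Prop :=
  exists x : nat, (0 < x)%N /\ m = (x ^ d)%N.

(* A subset of {1, ..., n} is encoded as a set A of ordinals below n + 1
   that does not contain 0. *)
Definition F2_admissible (d n : nat) (A : {set 'I_n.+1}) : Prop :=
  ord0 \notin A /\
  ~ (exists a b : 'I_n.+1,
       [/\ a \in A, b \in A, a <> b & pos_power d (a * b)%N]).

Definition f2_admissible (d n : nat) (A : {set 'I_n.+1}) : Prop :=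
  ord0 \notin A /\
  ~ (exists a b : 'I_n.+1,
       [/\ a \in A, b \in A & pos_power d (a * b)%N]).

Definition F2 (d n : nat) : nat :=
  (\max_(A : {set 'I_n.+1} | `[< F2_admissible d A >]) #|A|)%N.

Definition f2 (d n : nat) : nat :=
  (\max_(A : {set 'I_n.+1} | `[< f2_admissible d A >]) #|A|)%N.

(* Vinogradov's g << h: unlike bigO, no absolute values are taken. *)
Definition vinogradov (R : realType) (g h : nat -> R) : Prop :=
  exists c : R, 0 < c /\ \forall n \near \oo, g n <= c * h n.

Definition C4_factor (R : realType) (p : nat) : R :=
  1 - 6 / p%:R ^+ 2 + 8 / p%:R ^+ 3 - 3 / p%:R ^+ 4.

Definition C4_partial (R : realType) (N : nat) : R :=
  \prod_(0 <= p < N | prime p) C4_factor R p.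

Definition C4 (R : realType) : R :=
  pi ^+ 2 / 12 * limn (@C4_partial R).

Lemma C4_factor_itv (R : realType) (p : nat) :
  prime p -> 0 <= C4_factor R p <= 1.
Proof.
move=> /prime_gt1 p1.
have x0 : 0 < (p%:R : R)^-1 by rewrite invr_gt0 ltr0n ltnW.
have x1 : (p%:R : R)^-1 <= 2^-1.
  by rewrite lef_pV2 ?posrE ?ltr0n ?ler_nat// ltnW.
rewrite /C4_factor -!exprVn; move: (p%:R^-1) x0 x1 => x x0 x1.
have -> : 1 - 6 * x ^+ 2 + 8 * x ^+ 3 - 3 * x ^+ 4 =
  (1 - x) ^+ 3 * (1 + 3 * x) by ring.
have hx : 0 <= 1 - x by lra.
apply/andP; split; first by apply: mulr_ge0; [exact: exprn_ge0|lra].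
have -> : (1 - x) ^+ 3 * (1 + 3 * x) =
  1 - x ^+ 2 * (2 + 4 * (1 - 2 * x) + 3 * x ^+ 2) by ring.
have : 0 <= x ^+ 2 * (2 + 4 * (1 - 2 * x) + 3 * x ^+ 2).
  apply: mulr_ge0; first exact: sqr_ge0.
  have := sqr_ge0 x; lra.
lra.
Qed.

Lemma is_cvg_C4_partial (R : realType) : cvgn (@C4_partial R).
Proof.
have ge0 N : 0 <= C4_partial R N.
  by apply: prodr_ge0 => p /(C4_factor_itv R)/andP[].
apply: nonincreasing_is_cvgn; last by exists 0 => _ [N _ <-].
apply/nonincreasing_seqP => N.
have -> : C4_partial R N.+1 =
    C4_partial R N * (if prime N then C4_factor R N else 1).
  by rewrite /C4_partial big_mkcond big_nat_recr//= -big_mkcond.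
apply: ler_piMr; first exact: ge0.
by case: ifPn => // pN; case/andP: (C4_factor_itv R pN).
Qed.

(* Main.v *)
Require Import Defs.
From mathcomp Require Import all_boot all_order all_algebra.
From mathcomp Require Import all_classical all_reals all_analysis.
From mathcomp Require Import zify ring lra.
From Stdlib Require NArith Nnat.

Set Implicit Arguments.
Unset Strict Implicit.
Unset Printing Implicit Defensive.

Import Order.TTheory GRing.Theory Num.Theory.
Import numFieldNormedType.Exports.

Local Open Scope ring_scope.
Local Open Scope classical_set_scope.

(** Every [a > 0] is uniquely [u v^2 w^3 x^4] with [u], [v], [w] squarefree and
pairwise coprime ([quartic_decomposition]).  The product of two integers is a
fourth power exactly when the second has the same [v] and has [u] and [w]
exchanged.  So the graph of forbidden pairs of distinct integers has one
complete bipartite component for each unordered pair of distinct [u], [w] and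
each [v], and one clique, made of squares, for each [v] when [u = w = 1].
Exchanging [u] and [w] sends [a] with [u < w] to a smaller integer, so the
integers with [u < w] are matched inside [1 .. n] into the others and an
admissible set misses one end of each edge ([matching_bound]); conversely the
integers with [u > w] form an admissible set ([quads_f2]).  Hence both [n - F]
and [n - f] are the number [quad_count n] of [a <= n] with [u < w], up to the
[O(sqrt n)] squares.

For fixed [x] put [kappa = n / x^4].  The number of all triples [(u, v, w)]
with [u < w] and [u v^2 w^3 <= kappa] is, summing over [v], then [u], then [w],
[\sum_w \sum_(u < w) sqrt kappa / (sqrt u w^(3/2)) ~ 2 sqrt kappa \sum_w 1 / w].
The range of [w] that matters is [w <= kappa^(1/4)], whence
[sqrt kappa log kappa / 2].  A periodic weight multiplies this by its mean
([box_reg_mean]); for the sieve by the primes below [z] the mean is the partial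
product [C4_partial z], by Chinese remaindering ([mean3_sieve]).  The primes
from [z] on change the count by a proportion [O(1 / z)], because the number of
triples satisfying given divisibility conditions scales as expected
([sieve_box]).  Summing over [x] brings in [\sum_x x^-2 = pi^2 / 6] ([basel]),
and letting [z] grow gives [quad_count n ~ C4 sqrt n log n]
([quad_count_asymp]).

For the value of [C4] ([C4_num]), each factor of the product is divided by
[(1 - p^-2)^6], which leaves [1 + O(p^-3)]; the factors [1 - p^-2] multiply to
[6 / pi^2].  The primes below 3000 are then multiplied out with directed
rounding, the remaining tail is bounded by a telescoping product, and [pi^2 / 6]
is read off from [zeta2_Euler_Maclaurin].

The logarithm refutes the last assertion for [d = 4].  For [d >= 5] write
[d = 2 k + 2 + e] with [e] in [{1, 2}] and consider the pairs
[u^(k+1) w^(k+1+e) v^(k+2+e)], [u^(k+1+e) w^(k+1) v^k], of product [(u v w)^d],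
for good triples with [v > 1].  With [r^e = v], both members are at most [N^d]
as soon as [u <= N r] and [w <= N / (r v)], a box of area [N^2 / v].  Summed
over [v] the areas diverge, so the same sieve yields more than [c N^2] disjoint
forbidden pairs below [n = N^d], for any [c] ([box_breg_unbounded],
[F2_not_O_square]), while [n^(2/d) = N^2]. *)

(** * Elementary sums *)

Lemma sum_multiples (V : nmodType) (f : nat -> V) (d N : nat) : (0 < d)%N ->
  \sum_(1 <= u < N.+1 | (d %| u)%N) f u =
  \sum_(1 <= j < (N %/ d).+1) f (d * j)%N.
Proof.
move=> d0; elim: N => [|N IH]; first by rewrite div0n !big_geq.
rewrite big_mkcond big_nat_recr//= -big_mkcond/= IH divnS//.
case: ifP => [dN|_]; last by rewrite addr0.
rewrite add1n [RHS]big_nat_recr//=.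
have {1}-> : N.+1 = (d * (N %/ d).+1)%N.
  by rewrite -[LHS](divnK dN) mulnC divnS// dN.
by [].
Qed.

Section sums.
Variable R : realType.
Implicit Types (f a : nat -> R) (K N d : nat).

Definition harm N : R := \sum_(1 <= j < N.+1) j%:R^-1.

Lemma harm_le N K : (N <= K)%N -> harm N <= harm K.
Proof.
move=> NK; rewrite /harm (big_cat_nat _ (n := N.+1) (p := K.+1))//=.
by rewrite lerDl sumr_ge0// => i _; rewrite invr_ge0.
Qed.

Lemma harm_ge0 N : 0 <= harm N.
Proof. by apply: sumr_ge0 => i _; rewrite invr_ge0. Qed.

Lemma ln_step_ub (j : nat) : (0 < j)%N ->
  ln (j.+1%:R : R) - ln j%:R <= j%:R^-1.
Proof.
move=> j0; have j0' : 0 < j%:R :> R by rewrite ltr0n.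
rewrite -ln_div ?posrE ?ltr0n//.
have -> : j.+1%:R / j%:R = 1 + j%:R^-1 :> R.
  by rewrite -[j.+1]addn1 natrD mulrDl divff ?gt_eqF// mul1r.
by apply: le_ln1Dx; rewrite (lt_le_trans _ (_ : 0 <= _))// ?invr_ge0 ?ltrN10.
Qed.

Lemma ln_step_lb (j : nat) : (0 < j)%N ->
  j.+1%:R^-1 <= ln (j.+1%:R : R) - ln j%:R.
Proof.
move=> j0; have j0' : 0 < j%:R :> R by rewrite ltr0n.
have j1' : 0 < j.+1%:R :> R by rewrite ltr0n.
rewrite -[leRHS]opprB -ln_div ?posrE ?ltr0n//.
have -> : j%:R / j.+1%:R = 1 + - j.+1%:R^-1 :> R.
  apply: (mulIf (x := j.+1%:R)); first by rewrite gt_eqF.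
  by rewrite mulrBl mul1r !mulVf ?divfK ?gt_eqF// -natr1 addrK.
rewrite lerNr; apply: le_ln1Dx.
by rewrite ltrN2 invf_lt1 ?ltr1n ?ltr0n.
Qed.

Lemma ln_le_harm N : ln (N.+1%:R : R) <= harm N.
Proof.
elim: N => [|N IH]; first by rewrite ln1 /harm big_geq.
rewrite /harm big_nat_recr//= -/(harm N).
have := lerD IH (@ln_step_ub N.+1 isT).
by rewrite [ln N.+1%:R + _]addrC subrK.
Qed.

Lemma harm_le_ln N : (0 < N)%N -> harm N <= 1 + ln (N%:R : R).
Proof.
elim: N => [//|[|N] IH _]; first by rewrite /harm big_nat1 ln1 invr1 addr0.
rewrite /harm big_nat_recr//= -/(harm N.+1).
have := lerD (IH isT) (@ln_step_lb N.+1 isT).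
by rewrite -addrA [ln N.+1%:R + _]addrC subrK.
Qed.

Lemma harm_multiples d K : (0 < d)%N ->
  \sum_(1 <= w < K.+1 | (d %| w)%N) w%:R^-1 <= harm K / d%:R.
Proof.
move=> d0; rewrite sum_multiples//.
under eq_bigr do rewrite natrM invfM mulrC.
by rewrite -mulr_suml ler_wpM2r ?invr_ge0// harm_le// leq_div.
Qed.

Lemma count_le (J : nat) (Z : R) : 0 <= Z ->
  \sum_(1 <= j < J.+1) (j%:R <= Z :> R)%:R <= Z.
Proof.
move=> Z0; elim: J => [|J IH]; first by rewrite big_geq.
rewrite big_nat_recr//=; case: (boolP (J.+1%:R <= Z)) => h;
  last by rewrite addr0.
apply: le_trans h.
rewrite -[J.+1 in leRHS]addn1 natrD lerD2r.
apply: (@le_trans _ _ (\sum_(1 <= j < J.+1) 1)).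
  by apply: ler_sum => i _; by rewrite lern1 leq_b1.
by rewrite big_const_nat subn1/= iter_addr_0.
Qed.

Lemma count_multiples_le d (J : nat) (Z : R) : (0 < d)%N -> 0 <= Z ->
  \sum_(1 <= j < J.+1 | (d %| j)%N) (j%:R <= Z :> R)%:R <= Z / d%:R.
Proof.
move=> d0 Z0; rewrite sum_multiples//.
have d0' : 0 < d%:R :> R by rewrite ltr0n.
under eq_bigr do rewrite natrM mulrC -ler_pdivlMr//.
by apply: count_le; rewrite divr_ge0.
Qed.

Lemma sqrtS_natrK (j : nat) : Num.sqrt (j%:R : R) ^+ 2 = j%:R.
Proof. by rewrite sqr_sqrtr. Qed.

Lemma sqrt_nat_ge1 (j : nat) : (0 < j)%N -> 1 <= Num.sqrt (j%:R : R).
Proof. by move=> j0; rewrite -[X in X <= _]sqrtr1 ler_sqrt// ler1n. Qed.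

Lemma sum_invsqrt_ub J :
  \sum_(1 <= j < J.+1) (Num.sqrt (j%:R : R))^-1 <= 2 * Num.sqrt J%:R.
Proof.
elim: J => [|J IH]; first by rewrite big_geq// sqrtr0 mulr0.
rewrite big_nat_recr//=; apply: le_trans (lerD IH (lexx _)) _.
have := sqrtS_natrK J; have := sqrtS_natrK J.+1; rewrite -natr1.
have := @sqrt_nat_ge1 J.+1 isT; rewrite -natr1.
set s := Num.sqrt (J%:R + 1); have := sqrtr_ge0 (J%:R : R).
set t := Num.sqrt J%:R => t0 s1 es et.
have s0 : 0 < s by lra.
rewrite -(ler_pM2r s0) mulrDl mulVf ?gt_eqF//.
have := sqr_ge0 (s - t); nra.
Qed.

Lemma sum_invsqrt_lb J :
  2 * Num.sqrt (J.+1%:R : R) - 2 <=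
  \sum_(1 <= j < J.+1) (Num.sqrt (j%:R : R))^-1.
Proof.
elim: J => [|J IH]; first by rewrite big_geq// sqrtr1; lra.
rewrite big_nat_recr//=; apply: le_trans (lerD IH (lexx _)).
have := sqrtS_natrK J.+1; have := sqrtS_natrK J.+2.
rewrite -[J.+2%:R]natr1.
have := @sqrt_nat_ge1 J.+1 isT.
set s := Num.sqrt J.+1%:R; have := sqrtr_ge0 (J.+1%:R + 1 : R).
set t := Num.sqrt (_ + 1) => t0 s1 es et.
have s0 : 0 < s by lra.
rewrite -(ler_pM2r s0) [leRHS]mulrDl mulVf ?gt_eqF//.
have := sqr_ge0 (s - t); nra.
Qed.

Lemma sum_invsqrt_multiples d N : (0 < d)%N ->
  \sum_(1 <= u < N.+1 | (d %| u)%N) (Num.sqrt (u%:R : R))^-1 <=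
  2 * Num.sqrt N%:R / d%:R.
Proof.
move=> d0; rewrite sum_multiples//.
have d0' : 0 < d%:R :> R by rewrite ltr0n.
under eq_bigr do rewrite natrM sqrtrM// invfM mulrC.
rewrite -mulr_suml; apply: le_trans
  (ler_wpM2r _ (sum_invsqrt_ub _)) _; first by rewrite invr_ge0.
rewrite -!mulrA ler_pM2l// ler_pdivrMr ?sqrtr_gt0//.
rewrite mulrAC ler_pdivlMr//.
rewrite -[d%:R in leLHS]sqrtS_natrK expr2 mulrA.
apply: ler_wpM2r => //; rewrite -sqrtrM// ler_sqrt// -natrM ler_nat.
exact: leq_divM.
Qed.

Lemma sum_inv32 J :
  \sum_(1 <= j < J.+1) (j%:R * Num.sqrt (j%:R : R))^-1 <= 3.
Proof.
case: J => [|J]; first by rewrite big_geq.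
suff : \sum_(1 <= j < J.+2) (j%:R * Num.sqrt (j%:R : R))^-1 <=
    3 - 2 * (Num.sqrt J.+1%:R)^-1.
  move/le_trans; apply; rewrite gerBl mulr_ge0// invr_ge0 sqrtr_ge0//.
elim: J => [|J IH]; first by rewrite big_nat1 sqrtr1 mulr1 invr1; lra.
rewrite big_nat_recr//=; apply: le_trans (lerD IH (lexx _)) _.
have := sqrtS_natrK J.+1; have := sqrtS_natrK J.+2.
rewrite -[X in (X * Num.sqrt X)^-1]natr1 -[J.+2%:R]natr1.
have := @sqrt_nat_ge1 J.+1 isT.
have : 1 <= J.+1%:R :> R by rewrite ler1n.
set x : R := J.+1%:R => x1.
set s := Num.sqrt x; set t := Num.sqrt (x + 1) => s1 et es.
have t0 : 0 < t by rewrite sqrtr_gt0; lra.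
have st : s <= t by rewrite ler_sqrt; lra.
rewrite -subr_ge0 -et.
have -> : 3 - 2 * t^-1 - (3 - 2 * s^-1 + (t ^+ 2 * t)^-1) =
  (2 * t ^+ 2 * (t - s) - s) / (s * t ^+ 3).
  by field; apply/andP; split; apply/eqP; lra.
apply: divr_ge0; last by rewrite mulr_ge0 ?exprn_ge0//; lra.
have e : (t - s) * (t + s) = 1 by rewrite -subr_sqr et es; ring.
have h : 1 <= 2 * t * (t - s) by nra.
have := mulr_ge0 (ltW t0) (_ : 0 <= 2 * t * (t - s) - 1); nra.
Qed.

Lemma sum_inv3 Q K : (0 < Q)%N ->
  \sum_(Q.+1 <= w < K) (w%:R ^+ 3 : R)^-1 <= (Q%:R * (Q.+1)%:R)^-1.
Proof.
move=> Q0; have [KQ|QK] := leqP K Q.+1.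
  by rewrite big_geq// invr_ge0 mulr_ge0.
apply: (@le_trans _ _ (\sum_(Q.+1 <= w < K)
   (- (w%:R * w.+1%:R)^-1 - - (w.-1%:R * w.-1.+1%:R)^-1))).
  rewrite !big_nat; apply: ler_sum => w /andP[Qw _].
  have w1 : (1 < w)%N by lia.
  case: w w1 {Qw} => [//|[//|w]] _ /=.
  rewrite -[w.+3%:R]natr1 -[w.+2%:R]natr1.
  have x1 : 1 <= w.+1%:R :> R by rewrite ler1n.
  move: (w.+1%:R) x1 => x x1.
  rewrite -subr_ge0.
  have -> : - ((x + 1) * (x + 1 + 1))^-1 - - (x * (x + 1))^-1
     - ((x + 1) ^+ 3)^-1 =
    ((x + 1) ^+ 2 + 1) / (x * (x + 1) ^+ 3 * (x + 2)).
    by field; do !(apply/andP; split); apply/eqP; nra.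
  by apply: divr_ge0; rewrite ?addr_ge0 ?sqr_ge0// !mulr_ge0 ?exprn_ge0//; lra.
have -> : \sum_(Q.+1 <= w < K)
   (- (w%:R * w.+1%:R)^-1 - - (w.-1%:R * w.-1.+1%:R)^-1) =
   \sum_(Q.+1 <= w < K)
   ((fun w => - (w.-1%:R * w.-1.+1%:R)^-1) w.+1 - - (w.-1%:R * w.-1.+1%:R)^-1 :
     R).
  by [].
rewrite telescope_sumr ?(ltnW QK)//= opprK.
by rewrite gerDr oppr_le0 invr_ge0 mulr_ge0.
Qed.

Lemma sum_inv2 z K : (1 < z)%N ->
  \sum_(z <= p < K) (p%:R ^+ 2 : R)^-1 <= (z.-1%:R)^-1.
Proof.
move=> z1; have [KQ|QK] := leqP K z.
  by rewrite big_geq// invr_ge0.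
apply: (@le_trans _ _ (\sum_(z <= w < K)
   ((fun w => - w.-1%:R^-1) w.+1 - - w.-1%:R^-1 : R))).
  rewrite !big_nat; apply: ler_sum => w /andP[Qw _].
  have w1 : (1 < w)%N by lia.
  case: w w1 {Qw} => [//|[//|w]] _ /=.
  rewrite -[w.+2%:R]natr1.
  have x1 : 1 <= w.+1%:R :> R by rewrite ler1n.
  move: (w.+1%:R) x1 => x x1.
  rewrite -subr_ge0.
  have -> : - (x + 1)^-1 - - x^-1 - ((x + 1) ^+ 2)^-1 = (x * (x + 1) ^+ 2)^-1.
    by field; apply/andP; split; apply/eqP; lra.
  by rewrite invr_ge0 mulr_ge0 ?exprn_ge0//; lra.
rewrite telescope_sumr ?(ltnW QK)//= opprK.
by rewrite gerDr oppr_le0 invr_ge0.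
Qed.

(** Summation by parts. *)
Lemma abel_bound a f (B : R) :
  (forall K, `|\sum_(1 <= i < K) a i| <= B) ->
  (forall i, (0 < i)%N -> 0 <= f i) ->
  (forall i, (0 < i)%N -> f i.+1 <= f i) ->
  forall K, `|\sum_(1 <= i < K) a i * f i| <= B * f 1%N.
Proof.
move=> aB f0 fd K; have B0 : 0 <= B by apply: le_trans (aB 0%N).
have [K1|K1] := leqP K 1%N.
  by rewrite big_geq// normr0 mulr_ge0// f0.
case: K K1 => [//|[//|K]] _.
suff H : `|\sum_(1 <= i < K.+2) a i * f i -
    (\sum_(1 <= i < K.+2) a i) * f K.+2| <= B * (f 1%N - f K.+2).
  rewrite -[X in `|X|](subrK ((\sum_(1 <= i < K.+2) a i) * f K.+2)).
  apply: le_trans (ler_normD _ _) _.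
  rewrite normrM [`|f _|]ger0_norm ?f0//.
  have := ler_wpM2r (f0 K.+2 isT) (aB K.+2).
  by move: H; rewrite mulrBr; lra.
elim: K => [|K IH].
  rewrite !big_nat1 -mulrBr normrM ler_pM//; first by have := aB 2%N;
    rewrite big_nat1.
  by rewrite ger0_norm// subr_ge0 fd.
rewrite [X in `|X - _|]big_nat_recr//= -/(index_iota _ _).
set S := \sum_(1 <= i < K.+2) a i * f i in IH *.
have eA : \sum_(1 <= i < K.+3) a i = \sum_(1 <= i < K.+2) a i + a K.+2.
  by rewrite big_nat_recr.
have -> : S + a K.+2 * f K.+2 - (\sum_(1 <= i < K.+3) a i) * f K.+3 =
  (S - (\sum_(1 <= i < K.+2) a i) * f K.+2) +
  (\sum_(1 <= i < K.+3) a i) * (f K.+2 - f K.+3) by rewrite eA; ring.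
apply: le_trans (ler_normD _ _) _.
have d0 : 0 <= f K.+2 - f K.+3 by rewrite subr_ge0 fd.
have : `|(\sum_(1 <= i < K.+3) a i) * (f K.+2 - f K.+3)| <=
    B * (f K.+2 - f K.+3).
  by rewrite normrM [`|f _ - _|]ger0_norm// ler_wpM2r.
move: IH; rewrite !mulrBr; lra.
Qed.

End sums.

(** * Periodic functions and the squarefree sieve *)

Section periodic.
Variable R : realType.
Implicit Types (f g : nat -> R) (h : nat -> nat -> nat -> R) (M q : nat).

Definition nat_periodic (T : Type) (M : nat) (f : nat -> T) :=
  forall i, f (i + M)%N = f i.

Definition mean M f : R := (\sum_(0 <= i < M) f i) / M%:R.

Lemma nat_periodicM (T : Type) M q (f : nat -> T) :
  nat_periodic M f -> nat_periodic (M * q) f.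
Proof.
move=> pf i; elim: q => [|q IH]; first by rewrite muln0 addn0.
by rewrite mulnS addnCA addnC pf.
Qed.

Lemma nat_periodic_mod (T : Type) M (f : nat -> T) i :
  nat_periodic M f -> f (i %% M)%N = f i.
Proof.
move=> pf; rewrite [in RHS](divn_eq i M) addnC mulnC.
by rewrite (nat_periodicM _ pf).
Qed.

Lemma eq_mean M f g : f =1 g -> mean M f = mean M g.
Proof. by move=> fg; congr (_ / _); apply: eq_bigr => i _. Qed.

Lemma meanD M f g : mean M (fun i => f i + g i) = mean M f + mean M g.
Proof. by rewrite /mean big_split mulrDl. Qed.

Lemma meanZ M (c : R) f : mean M (fun i => c * f i) = c * mean M f.
Proof. by rewrite /mean -mulr_sumr mulrA. Qed.

Lemma meanZr M (c : R) f : mean M (fun i => f i * c) = mean M f * c.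
Proof. by rewrite mulrC -meanZ; apply: eq_mean => i; rewrite mulrC. Qed.

Lemma mean_const M (c : R) : (0 < M)%N -> mean M (fun=> c) = c.
Proof.
move=> M0; rewrite /mean big_const_nat subn0 iter_addr_0 -[c *+ M]mulr_natr
  mulfK//.
by rewrite pnatr_eq0; lia.
Qed.

Lemma mean_itv M f : (forall i, 0 <= f i <= 1) -> 0 <= mean M f <= 1.
Proof.
move=> f01; case: M => [|M]; first by rewrite /mean big_geq// mul0r lexx ler01.
rewrite divr_ge0 ?sumr_ge0//=; last by move=> i _; case/andP: (f01 i).
rewrite ler_pdivrMr ?ltr0n// mul1r.
apply: (@le_trans _ _ (\sum_(0 <= i < M.+1) 1)).
  by apply: ler_sum => i _; case/andP: (f01 i).
by rewrite big_const_nat iter_addr_0 subn0.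
Qed.

Lemma mean_exchange M q (F : nat -> nat -> R) :
  mean M (fun i => mean q (fun j => F i j)) =
  mean q (fun j => mean M (fun i => F i j)).
Proof.
rewrite /mean -!mulr_suml exchange_big/= -!mulrA; congr (_ * _).
by rewrite mulrC.
Qed.

(** Over one full period the deviations from the mean cancel, so only an
incomplete last period contributes. *)
Lemma periodic_discrepancy M f K : (0 < M)%N -> nat_periodic M f ->
  (forall i, 0 <= f i <= 1) ->
  `|\sum_(1 <= i < K) (f i - mean M f)| <= M%:R + 1.
Proof.
move=> M0 pf f01; set m := mean M f.
have m01 : 0 <= m <= 1 by exact: mean_itv.
have d1 i : `|f i - m| <= 1.
  by rewrite ler_norml; have := f01 i; move: m01; lra.
have D0 : \sum_(0 <= i < M) (f i - m) = 0.
  rewrite sumrB big_const_nat subn0 iter_addr_0 -[m *+ M]mulr_natr /m /mean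
    divfK.
    by rewrite subrr.
  by rewrite pnatr_eq0; lia.
have D n : `|\sum_(0 <= i < n) (f i - m)| <= M%:R.
  elim/ltn_ind: n => n IH; have [nM|Mn] := leqP n M.
    apply: le_trans (ler_norm_sum _ _ _) _.
    apply: (@le_trans _ _ (\sum_(0 <= i < n) 1)); first exact: ler_sum.
    by rewrite big_const_nat iter_addr_0 subn0 ler_nat.
  rewrite (big_cat_nat _ (n := M))//=; last exact: ltnW.
  rewrite D0 add0r -{1}[M]add0n big_addn.
  under eq_bigr do rewrite pf.
  by apply: IH; lia.
case: K => [|K]; first by rewrite big_geq// normr0 addr_ge0.
have := D K.+1; rewrite big_ltn// => DK.
rewrite -[X in `|X|](addKr (f 0%N - m)).
apply: le_trans (ler_normD _ _) _; rewrite normrN addrC.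
exact: lerD.
Qed.

Lemma sum_nat_le_real (V : nmodType) (F : nat -> V) (K : nat) (Y : R) :
  0 <= Y -> Y <= K%:R ->
  \sum_(1 <= v < K.+1 | v%:R <= Y) F v = \sum_(1 <= v < (Num.truncn Y).+1) F v.
Proof.
move=> Y0 YK.
have tK : (Num.truncn Y <= K)%N.
  by rewrite -(ler_nat R) (le_trans _ YK)// truncn_le.
rewrite (big_cat_nat _ (n := (Num.truncn Y).+1))//=.
have -> : \sum_((Num.truncn Y).+1 <= i < K.+1 | i%:R <= Y) F i = 0.
  rewrite big_nat_cond big1// => i /andP[/andP[ti _]].
  by rewrite -truncn_ge_nat// leqNgt ti.
rewrite addr0.
rewrite big_nat_cond [RHS]big_nat_cond; apply: eq_bigl => i.
rewrite andbT; apply: andb_idr => /andP[_]; rewrite ltnS => it.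
by rewrite -truncn_ge_nat.
Qed.

Lemma periodic_count M f K (Y : R) : (0 < M)%N -> nat_periodic M f ->
  (forall i, 0 <= f i <= 1) -> 0 <= Y -> Y <= K%:R ->
  `|\sum_(1 <= v < K.+1 | v%:R <= Y) f v - mean M f * Y| <= M%:R + 2.
Proof.
move=> M0 pf f01 Y0 YK; rewrite sum_nat_le_real//.
have := @periodic_discrepancy M f (Num.truncn Y).+1 M0 pf f01.
rewrite sumrB big_const_nat subn1/= iter_addr_0 -[_ *+ Num.truncn Y]mulr_natr.
set S := \sum_(_ <= _ < _) _; set m := mean M f => H.
have m01 : 0 <= m <= 1 by exact: mean_itv.
have -> : S - m * Y = (S - m * (Num.truncn Y)%:R) - m * (Y - (Num.truncn Y)%:R).
  by ring.
apply: le_trans (ler_normB _ _) _.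
have -> : M%:R + 2 = (M%:R + 1) + 1 :> R by ring.
apply: lerD => //.
have := @truncn_itv R Y Y0; rewrite -natr1 => /andP[t1 t2].
rewrite ger0_norm; first by case/andP: m01 => a b; nra.
by case/andP: m01 => a b; rewrite mulr_ge0// subr_ge0.
Qed.

Lemma sum_nat_blocks (V : nmodType) (F : nat -> V) M q :
  \sum_(0 <= i < M * q) F i =
  \sum_(0 <= b < q) \sum_(0 <= a < M) F (a + M * b)%N.
Proof.
elim: q => [|q IH]; first by rewrite muln0 !big_geq.
rewrite big_nat_recr//= -IH mulnS addnC.
rewrite (big_cat_nat _ (n := (M * q)%N)) ?leq_addr//=; congr (_ + _).
by rewrite -{1}[(M * q)%N]add0n big_addn addKn.
Qed.

(** Chinese remaindering: [b |-> a + M * b] permutes the residues mod [q]. *)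
Lemma mean_coprime M q f g : (0 < M)%N -> (0 < q)%N -> coprime M q ->
  nat_periodic M f -> nat_periodic q g ->
  mean (M * q) (fun i => f i * g i) = mean M f * mean q g.
Proof.
move=> M0 q0 cMq pf pg; rewrite /mean sum_nat_blocks exchange_big/=.
have E a : \sum_(0 <= b < q) g (a + M * b)%N = \sum_(0 <= b < q) g b.
  rewrite !big_mkord.
  have lt b : ((a + M * b) %% q < q)%N by rewrite ltn_mod.
  pose s (b : 'I_q) := Ordinal (lt b).
  have sI : injective s.
    move=> b c /(congr1 val)/= /eqP; rewrite eqn_modDl.
    have [bc|cb] := leqP b c.
      rewrite eq_sym eqn_mod_dvd ?leq_mul2l ?bc ?orbT// -mulnBr.
      rewrite Gauss_dvdr 1?coprime_sym// => d.
      apply/val_inj => /=; have := ltn_ord c.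
      have [|cb0 _] := posnP (c - b)%N; first by lia.
      by have := dvdn_leq cb0 d; have := ltn_ord c; lia.
    rewrite eqn_mod_dvd ?leq_mul2l ?(ltnW cb) ?orbT// -mulnBr.
    rewrite Gauss_dvdr 1?coprime_sym// => d.
    have cb0 : (0 < b - c)%N by lia.
    by have := dvdn_leq cb0 d; have := ltn_ord b; lia.
  rewrite [RHS](reindex_inj sI); apply: eq_bigr => b _ /=.
  by rewrite nat_periodic_mod.
transitivity ((\sum_(0 <= a < M) f a * \sum_(0 <= b < q) g b) / (M * q)%:R).
  congr (_ / _); apply: eq_bigr => a _; rewrite -(E a) mulr_sumr.
  by apply: eq_bigr => b _; rewrite (nat_periodicM _ pf).
by rewrite -mulr_suml natrM invfM; ring.
Qed.

Definition mean3 M h : R :=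
  mean M (fun w => mean M (fun u => mean M (fun v => h u v w))).

Definition periodic3 M h := [/\ forall v w, nat_periodic M (fun u => h u v w),
  forall u w, nat_periodic M (fun v => h u v w) &
  forall u v, nat_periodic M (fun w => h u v w)].

Lemma mean3_coprime M q (F G : nat -> nat -> nat -> R) :
  (0 < M)%N -> (0 < q)%N -> coprime M q -> periodic3 M F -> periodic3 q G ->
  mean3 (M * q) (fun u v w => F u v w * G u v w) = mean3 M F * mean3 q G.
Proof.
move=> M0 q0 cMq [F1 F2 F3] [G1 G2 G3]; rewrite /mean3.
transitivity (mean (M * q) (fun w => mean (M * q) (fun u =>
    mean M (fun v => F u v w) * mean q (fun v => G u v w)))).
  by apply: eq_mean => w; apply: eq_mean => u; apply: mean_coprime.
transitivity (mean (M * q) (fun w =>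
    mean M (fun u => mean M (fun v => F u v w)) *
    mean q (fun u => mean q (fun v => G u v w)))).
  apply: eq_mean => w; apply: mean_coprime => // i.
    by apply: eq_mean => v; apply: F1.
  by apply: eq_mean => v; apply: G1.
apply: mean_coprime => // i.
  by apply: eq_mean => u; apply: eq_mean => v; apply: F3.
by apply: eq_mean => u; apply: eq_mean => v; apply: G3.
Qed.

Lemma mean_dvd d q : (0 < d)%N -> (0 < q)%N ->
  mean (d * q) (fun i => (d %| i)%N%:R) = d%:R^-1.
Proof.
move=> d0 q0; rewrite /mean sum_nat_blocks.
have E b : \sum_(0 <= a < d) (d %| a + d * b)%N%:R = 1 :> R.
  rewrite big_ltn// add0n dvdn_mulr// big_nat big1 ?addr0// => a /andP[a0 ad].
  by rewrite dvdn_addl ?dvdn_mulr// gtnNdvd.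
rewrite (eq_bigr _ (fun b _ => E b)) big_const_nat subn0 iter_addr_0.
by rewrite natrM invfM mulrCA mulfV ?mulr1// pnatr_eq0; lia.
Qed.

End periodic.

Section sieve.
Variable R : realType.

(** The condition at [p] for [u], [v], [w] to be squarefree and pairwise
coprime. *)
Definition loc (p u v w : nat) : bool :=
  [&& ~~ (p ^ 2 %| u), ~~ (p ^ 2 %| v), ~~ (p ^ 2 %| w),
      ~~ ((p %| u) && (p %| v)), ~~ ((p %| v) && (p %| w)) &
      ~~ ((p %| u) && (p %| w))]%N.

Definition sieve (z u v w : nat) : bool :=
  all (fun p => prime p ==> loc p u v w) (iota 0 z).

Definition good (u v w : nat) : bool :=
  `[< forall p, prime p -> loc p u v w >].

Definition modulus (z : nat) : nat := (\prod_(0 <= p < z | prime p) p ^ 2)%N.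

Lemma sieveS z u v w :
  sieve z.+1 u v w = sieve z u v w && (prime z ==> loc z u v w).
Proof. by rewrite /sieve -addn1 iotaD all_cat/= andbT. Qed.

Lemma modulusS z :
  modulus z.+1 = (modulus z * (if prime z then z ^ 2 else 1))%N.
Proof. by rewrite /modulus big_mkcond big_nat_recr//= -big_mkcond. Qed.

Lemma modulus_gt0 z : (0 < modulus z)%N.
Proof.
by rewrite prodn_cond_gt0// => p /prime_gt0 p0; rewrite expn_gt0 p0.
Qed.

Lemma coprime_modulus z : prime z -> coprime (modulus z) (z ^ 2).
Proof.
move=> pz; rewrite coprimeXr// /modulus big_nat_cond.
elim/big_ind: _ => [|a b ca cb|p /andP[/andP[_ pz'] pp]];
  first exact: coprime1n.
  by rewrite coprimeMl ca.
by rewrite coprimeXl// prime_coprime// dvdn_prime2// neq_ltn pz'.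
Qed.

Lemma loc_periodic p : periodic3 (p ^ 2) (fun u v w => (loc p u v w)%:R : R).
Proof.
have E a : (p %| a + p ^ 2)%N = (p %| a)%N by rewrite dvdn_addl// dvdn_exp.
have E2 a : (p ^ 2 %| a + p ^ 2)%N = (p ^ 2 %| a)%N by rewrite dvdn_addl.
by split=> a b i; rewrite /loc !E !E2.
Qed.

Lemma sieve_periodic z :
  periodic3 (modulus z) (fun u v w => (sieve z u v w)%:R : R).
Proof.
elim: z => [|z [I1 I2 I3]]; first by split.
rewrite modulusS; have [L1 L2 L3] := loc_periodic z.
have E u v w : (sieve z.+1 u v w)%:R =
    (sieve z u v w)%:R * (prime z ==> loc z u v w)%:R :> R.
  by rewrite sieveS -natrM mulnb.
split=> a b i; rewrite !E.
- rewrite (nat_periodicM _ (I1 a b)); congr (_ * _); case: ifP => //= _.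
  by rewrite mulnC (nat_periodicM _ (L1 a b)).
- rewrite (nat_periodicM _ (I2 a b)); congr (_ * _); case: ifP => //= _.
  by rewrite mulnC (nat_periodicM _ (L2 a b)).
- rewrite (nat_periodicM _ (I3 a b)); congr (_ * _); case: ifP => //= _.
  by rewrite mulnC (nat_periodicM _ (L3 a b)).
Qed.

(** Either [p] divides none of [u], [v], [w], or it divides exactly one of them
and divides that one exactly once. With [y = p^-1] the proportion of such
residues is [(1 - y)^3 + 3 (y - y^2) (1 - y)^2 = (1 - y)^3 (1 + 3 y)]. *)
Lemma mean3_loc p : prime p ->
  mean3 (p ^ 2) (fun u v w => (loc p u v w)%:R : R) = C4_factor R p.
Proof.
move=> pp; have p0 := prime_gt0 pp.
pose s a : R := 1 + - 1 * (p %| a)%N%:R.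
pose t a : R := (p %| a)%N%:R + - 1 * (p ^ 2 %| a)%N%:R.
have ms : mean (p ^ 2) s = 1 - p%:R^-1.
  by rewrite /s meanD mean_const ?expn_gt0 ?p0// meanZ mulN1r -mulnn mean_dvd.
have mt : mean (p ^ 2) t = p%:R^-1 - (p%:R ^+ 2)^-1.
  rewrite /t meanD meanZ mulN1r -{1}mulnn mean_dvd//.
  by rewrite -[X in mean X _]muln1 mean_dvd ?expn_gt0 ?p0// natrX.
have E u v w : (loc p u v w)%:R =
    s u * s w * s v + t u * s w * s v + (s u * t w * s v + s u * s w * t v).
  (* [s]: prime to [p]; [t]: divisible by [p] but not by [p ^ 2] *)
  have D a : (p ^ 2 %| a)%N -> (p %| a)%N by apply: dvdn_trans;
    rewrite dvdn_exp.
  rewrite /s /t /loc; move: (D u) (D v) (D w).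
  case: (p ^ 2 %| u)%N => [/(_ isT)->|_];
    case: (p ^ 2 %| v)%N => [/(_ isT)->|_];
  case: (p ^ 2 %| w)%N => [/(_ isT)->|_]; rewrite ?andbF ?andbT/=;
  try case: (p %| u)%N; try case: (p %| v)%N; try case: (p %| w)%N => /=; ring.
rewrite /mean3.
under eq_mean => w do under eq_mean => u do
  (rewrite (eq_mean _ (E u ^~ w)) !meanD !meanZ ms mt).
under eq_mean => w do (rewrite !meanD !meanZr ms mt).
rewrite !meanD !(meanZr, meanZ) ms mt /C4_factor.
have : p%:R != 0 :> R by rewrite pnatr_eq0; lia.
by move: (p%:R : R) => x x0; field.
Qed.

Lemma mean3_sieve z :
  mean3 (modulus z) (fun u v w => (sieve z u v w)%:R : R) = C4_partial R z.
Proof.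
elim: z => [|z IH].
  rewrite /C4_partial big_geq// /modulus big_geq// /mean3.
  by rewrite /mean !big_nat1 !divr1.
rewrite modulusS /C4_partial big_mkcond big_nat_recr//= -big_mkcond/=.
rewrite -/(C4_partial R z) -IH.
have E u v w : (sieve z.+1 u v w)%:R =
    (sieve z u v w)%:R * (prime z ==> loc z u v w)%:R :> R.
  by rewrite sieveS -natrM mulnb.
case: ifP => [pz|npz].
  rewrite -mean3_loc// -mean3_coprime ?modulus_gt0 ?expn_gt0 ?prime_gt0//.
  - rewrite /mean3; apply: eq_mean => w; apply: eq_mean => u.
    by apply: eq_mean => v; rewrite E pz.
  - exact: coprime_modulus.
  - exact: sieve_periodic.
  - exact: loc_periodic.
rewrite muln1 mulr1 /mean3; apply: eq_mean => w; apply: eq_mean => u.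
by apply: eq_mean => v; rewrite E npz mulr1.
Qed.

Definition dvd3 (d1 d2 d3 u v w : nat) : R :=
  [&& d1 %| u, d2 %| v & d3 %| w]%N%:R.

Definition bad (p u v w : nat) : R :=
  dvd3 (p ^ 2) 1 1 u v w + dvd3 1 (p ^ 2) 1 u v w + dvd3 1 1 (p ^ 2) u v w +
  dvd3 p p 1 u v w + dvd3 1 p p u v w + dvd3 p 1 p u v w.

Lemma bad_ge0 p u v w : 0 <= bad p u v w.
Proof. by rewrite /bad !addr_ge0// /dvd3. Qed.

Lemma loc_bad p u v w : ~~ loc p u v w -> 1 <= bad p u v w.
Proof.
rewrite /loc /bad /dvd3 !dvd1n !andbT !andTb.
case: (p ^ 2 %| u)%N; case: (p ^ 2 %| v)%N; case: (p ^ 2 %| w)%N;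
  case: (p %| u)%N; case: (p %| v)%N; case: (p %| w)%N => //= _; lra.
Qed.

Lemma sieve_diff z z' u v w : (z <= z')%N ->
  (sieve z u v w)%:R - (sieve z' u v w)%:R <=
  \sum_(z <= p < z') bad p u v w.
Proof.
move=> /subnKC <-; elim: (z' - z)%N => [|k IH].
  by rewrite addn0 big_geq// subrr.
rewrite addnS big_nat_recr ?leq_addr//= sieveS.
case: (boolP (prime (z + k) ==> loc (z + k) u v w)) => [_|].
  by rewrite andbT (le_trans IH)// lerDl bad_ge0.
rewrite negb_imply => /andP[_ /loc_bad b1]; rewrite andbF subr0.
apply: (@le_trans _ _ 1); first by rewrite lern1 leq_b1.
by rewrite (le_trans b1)// lerDr sumr_ge0// => i _; exact: bad_ge0.
Qed.

Lemma sieve_le z z' u v w : (z <= z')%N -> sieve z' u v w -> sieve z u v w.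
Proof.
move=> zz' /allP h; apply/allP => p; rewrite mem_iota => /andP[_ pz].
by apply: h; rewrite mem_iota/=; rewrite !add0n in pz *; lia.
Qed.

Lemma goodE K u v w : (0 < u <= K)%N -> (0 < v <= K)%N -> (0 < w <= K)%N ->
  good u v w = sieve K.+1 u v w.
Proof.
move=> u0 v0 w0; apply/asboolP/allP => [h p _|h p pp]; first exact/implyP/h.
have [pK|Kp] := leqP p K.
  by have := h p; rewrite mem_iota add0n ltnS pK => /(_ isT)/implyP; apply.
have nd a : (0 < a <= K)%N -> (p %| a)%N = false.
  by move=> /andP[a0 aK]; apply/negbTE; rewrite gtnNdvd//; lia.
have nd2 a : (0 < a <= K)%N -> (p ^ 2 %| a)%N = false.
  move=> aK; apply: contraFF (nd a aK); apply: dvdn_trans; exact: dvdn_exp.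
by rewrite /loc !nd// !nd2.
Qed.

Definition box (K : nat) (P : nat -> nat -> nat -> bool)
    (h : nat -> nat -> nat -> R) : R :=
  \sum_(1 <= w < K.+1) \sum_(1 <= u < K.+1) \sum_(1 <= v < K.+1)
    (P u v w)%:R * h u v w.

Lemma box_le K P (h h' : nat -> nat -> nat -> R) :
  (forall u v w, (0 < u <= K)%N -> (0 < v <= K)%N -> (0 < w <= K)%N ->
     P u v w = true -> h u v w <= h' u v w) -> box K P h <= box K P h'.
Proof.
move=> hh; rewrite /box !big_nat; apply: ler_sum => w w1.
rewrite !big_nat; apply: ler_sum => u u1; rewrite !big_nat;
  apply: ler_sum => v v1.
case: (boolP (P u v w)) => p; last by rewrite !mul0r.
by rewrite !mul1r hh.
Qed.

Lemma boxD K P (h h' : nat -> nat -> nat -> R) :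
  box K P (fun u v w => h u v w + h' u v w) = box K P h + box K P h'.
Proof.
rewrite /box -big_split; apply: eq_bigr => w _ /=; rewrite -big_split.
apply: eq_bigr => u _ /=; rewrite -big_split; apply: eq_bigr => v _ /=.
by rewrite mulrDr.
Qed.

Lemma box_sum K P z z' (h : nat -> nat -> nat -> nat -> R) :
  box K P (fun u v w => \sum_(z <= p < z') h p u v w) =
  \sum_(z <= p < z') box K P (h p).
Proof.
rewrite /box [RHS]exchange_big; apply: eq_bigr => w _ /=.
rewrite [RHS]exchange_big; apply: eq_bigr => u _ /=.
rewrite [RHS]exchange_big; apply: eq_bigr => v _ /=.
by rewrite mulr_sumr.
Qed.

(** Sieving a weighted box only by the primes below [z] overcounts by at most
[6 B / (z - 1)], the six ways of failing at [p] having density [p ^- 2]. *)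
Lemma sieve_box K P z (B : R) : (1 < z)%N -> (z <= K.+1)%N -> 0 <= B ->
  (forall d1 d2 d3, (0 < d1)%N -> (0 < d2)%N -> (0 < d3)%N ->
     box K P (dvd3 d1 d2 d3) <= B / (d1%:R * d2%:R * d3%:R)) ->
  box K P (fun u v w => (sieve z u v w)%:R) - 6 * B / z.-1%:R <=
  box K P (fun u v w => (good u v w)%:R) <=
  box K P (fun u v w => (sieve z u v w)%:R).
Proof.
move=> z1 zK B0 hB; apply/andP; split; last first.
  apply: box_le => u v w u1 v1 w1 _; rewrite (goodE u1 v1 w1) ler_nat.
  case: (boolP (sieve K.+1 u v w)) => // /(sieve_le zK) ->//.
rewrite lerBlDr.
apply: (@le_trans _ _ (box K P (fun u v w =>
    (good u v w)%:R + \sum_(z <= p < K.+1) bad p u v w))).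
  apply: box_le => u v w u1 v1 w1 _; rewrite (goodE u1 v1 w1).
  by rewrite addrC -lerBlDr sieve_diff.
rewrite boxD lerD2l box_sum.
apply: (@le_trans _ _ (\sum_(z <= p < K.+1) 6 * B * (p%:R ^+ 2)^-1));
  last first.
  by rewrite -mulr_sumr ler_wpM2l ?mulr_ge0// sum_inv2.
rewrite !big_nat; apply: ler_sum => p /andP[zp _].
have p0 : (0 < p)%N by lia.
have p20 : (0 < p ^ 2)%N by rewrite expn_gt0 p0.
rewrite /bad !boxD.
have i1 : (0 < 1)%N by [].
have := hB _ _ _ p20 i1 i1; have := hB _ _ _ i1 p20 i1.
have := hB _ _ _ i1 i1 p20; have := hB _ _ _ p0 p0 i1.
have := hB _ _ _ i1 p0 p0; have := hB _ _ _ p0 i1 p0.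
rewrite !mulr1 !mul1r natrX -!expr2.
set X := B / _; rewrite -mulrA -/X; lra.
Qed.

End sieve.

(** * Counting triples in the region [u < w], [u w^3 v^2 <= kappa] *)

Section region.
Variable R : realType.
Implicit Types (kappa : R) (K M : nat).

Definition reg kappa (u v w : nat) : bool :=
  (u < w)%N && ((u * w ^ 3 * v ^ 2)%:R <= kappa).

Definition pw32 (w : nat) : R := w%:R * Num.sqrt w%:R.

Definition vmax kappa (u w : nat) : R :=
  Num.sqrt kappa * ((pw32 w)^-1 * (Num.sqrt u%:R)^-1).

Lemma pw32_gt0 w : (0 < w)%N -> 0 < pw32 w.
Proof. by move=> w0; rewrite mulr_gt0 ?sqrtr_gt0 ?ltr0n. Qed.

Lemma pw32_ge0 w : 0 <= pw32 w.
Proof. by rewrite mulr_ge0 ?sqrtr_ge0. Qed.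

Lemma pw32_ge1 w : (0 < w)%N -> 1 <= pw32 w.
Proof. by move=> w0; rewrite mulr_ege1 ?ler1n ?sqrt_nat_ge1. Qed.

Lemma pw32_sqr w : pw32 w ^+ 2 = w%:R ^+ 3.
Proof. by rewrite exprMn sqr_sqrtr// -exprSr. Qed.

Lemma vmax_ge0 kappa u w : 0 <= vmax kappa u w.
Proof. by rewrite !mulr_ge0 ?invr_ge0 ?pw32_ge0 ?sqrtr_ge0. Qed.

Lemma regE kappa u v w : 0 <= kappa -> (0 < u)%N -> (0 < w)%N ->
  reg kappa u v w = (u < w)%N && (v%:R <= vmax kappa u w).
Proof.
move=> k0 u0 w0; rewrite /reg; congr (_ && _).
have su : 0 < Num.sqrt (u%:R : R) by rewrite sqrtr_gt0 ltr0n.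
rewrite /vmax -invfM ler_pdivlMr ?mulr_gt0 ?pw32_gt0 ?ltr0n ?sqrtr_gt0 ?ltr0n//.
rewrite -[RHS]ler_sqr ?nnegrE ?sqrtr_ge0 ?mulr_ge0 ?pw32_ge0 ?sqrtr_ge0//.
rewrite [X in _ = (_ <= X)]sqr_sqrtr// [X in _ = (X <= _)]exprMn.
rewrite [X in _ * X]exprMn pw32_sqr sqr_sqrtr//.
by rewrite (natrM _ (u * _)) (natrM _ u) !natrX; congr (_ <= _); ring.
Qed.

Lemma sum_lt (V : nmodType) (f : nat -> V) w K : (w <= K)%N ->
  \sum_(1 <= u < K.+1 | (u < w)%N) f u = \sum_(1 <= u < w) f u.
Proof. by move=> wK; rewrite [RHS](big_nat_widen _ _ K.+1) ?leqW. Qed.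

Lemma eq_ler (x y : R) : x = y -> x <= y. Proof. by move->. Qed.

(** The number of [v] is at most [vmax kappa u w], even where this is less
than 1; summed over [u < w] and then over [w], these bounds make a harmonic sum,
and each divisibility condition divides its own sum. *)
Lemma box_reg_multiples kappa K d1 d2 d3 : 0 <= kappa ->
  (0 < d1)%N -> (0 < d2)%N -> (0 < d3)%N ->
  box K (reg kappa) (@dvd3 R d1 d2 d3) <=
  2 * Num.sqrt kappa * harm R K / (d1%:R * d2%:R * d3%:R).
Proof.
move=> k0 d10 d20 d30; set s := Num.sqrt kappa.
have s0 : 0 <= s by exact: sqrtr_ge0.
have d1' : 0 < d1%:R :> R by rewrite ltr0n.
have d2' : 0 < d2%:R :> R by rewrite ltr0n.
have d3' : 0 < d3%:R :> R by rewrite ltr0n.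
apply: (@le_trans _ _ (\sum_(1 <= w < K.+1 | (d3 %| w)%N)
    s / d2%:R * (2 / d1%:R) * w%:R^-1)); last first.
  rewrite -mulr_sumr; apply: le_trans (ler_wpM2l _ (harm_multiples _ K d30)) _.
    by rewrite !mulr_ge0 ?invr_ge0.
  by apply: eq_ler; field; rewrite !gt_eqF.
rewrite /box [leRHS]big_mkcond !big_nat; apply: ler_sum => w /andP[w0 wK].
have [d3w|nd3w] := boolP (d3 %| w)%N; last first.
  rewrite big1// => u _; rewrite big1// => v _.
  by rewrite /dvd3 (negbTE nd3w) !andbF mulr0.
have sw : 0 < Num.sqrt (w%:R : R) by rewrite sqrtr_gt0 ltr0n.
have w0' : 0 < w%:R :> R by rewrite ltr0n.
apply: (@le_trans _ _ (\sum_(1 <= u < K.+1 | (u < w)%N)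
    if (d1 %| u)%N then s / d2%:R * (pw32 w)^-1 * (Num.sqrt u%:R)^-1 else 0)).
  rewrite [leRHS]big_mkcond !big_nat; apply: ler_sum => u /andP[u0 uK].
  have su : 0 < Num.sqrt (u%:R : R) by rewrite sqrtr_gt0 ltr0n.
  have [uw|nuw] := boolP (u < w)%N; last first.
    by rewrite big1// => v _; rewrite /reg (negbTE nuw) mul0r.
  have [d1u|nd1u] := boolP (d1 %| u)%N; last first.
    by rewrite big1// => v _; rewrite /dvd3 (negbTE nd1u) mulr0.
  apply: (@le_trans _ _ (vmax kappa u w / d2%:R)); last first.
    by apply: eq_ler; rewrite /vmax -/s; field; rewrite !gt_eqF ?pw32_gt0.
  apply: le_trans (count_multiples_le K d20 (vmax_ge0 kappa u w)).
  rewrite [leRHS]big_mkcond; apply: ler_sum => v _.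
  rewrite regE// uw /dvd3 d1u d3w/= andbT.
  by case: (d2 %| v)%N; rewrite ?mulr1 ?mulr0.
rewrite (@sum_lt _ _ w)// -big_mkcond/= -mulr_sumr.
case: w w0 wK d3w sw w0' => [//|w] w0 wK d3w sw w0'.
apply: le_trans (ler_wpM2l _ (sum_invsqrt_multiples _ w d10)) _.
  by rewrite !mulr_ge0 ?invr_ge0 ?pw32_ge0.
apply: (@le_trans _ _ (s / d2%:R * (pw32 w.+1)^-1 *
    (2 * Num.sqrt w.+1%:R / d1%:R))).
  apply: ler_wpM2l; first by rewrite !mulr_ge0 ?invr_ge0 ?pw32_ge0.
  by rewrite ler_pM2r ?invr_gt0// ler_pM2l// ler_sqrt ?ler_nat.
by apply: eq_ler; rewrite /pw32; field; rewrite !gt_eqF.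
Qed.

(** Points with [w > kappa ^ (1/4)]: here [u <= kappa / w ^ 3] is the stronger
constraint on [u], and the sum over [w] converges like [w ^ -3]. *)
Lemma box_reg_tail kappa K Q (h : nat -> nat -> nat -> R) :
  0 <= kappa -> (0 < Q)%N -> kappa <= (Q.+1)%:R ^+ 4 ->
  (forall u v w, 0 <= h u v w <= 1) ->
  \sum_(Q.+1 <= w < K.+1) \sum_(1 <= u < K.+1) \sum_(1 <= v < K.+1)
    (reg kappa u v w)%:R * h u v w <= 4 * Num.sqrt kappa.
Proof.
move=> k0 Q0 kQ h01; set s := Num.sqrt kappa.
have s0 : 0 <= s by exact: sqrtr_ge0.
have ss : s ^+ 2 = kappa by rewrite sqr_sqrtr.
apply: (@le_trans _ _ (\sum_(Q.+1 <= w < K.+1) 2 * kappa * (w%:R ^+ 3)^-1)).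
  rewrite !big_nat; apply: ler_sum => w /andP[Qw wK].
  have w0 : (0 < w)%N by lia.
  have pw0 := pw32_gt0 w0.
  have kw0 : 0 <= kappa / w%:R ^+ 3 by rewrite divr_ge0// exprn_ge0.
  apply: (@le_trans _ _ (\sum_(1 <= u < K.+1 | u%:R <= kappa / w%:R ^+ 3)
      s * (pw32 w)^-1 * (Num.sqrt u%:R)^-1)).
    rewrite [leRHS]big_mkcond !big_nat; apply: ler_sum => u /andP[u0 uK].
    case: ifPn => [uk|nuk].
      apply: (@le_trans _ _ (vmax kappa u w)); last by rewrite /vmax mulrA.
      apply: le_trans (count_le K (vmax_ge0 kappa u w)); apply: ler_sum => v _.
      rewrite regE//; case: (_ < _)%N; rewrite ?mul0r//=.
      by case: (v%:R <= vmax kappa u w); rewrite ?mul0r// mul1r;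
        case/andP: (h01 u v w).
    rewrite big_nat big1// => v /andP[v0 _]; case: (boolP (reg _ _ _ _));
      last first.
      by rewrite mul0r.
    move=> /andP[_ r]; case/negP: nuk; rewrite ler_pdivlMr ?exprn_gt0 ?ltr0n//.
    apply: le_trans r; rewrite -natrX -natrM ler_nat leq_pmulr// expn_gt0 v0//.
  apply: (@le_trans _ _ (s * (pw32 w)^-1 * (2 * (s * (pw32 w)^-1))));
    last first.
    apply: eq_ler; rewrite -pw32_sqr -ss; field; by rewrite gt_eqF.
  rewrite -mulr_sumr; apply: ler_wpM2l;
    first by rewrite mulr_ge0 ?invr_ge0 ?pw32_ge0.
  have -> : s * (pw32 w)^-1 = Num.sqrt (kappa / w%:R ^+ 3).
    rewrite -pw32_sqr sqrtrM// sqrtrV ?sqr_ge0// sqrtr_sqr ger0_norm//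
      pw32_ge0//.
  set Y := kappa / _; have [YK|KY] := leP Y K%:R.
    rewrite sum_nat_le_real//; apply: le_trans (sum_invsqrt_ub _ _) _.
    by rewrite ler_pM2l// ler_sqrt// truncn_le.
  apply: (@le_trans _ _ (2 * Num.sqrt K%:R)); last first.
    by rewrite ler_pM2l// ler_sqrt// ltW.
  apply: le_trans (sum_invsqrt_ub _ _); rewrite [leLHS]big_mkcond.
  by apply: ler_sum => u _; case: ifP => // _; rewrite invr_ge0 sqrtr_ge0.
rewrite -mulr_sumr; apply: le_trans (ler_wpM2l _ (sum_inv3 _ _ Q0)) _.
  by rewrite mulr_ge0.
have Q1 : 1 <= Q%:R :> R by rewrite ler1n.
have sQ : s <= (Q.+1)%:R ^+ 2.
  by rewrite -ler_sqr ?nnegrE ?exprn_ge0// ss -exprM.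
rewrite ler_pdivrMr ?mulr_gt0 ?ltr0n// -ss.
move: sQ; rewrite -natr1; move: (Q%:R) Q1 => x x1 sQ.
have h1 : s * s <= s * (x + 1) ^+ 2 by rewrite ler_wpM2l.
have h2 : 0 <= s * ((x - 1) * (x + 1)) by rewrite !mulr_ge0//; lra.
nra.
Qed.

(** The variables are averaged one at a time in the order [v], [u], [w].  Only
[w <= kappa ^ (1/4)] matters, so averaging over [v] costs [O(1)] for each of at
most [sqrt kappa] pairs [(u, w)]; the other two averages are weighted sums with
monotone weights, handled by [abel_bound].  The factor [1/2] is [2 / 4]: the
sum over [u < w] of [u ^ (-1/2)] gives [2 sqrt w],
  and the sum over [w] of [1 / w]
gives [ln kappa / 4]. *)
Lemma box_reg_mean M (h : nat -> nat -> nat -> R) : (0 < M)%N ->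
  periodic3 M h -> (forall u v w, 0 <= h u v w <= 1) ->
  exists2 C : R, 0 <= C & forall kappa K, 1 <= kappa -> kappa <= K%:R ->
  `|box K (reg kappa) h - mean3 M h / 2 * (Num.sqrt kappa * ln kappa)| <=
  C * Num.sqrt kappa.
Proof.
move=> M0 [pu pv pw] h01.
pose h1 u w := mean M (fun v => h u v w).
pose h2 w := mean M (fun u => h1 u w).
have h101 u w : 0 <= h1 u w <= 1 by apply: mean_itv => i; exact: h01.
have h201 w : 0 <= h2 w <= 1 by apply: mean_itv => i; exact: h101.
have mu01 : 0 <= mean M h2 <= 1 by exact: mean_itv.
have ph1 w : nat_periodic M (fun u => h1 u w).
  by move=> i; apply: eq_mean => v; exact: pu.
have ph2 : nat_periodic M h2.
  by move=> i; apply: eq_mean => u; apply: eq_mean => v; exact: pw.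
have mE : mean3 M h = mean M h2 by [].
exists (4 + (M%:R + 2) + 3 * (M%:R + 3) + (2 * (M%:R + 1) + 2)).
  by rewrite !addr_ge0 ?mulr_ge0 ?addr_ge0.
move=> kappa K k1 kK; rewrite mE; set mu := mean M h2 in mu01 *.
set s := Num.sqrt kappa.
have k0 : 0 <= kappa by lra.
have ss : s ^+ 2 = kappa by rewrite sqr_sqrtr.
have s1 : 1 <= s by rewrite -[leLHS]sqrtr1 ler_sqrt.
have s0 : 0 <= s by lra.
have sk : s <= kappa by rewrite -ss expr2 ler_peMr.
pose r := Num.sqrt s.
have rr : r ^+ 2 = s by rewrite sqr_sqrtr.
have r1 : 1 <= r by rewrite -[leLHS]sqrtr1 ler_sqrt.
have r0 : 0 <= r by lra.
have rs : r <= s by rewrite -rr expr2 ler_peMr.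
pose Q := Num.truncn r.
have /andP[Qr rQ] : Q%:R <= r < Q.+1%:R by exact: truncn_itv.
have Q0 : (0 < Q)%N by rewrite truncn_gt0.
have QK : (Q <= K)%N by rewrite -(ler_nat R); lra.
have r4 : r ^+ 4 = kappa by rewrite (exprM r 2 2) rr ss.
have kQ : kappa <= Q.+1%:R ^+ 4 by rewrite -r4 lerXn2r ?nnegrE// ltW.
rewrite {1}/box (big_cat_nat _ (n := Q.+1))//=.
set B1 := \sum_(1 <= w < Q.+1) _; set B2 := \sum_(Q.+1 <= w < K.+1) _.
have hB2 : `|B2| <= 4 * s.
  rewrite ger0_norm; first exact: box_reg_tail.
  apply: sumr_ge0 => w _; apply: sumr_ge0 => u _; apply: sumr_ge0 => v _.
  by rewrite mulr_ge0//; case/andP: (h01 u v w).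
pose A1 := \sum_(1 <= w < Q.+1) \sum_(1 <= u < w) h1 u w * vmax kappa u w.
have hA1 : `|B1 - A1| <= (M%:R + 2) * s.
  apply: (@le_trans _ _ (\sum_(1 <= w < Q.+1) \sum_(1 <= u < w) (M%:R + 2))).
    rewrite /B1 /A1 -sumrB; apply: le_trans (ler_norm_sum _ _ _) _.
    rewrite !big_nat; apply: ler_sum => w /andP[w0 wQ].
    have -> : \sum_(1 <= u < K.+1) \sum_(1 <= v < K.+1) (reg kappa u v w)%:R *
      h u v w
        = \sum_(1 <= u < w) \sum_(1 <= v < K.+1 | v%:R <= vmax kappa u w) h u v
          w.
      rewrite -(@sum_lt _ _ w K) ?(leq_trans _ QK)// [RHS]big_mkcond !big_nat.
      apply: eq_bigr => u /andP[u0 uK]; case: ifPn => [uw|nuw]; last first.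
        by rewrite big1// => v _; rewrite /reg (negbTE nuw) mul0r.
      rewrite [RHS]big_mkcond; apply: eq_bigr => v _; rewrite regE// uw/=.
      by case: ifP; rewrite ?mul1r ?mul0r.
    rewrite -sumrB; apply: le_trans (ler_norm_sum _ _ _) _.
    rewrite !big_nat; apply: ler_sum => u /andP[u0 uw].
    apply: periodic_count => //; first exact: vmax_ge0.
    apply: (le_trans _ kK); apply: (le_trans _ sk).
    rewrite /vmax -/s ler_piMr// -invfM invf_le1 ?mulr_gt0 ?pw32_gt0 ?sqrtr_gt0
      ?ltr0n//.
    by rewrite mulr_ege1 ?pw32_ge1 ?sqrt_nat_ge1.
  apply: (@le_trans _ _ (\sum_(1 <= w < Q.+1) (M%:R + 2) * Q%:R)).
    rewrite !big_nat; apply: ler_sum => w /andP[w0 wQ].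
    rewrite big_const_nat iter_addr_0 -[_ *+ _]mulr_natr ler_wpM2l ?addr_ge0//.
    by rewrite ler_nat leq_subLR add1n ltnW.
  rewrite big_const_nat iter_addr_0 subn1/= -[_ *+ Q]mulr_natr -mulrA.
  rewrite ler_wpM2l ?addr_ge0// -rr expr2; exact: ler_pM.
pose A2 := s * \sum_(1 <= w < Q.+1) 2 * h2 w * w%:R^-1.
have hA2 : `|A1 - A2| <= 3 * (M%:R + 3) * s.
  rewrite /A2 mulr_sumr /A1 -sumrB; apply: le_trans (ler_norm_sum _ _ _) _.
  apply: (@le_trans _ _ (\sum_(1 <= w < Q.+1) s * (M%:R + 3) * (pw32 w)^-1));
    last first.
    have -> : 3 * (M%:R + 3) * s = s * (M%:R + 3) * 3 by ring.
    rewrite -mulr_sumr ler_wpM2l ?mulr_ge0 ?addr_ge0//; exact: sum_inv32.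
  rewrite !big_nat; apply: ler_sum => w /andP[w0 wQ].
  have pw0 := pw32_gt0 w0; have sw1 := sqrt_nat_ge1 R w0.
  have sw0 : 0 < Num.sqrt (w%:R : R) by lra.
  have w0' : 0 < w%:R :> R by rewrite ltr0n.
  pose S := \sum_(1 <= u < w) h1 u w * (Num.sqrt u%:R)^-1.
  have -> : \sum_(1 <= u < w) h1 u w * vmax kappa u w = s * (pw32 w)^-1 * S.
    by rewrite /S mulr_sumr; apply: eq_bigr => u _; rewrite /vmax -/s; ring.
  have -> : s * (2 * h2 w * w%:R^-1) = s * (pw32 w)^-1 * (2 * h2 w * Num.sqrt
    w%:R).
    by rewrite /pw32; field; rewrite !gt_eqF.
  rewrite -mulrBr normrM [`|s * _|]ger0_norm ?mulr_ge0 ?invr_ge0 ?pw32_ge0//.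
  rewrite [leRHS]mulrAC ler_wpM2l ?mulr_ge0 ?invr_ge0 ?pw32_ge0//.
  pose T : R := \sum_(1 <= u < w) (Num.sqrt u%:R)^-1.
  have hS : `|S - h2 w * T| <= M%:R + 1.
    have -> : S - h2 w * T = \sum_(1 <= u < w) (h1 u w - h2 w) * (Num.sqrt
      u%:R)^-1.
      by rewrite /T mulr_sumr -sumrB; apply: eq_bigr => u _; rewrite mulrBl.
    have := @abel_bound R (fun u => h1 u w - h2 w) (fun u =>
      (Num.sqrt u%:R)^-1) (M%:R + 1).
    rewrite sqrtr1 invr1 mulr1; apply.
    - move=> k; apply: periodic_discrepancy => //; exact: ph1.
    - by move=> i _; rewrite invr_ge0 sqrtr_ge0.
    - move=> i i0; rewrite lef_pV2 ?posrE ?sqrtr_gt0 ?ltr0n//.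
      by rewrite ler_sqrt// ler_nat.
  have hT : `|T - 2 * Num.sqrt w%:R| <= 2.
    rewrite /T; case: (w) w0 => [//|w'] _.
    rewrite ler_norml; have := sum_invsqrt_ub R w'; have := sum_invsqrt_lb R w'.
    have : Num.sqrt (w'%:R : R) <= Num.sqrt w'.+1%:R by rewrite ler_sqrt
      ?ler_nat.
    lra.
  have -> : S - 2 * h2 w * Num.sqrt w%:R =
      (S - h2 w * T) + h2 w * (T - 2 * Num.sqrt w%:R) by ring.
  have -> : M%:R + 3 = (M%:R + 1) + 2 :> R by ring.
  apply: le_trans (ler_normD _ _) _; apply: lerD => //.
  have /andP[h20 h21] := h201 w.
  by rewrite normrM ger0_norm// -[leRHS]mul1r ler_pM.
pose A3 := s * (2 * mu * harm R Q).
have hA3 : `|A2 - A3| <= 2 * (M%:R + 1) * s.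
  have -> : A2 - A3 = s * 2 * \sum_(1 <= w < Q.+1) (h2 w - mu) * w%:R^-1.
    rewrite /A2 /A3 /harm -mulrBr [2 * mu * _]mulr_sumr -sumrB.
    rewrite -[s * 2 * _]mulrA; congr (_ * _).
    by rewrite mulr_sumr; apply: eq_bigr => w _; ring.
  rewrite normrM [`|s * 2|]ger0_norm ?mulr_ge0//.
  have -> : 2 * (M%:R + 1) * s = s * 2 * (M%:R + 1) by ring.
  apply: ler_wpM2l; first by rewrite mulr_ge0.
  have := @abel_bound R (fun w => h2 w - mu) (fun w => w%:R^-1) (M%:R + 1).
  rewrite invr1 mulr1; apply.
  - move=> k; apply: periodic_discrepancy => //.
  - by move=> i _; rewrite invr_ge0.
  - by move=> i i0; rewrite lef_pV2 ?posrE ?ltr0n// ler_nat.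
have lr : ln kappa = 4 * ln r by rewrite -r4 lnXn ?mulr_natl//; lra.
have hH : `|harm R Q - ln r| <= 1.
  rewrite ler_norml; apply/andP; split.
    have := ln_le_harm R Q.
    have : ln r <= ln (Q.+1%:R : R) by rewrite ler_ln ?posrE ?ltr0n//; lra.
    lra.
  have := harm_le_ln R Q0.
  have : ln (Q%:R : R) <= ln r by rewrite ler_ln ?posrE ?ltr0n//; lra.
  lra.
pose A4 := mu / 2 * (s * ln kappa).
have hA4 : `|A3 - A4| <= 2 * s.
  have -> : A3 - A4 = 2 * s * (mu * (harm R Q - ln r)).
    by rewrite /A3 /A4 lr; field.
  rewrite normrM [`|2 * s|]ger0_norm ?mulr_ge0// ler_piMr ?mulr_ge0//.
  case/andP: mu01 => mu0 mu1.
  by rewrite normrM ger0_norm// -[leRHS]mul1r ler_pM.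
rewrite -/A4.
have -> : B1 + B2 - A4 = B2 + ((B1 - A1) + ((A1 - A2) + ((A2 - A3) + (A3 -
  A4)))).
  by ring.
move: hB2 hA1 hA2 hA3 hA4; move: B1 B2 A1 A2 A3 A4 => b1 b2 a1 a2 a3 a4.
rewrite !ler_norml => /andP[? ?] /andP[? ?] /andP[? ?] /andP[? ?] /andP[? ?].
by apply/andP; split; lra.
Qed.

End region.

(** * The Basel problem *)

Section basel.
Variable R : realType.
Implicit Types (x y e : R) (K n : nat).

Definition zeta2_sum K : R := \sum_(1 <= i < K.+1) (i%:R ^+ 2)^-1.

Lemma zeta2_sumS K : zeta2_sum K.+1 = zeta2_sum K + (K.+1%:R ^+ 2)^-1.
Proof. by rewrite /zeta2_sum big_nat_recr. Qed.

Lemma zeta2_sum_le K n : (K <= n)%N -> zeta2_sum K <= zeta2_sum n.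
Proof.
move=> Kn; rewrite /zeta2_sum (big_cat_nat _ (n := K.+1) (p := n.+1))//=.
by rewrite lerDl sumr_ge0// => i _; rewrite invr_ge0 exprn_ge0.
Qed.

Lemma zeta2_sum_tail K n : (0 < K)%N -> zeta2_sum n <= zeta2_sum K + K%:R^-1.
Proof.
move=> K0; have [nK|Kn] := leqP n K.
  by apply: le_trans (zeta2_sum_le nK) _; rewrite lerDl invr_ge0.
rewrite {1}/zeta2_sum (big_cat_nat _ (n := K.+1) (p := n.+1))//=; last first.
  by rewrite ltnS ltnW.
by rewrite lerD2l; exact: (@sum_inv2 R K.+1 n.+1).
Qed.

Lemma nonneg_derivative_le (f df : R -> R) (a b : R) : a <= b ->
  (forall x, is_derive x 1 f (df x)) ->
  (forall x, a <= x <= b -> 0 <= df x) -> f a <= f b.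
Proof.
move=> ab fd df0.
have fc : {within `[a, b], continuous f}.
  apply: continuous_subspaceT => x.
  apply: differentiable_continuous; apply/derivable1_diffP.
  by have := fd x; case.
have [c cab E] := MVT_segment ab (fun x _ => fd x) fc.
rewrite -subr_ge0 E mulr_ge0 ?subr_ge0//; apply: df0.
by move: cab; rewrite in_itv.
Qed.

Lemma sin_le x : 0 <= x -> sin x <= x.
Proof.
move=> x0; pose f := (id - sin : R -> R).
have fd y : is_derive y 1 f (1 - cos y) by apply: is_derive_eq.
have : f 0 <= f x.
  by apply: (nonneg_derivative_le x0 fd) => y _; rewrite subr_ge0 cos_le1.
by rewrite /f /= !fctE /= sin0 subrr subr_ge0.
Qed.

Lemma xcos_le_sin x : 0 <= x <= pi -> x * cos x <= sin x.
Proof.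
move=> /andP[x0 xpi]; pose f := (sin - (id * cos) : R -> R).
have fd y : is_derive y 1 f (y * sin y).
  by apply: is_derive_eq; rewrite /GRing.scale/=; ring.
have : f 0 <= f x.
  apply: (nonneg_derivative_le x0 fd) => y /andP[y0 yx].
  by rewrite mulr_ge0// sin_ge0_pi// y0 (le_trans yx).
by rewrite /f /= !fctE /= sin0 mul0r subrr subr_ge0.
Qed.

Lemma inv_sin2_bounds x : 0 < x < pi / 2 ->
  (sin x ^+ 2)^-1 - 1 <= (x ^+ 2)^-1 <= (sin x ^+ 2)^-1.
Proof.
move=> x02; have /andP[x0 x2] := x02.
have pi0 := pi_gt0 R.
have s0 : 0 < sin x by exact: sin_gt0_pihalf.
have c0 : 0 < cos x by apply: cos_gt0_pihalf; lra.
apply/andP; split; last first.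
  rewrite lef_pV2 ?posrE ?exprn_gt0//.
  by rewrite lerXn2r ?nnegrE ?(ltW s0) ?(ltW x0)// sin_le// ltW.
have -> : (sin x ^+ 2)^-1 - 1 = (cos x / sin x) ^+ 2.
  rewrite expr_div_n cos2sin2 mulrBl divff ?mul1r// expf_eq0/= gt_eqF//.
have -> : (x ^+ 2)^-1 = (x^-1) ^+ 2 by rewrite exprVn.
rewrite lerXn2r ?nnegrE ?invr_ge0 ?divr_ge0 ?(ltW s0) ?(ltW c0) ?(ltW x0)//.
by rewrite ler_pdivrMr// mulrC ler_pdivlMr// mulrC xcos_le_sin// ltW//=; lra.
Qed.

Definition angle n k : R := (k.*2.+1)%:R * pi / 2 ^+ n.+2.

Lemma angle_itv n k : (k < 2 ^ n)%N -> 0 < angle n k < pi / 2.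
Proof.
move=> kn; have pi0 := pi_gt0 R; rewrite /angle.
have p0 m : 0 < 2 ^+ m :> R by exact: exprn_gt0.
apply/andP; split; first by rewrite divr_gt0 ?p0// mulr_gt0 ?ltr0n.
rewrite ltr_pdivrMr//.
have -> : pi / 2 * 2 ^+ n.+2 = 2 ^+ n.+1 * pi :> R by rewrite exprS; field.
by rewrite ltr_pM2r// -natrX ltr_nat expnS; lia.
Qed.

Definition inv_sin2_sum n :
  R := \sum_(0 <= k < 2 ^ n) (sin (angle n k) ^+ 2)^-1.

(** Halving the angle: [1 / sin^2 (2 y) = (1 / sin^2 y + 1 / cos^2 y) / 4], and
[cos y] is the sine of the complementary angle. *)
Lemma inv_sin2_sum_double n : inv_sin2_sum n.+1 = 4 * inv_sin2_sum n.
Proof.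
rewrite {1}/inv_sin2_sum expnS mul2n -addnn (big_cat_nat _ (n :=
  (2 ^ n)%N)) ?leq_addr//=.
have -> : \sum_(2 ^ n <= i < 2 ^ n + 2 ^ n) (sin (angle n.+1 i) ^+ 2)^-1 =
    \sum_(0 <= i < 2 ^ n) (sin (angle n.+1 (i + 2 ^ n)) ^+ 2)^-1.
  by rewrite -{1}[(2 ^ n)%N]add0n big_addn addnK.
rewrite [X in _ + X]big_nat_rev/= add0n -big_split/= /inv_sin2_sum mulr_sumr.
rewrite !big_nat; apply: eq_bigr => k kn.
have -> : angle n k = angle n.+1 k *+ 2.
  by rewrite /angle [2 ^+ n.+3]exprS; field; rewrite expf_neq0.
have -> : angle n.+1 (2 ^ n - k.+1 + 2 ^ n) = pi / 2 - angle n.+1 k.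
  rewrite /angle.
  have -> : ((2 ^ n - k.+1 + 2 ^ n).*2.+1)%:R = 2 ^+ n.+2 - (k.*2.+1)%:R :> R.
    apply/eqP; rewrite -subr_eq opprK eq_sym -natrX -natrD eqr_nat !expnS; lia.
  by rewrite [2 ^+ n.+3]exprS; field; rewrite expf_neq0.
have /andP[y0 y1] : 0 < angle n.+1 k < pi / 2 by apply: angle_itv;
  rewrite expnS; lia.
have pi0 := pi_gt0 R; set y := angle _ _ in y0 y1 *.
have s0 : 0 < sin y by apply: sin_gt0_pihalf; rewrite y0.
have c0 : 0 < cos y by apply: cos_gt0_pihalf; lra.
have -> : sin (pi / 2 - y) = cos y by rewrite -opprB sinN sinBpihalf opprK.
rewrite sin_mulr2n.
have := cos2Dsin2 y => cs.
apply: (mulIf (x := cos y ^+ 2 * sin y ^+ 2)).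
  by rewrite mulf_neq0// expf_neq0// gt_eqF.
transitivity (cos y ^+ 2 + sin y ^+ 2).
  by field; rewrite !gt_eqF.
by rewrite cs; field; rewrite !gt_eqF.
Qed.

Lemma inv_sin2_sumE n : inv_sin2_sum n = 2 * 4 ^+ n.
Proof.
elim: n => [|n IH]; last by rewrite inv_sin2_sum_double IH exprS; ring.
rewrite /inv_sin2_sum expn0 big_nat1 /angle expr0 mulr1 mul1r.
have -> : sin (pi / 2 ^+ 2) ^+ 2 = 2^-1 :> R.
  have h := cos_mulr2n (pi / 2 ^+ 2 : R).
  have e : pi / 2 ^+ 2 *+ 2 = pi / 2 :> R by field.
  have := cos2Dsin2 (pi / 2 ^+ 2 : R); move: h; rewrite e cos_pihalf.
  by move: (cos _) (sin _) => c s; lra.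
by rewrite invrK.
Qed.

Definition odd_sum n : R := \sum_(0 <= k < n) ((k.*2.+1)%:R ^+ 2)^-1.

Lemma odd_sum_bounds n :
  pi ^+ 2 / 8 - pi ^+ 2 / 16 / 2 ^+ n <= odd_sum (2 ^ n) <= pi ^+ 2 / 8.
Proof.
have pi0 := pi_gt0 R.
have p0 m : 0 < 2 ^+ m :> R by exact: exprn_gt0.
have E : odd_sum (2 ^ n) =
    pi ^+ 2 / 16 / 4 ^+ n * \sum_(0 <= k < 2 ^ n) (angle n k ^+ 2)^-1.
  rewrite /odd_sum mulr_sumr; apply: eq_bigr => k _; rewrite /angle.
  have -> : 4 ^+ n = 2 ^+ n ^+ 2 :> R by rewrite -exprM mulnC exprM;
    congr (_ ^+ _); ring.
  rewrite -[n.+2]addn2 exprD; have := p0 n; move: (2 ^+ n : R) => q q0.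
  have a0 : 0 < k.*2.+1%:R :> R by rewrite ltr0n.
  move: (k.*2.+1%:R : R) a0 (pi : R) pi0 => a a0 t t0.
  by field; rewrite !gt_eqF.
have lo : inv_sin2_sum n - 2 ^+ n <= \sum_(0 <= k < 2 ^ n) (angle n k ^+ 2)^-1.
  have -> : 2 ^+ n = \sum_(0 <= k < 2 ^ n) 1 :> R.
    by rewrite big_const_nat iter_addr_0 subn0 natrX.
  rewrite /inv_sin2_sum -sumrB !big_nat; apply: ler_sum => k kn.
  by case/andP: (inv_sin2_bounds (angle_itv kn)).
have hi : \sum_(0 <= k < 2 ^ n) (angle n k ^+ 2)^-1 <= inv_sin2_sum n.
  rewrite /inv_sin2_sum !big_nat; apply: ler_sum => k kn.
  by case/andP: (inv_sin2_bounds (angle_itv kn)).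
rewrite E; move: lo hi; rewrite inv_sin2_sumE.
have -> : 4 ^+ n = 2 ^+ n ^+ 2 :> R by rewrite -exprM mulnC exprM;
  congr (_ ^+ _); ring.
have := p0 n; move: (2 ^+ n : R) (\sum_(_ <= _ < _) _) => q X q0 lo hi.
have c0 : 0 <= pi ^+ 2 / 16 / q ^+ 2 :> R.
  by rewrite !divr_ge0 ?exprn_ge0 ?ltW.
apply/andP; split.
  apply: le_trans (ler_wpM2l c0 lo); rewrite le_eqVlt; apply/orP; left.
  by apply/eqP; field; rewrite gt_eqF.
apply: le_trans (ler_wpM2l c0 hi) _; rewrite le_eqVlt; apply/orP; left.
by apply/eqP; field; rewrite gt_eqF.
Qed.

Lemma zeta2_sum_double n : zeta2_sum n.*2 = odd_sum n + zeta2_sum n / 4.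
Proof.
elim: n => [|n IH]; first by rewrite /zeta2_sum /odd_sum !big_geq// mul0r addr0.
rewrite doubleS !zeta2_sumS IH /odd_sum big_nat_recr//=.
have -> : n.*2.+2%:R = 2 * n.+1%:R :> R by rewrite -natrM -mul2n mulnS.
have -> : ((2 * n.+1%:R) ^+ 2)^-1 = (n.+1%:R ^+ 2)^-1 / 4 :> R.
  by rewrite exprMn invfM mulrC; congr (_ * _^-1); ring.
by rewrite mulrDl; ring.
Qed.

Lemma zeta2_sum_exp : exists C : R, forall n,
  `|zeta2_sum (2 ^ n) - pi ^+ 2 / 6| <= C / 2 ^+ n.
Proof.
pose c : R := pi ^+ 2 / 16.
exists (4 * c + `|zeta2_sum 1 - pi ^+ 2 / 6|).
have c0 : 0 <= c by rewrite divr_ge0 ?exprn_ge0 ?pi_ge0.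
set e0 := `|_|; have e00 : 0 <= e0 by exact: normr_ge0.
elim=> [|n IH]; first by rewrite expr0 divr1 -/e0 lerDr mulr_ge0.
rewrite expnS mul2n zeta2_sum_double.
have p0 : 0 < 2 ^+ n :> R by exact: exprn_gt0.
move: IH (odd_sum_bounds n); rewrite -/c [2 ^+ n.+1]exprS invfM.
have -> : pi ^+ 2 / 8 = 2 * c by rewrite /c; field.
have -> : pi ^+ 2 / 6 = 8 / 3 * c by rewrite /c; field.
have t0 : 0 < (2 ^+ n)^-1 :> R by rewrite invr_gt0.
move: (2 ^+ n)^-1 (zeta2_sum _) (odd_sum _) t0 => t z o t0.
rewrite !ler_norml => /andP[z1 z2] /andP[lo hi].
have := mulr_ge0 e00 (ltW t0); have := mulr_ge0 c0 (ltW t0).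
move: z1 z2 lo hi; rewrite !mulrDl => z1 z2 lo hi h1 h2.
apply/andP; split; lra.
Qed.

(** Halving the angle repeatedly in [1 / sin^2] gives
[\sum_k 1 / sin^2 ((2 k + 1) pi / 2 ^ (n + 2)) = 2 * 4 ^ n], and [1 / sin^2 x]
is [1 / x^2] up to an error at most [1]. *)
Theorem basel K : (0 < K)%N ->
  zeta2_sum K <= pi ^+ 2 / 6 <= zeta2_sum K + K%:R^-1.
Proof.
move=> K0; have [C hC] := zeta2_sum_exp.
have approx e : 0 < e -> exists2 n,
  (K <= n)%N & `|zeta2_sum n - pi ^+ 2 / 6| <= e.
  move=> e0; pose m := maxn K (Num.truncn (C / e)).+1.
  exists (2 ^ m)%N.
    by apply: leq_trans (ltnW (ltn_expl m (ltnSn 1))); exact: leq_maxl.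
  apply: le_trans (hC m) _.
  rewrite ler_pdivrMr ?exprn_gt0// mulrC -ler_pdivrMr//.
  apply: (@le_trans _ _ m%:R); last by rewrite -natrX ler_nat ltnW// ltn_expl.
  apply: ltW; apply: lt_le_trans (truncnS_gt _) _.
  by rewrite ler_nat leq_maxr.
apply/andP; split; apply/ler_addgt0Pr => e /approx[n Kn]; rewrite ler_norml.
  by have := zeta2_sum_le Kn; lra.
by have := zeta2_sum_tail n K0; lra.
Qed.

End basel.

(** * The asymptotic count of quadruples *)

Section asymptotics.
Variable R : realType.

Lemma box_reg_lt1 (kappa : R) K (h : nat -> nat -> nat -> R) : kappa < 1 ->
  box K (reg kappa) h = 0.
Proof.
move=> k1; rewrite /box big_nat big1// => w /andP[w0 _].
rewrite big_nat big1// => u /andP[u0 _];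
  rewrite big_nat big1// => v /andP[v0 _].
case: (boolP (reg kappa u v w)) => [/andP[_]|]; last by rewrite mul0r.
rewrite leNgt (lt_le_trans k1)// ler1n.
by rewrite muln_gt0 [X in X && _]muln_gt0 !expn_gt0 u0 v0 w0.
Qed.

(** Since every [a] is uniquely [u v^2 w^3 x^4] with [u], [v], [w] squarefree
and pairwise coprime, this is the number of [a <= n] for which [u < w]. *)
Definition quad_count (n : nat) : R :=
  \sum_(1 <= x < n.+1)
    box n (reg (n%:R / x%:R ^+ 4 : R)) (fun u v w => (good u v w)%:R).

Lemma C4_partial_itv z : 0 <= C4_partial R z <= 1.
Proof.
rewrite -mean3_sieve; apply: mean_itv => w; apply: mean_itv => u.
by apply: mean_itv => v; rewrite ler0n lern1 leq_b1.
Qed.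

Lemma ln_le_sqrt (x : nat) : (0 < x)%N -> ln (x%:R : R) <= 2 * Num.sqrt x%:R.
Proof.
move=> x0; have s0 : 0 < Num.sqrt (x%:R : R) by rewrite sqrtr_gt0 ltr0n.
rewrite -{1}(sqrtS_natrK R x) lnXn// -[_ *+ 2]mulr_natl ler_wpM2l//.
have := le_ln1Dx (x := Num.sqrt (x%:R : R) - 1).
by rewrite addrCA subrr addr0 => /(_ _); rewrite ltrBrDr addNr => /(_ s0); lra.
Qed.

Lemma sum_ln_sqr X : \sum_(1 <= x < X.+1) (ln x%:R / x%:R ^+ 2) <= 6 :> R.
Proof.
apply: (@le_trans _ _ (\sum_(1 <= x < X.+1) 2 * (x%:R * Num.sqrt (x%:R :
  R))^-1)).
  rewrite !big_nat; apply: ler_sum => x /andP[x0 _].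
  have x0' : 0 < x%:R :> R by rewrite ltr0n.
  have s0 : 0 < Num.sqrt (x%:R : R) by rewrite sqrtr_gt0.
  rewrite ler_pdivrMr ?exprn_gt0//.
  apply: le_trans (ln_le_sqrt x0) _; apply: eq_ler.
  have := sqrtS_natrK R x; move: (Num.sqrt _) s0 => t t0 <-.
  by field; rewrite gt_eqF.
by rewrite -mulr_sumr; have := sum_inv32 R X; lra.
Qed.

Lemma zeta2_sum_le2 X : zeta2_sum R X <= 2.
Proof.
have := @zeta2_sum_tail R 1 X isT.
by rewrite /zeta2_sum big_nat1 expr1n invr1.
Qed.

(** With [kappa = n / x^4] the main term for [x] is
[sqrt n / x^2 * (ln n - 4 ln x) / 2] times the density, and the sum of
[ln x / x^2] converges, so summing over [x] replaces [x ^ -2] by [pi ^ 2 / 6].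
The sieve error stays proportional to [sqrt n * ln n], with a factor that is
small when [z] is large. *)
Lemma quad_count_sieve z : (1 < z)%N -> exists C : R, forall n,
  (0 < n)%N -> (z <= n.+1)%N ->
  `|quad_count n -
     C4_partial R z * (pi ^+ 2 / 12) * (Num.sqrt n%:R * ln n%:R)| <=
  Num.sqrt n%:R * (C + 24 / z.-1%:R * ln n%:R).
Proof.
move=> z1; have /andP[mu0 mu1] := C4_partial_itv z.
pose h u v w : R := (sieve z u v w)%:R.
have h01 u v w : 0 <= h u v w <= 1 by rewrite ler0n lern1 leq_b1.
have [C0 C00 hC0] := box_reg_mean (modulus_gt0 z) (sieve_periodic R z) h01.
rewrite mean3_sieve in hC0; set mu := C4_partial R z in mu0 mu1 hC0 *.
have z0 : 0 < z.-1%:R :> R by rewrite ltr0n; lia.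
exists (14 + 2 * C0 + 24 / z.-1%:R) => n n0 zn.
have n1 : 1 <= n%:R :> R by rewrite ler1n.
set s := Num.sqrt n%:R; have s0 : 0 <= s by exact: sqrtr_ge0.
set l := ln n%:R; have l0 : 0 <= l by exact: ln_ge0.
pose B x := box n (reg (n%:R / x%:R ^+ 4 : R)) (fun u v w =>
  (good u v w)%:R) : R.
pose X := Num.truncn (Num.sqrt s).
have s1 : 1 <= s by exact: sqrt_nat_ge1.
have ss : s ^+ 2 = n%:R by exact: sqrtS_natrK.
have rr : Num.sqrt s ^+ 2 = s by rewrite sqr_sqrtr.
have r1 : 1 <= Num.sqrt s by rewrite -[leLHS]sqrtr1 ler_sqrt.
have /andP[Xr rX] : X%:R <= Num.sqrt s < X.+1%:R by apply: truncn_itv; lra.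
have X0 : (0 < X)%N by rewrite truncn_gt0.
have r4 : Num.sqrt s ^+ 4 = n%:R by rewrite (exprM _ 2 2) rr ss.
have Xn : (X <= n)%N.
  rewrite -(ler_nat R) (le_trans Xr)// -r4; apply: ler_eXnr => //; lra.
(* [n / x ^ 4 < 1] for [x > X], which leaves an empty region *)
have TX : quad_count n = \sum_(1 <= x < X.+1) B x.
  rewrite /quad_count (big_cat_nat _ (n := X.+1))//= [X in _ + X]big_nat_cond.
  rewrite [X in _ + X]big1 ?addr0// => x /andP[/andP[Xx _] _].
  have x0 : (0 < x)%N by lia.
  apply: box_reg_lt1; rewrite ltr_pdivrMr ?exprn_gt0 ?ltr0n// mul1r -r4.
  rewrite ltrXn2r ?nnegrE ?sqrtr_ge0//; apply: (lt_le_trans rX).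
  by rewrite ler_nat.
pose H := harm R n.
have H0 : 0 <= H := harm_ge0 R n.
have Hl : H <= 1 + l by exact: harm_le_ln.
pose E := C0 + 12 / z.-1%:R * H.
have E0 : 0 <= E by rewrite addr_ge0// mulr_ge0// divr_ge0// ltW.
pose m x : R := mu / 2 * (s / x%:R ^+ 2 * (l - 4 * ln x%:R)).
have hB x : (0 < x)%N -> (x <= X)%N -> `|B x - m x| <= E * s * (x%:R ^+ 2)^-1.
  move=> x0 xX; have x0' : 0 < x%:R :> R by rewrite ltr0n.
  set k := n%:R / x%:R ^+ 4 : R.
  have x4 : 0 < x%:R ^+ 4 :> R by exact: exprn_gt0.
  have k1 : 1 <= k.
    rewrite ler_pdivlMr// mul1r -r4 lerXn2r ?nnegrE ?sqrtr_ge0//.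
    by apply: le_trans Xr; rewrite ler_nat.
  have kn : k <= n%:R.
    by rewrite ler_pdivrMr// ler_peMr// exprn_ege1// ler1n.
  have sk : Num.sqrt k = s / x%:R ^+ 2.
    by rewrite /k sqrtrM// sqrtrV ?(ltW x4)// (exprM _ 2 2) sqrtr_sqr ger0_norm.
  have lk : ln k = l - 4 * ln x%:R.
    rewrite /k ln_div ?posrE// ?lnXn// ?mulr_natl//; lra.
  have := hC0 k n k1 kn; rewrite sk lk -/(m x) => h1.
  have q0 : 0 <= 2 * Num.sqrt k * H by rewrite !mulr_ge0 ?sqrtr_ge0.
  have := @sieve_box R n (reg k) z (2 * Num.sqrt k * H) z1 zn q0
    (fun d1 d2 d3 => box_reg_multiples n (le_trans ler01 k1)).
  rewrite -/(B x) sk; move: h1; rewrite -/h.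
  have -> : E * s / x%:R ^+ 2 = C0 * (s / x%:R ^+ 2) +
    12 / z.-1%:R * H * (s / x%:R ^+ 2) by rewrite /E; ring.
  have -> : 6 * (2 * (s / x%:R ^+ 2) * H) / z.-1%:R =
     12 / z.-1%:R * H * (s * (x%:R ^+ 2)^-1) by field; rewrite !gt_eqF.
  have e0 : 0 <= 12 / z.-1%:R * H * (s * (x%:R ^+ 2)^-1).
    by rewrite !mulr_ge0 ?invr_ge0 ?exprn_ge0.
  move: e0; move: (12 / _ * _ * _) (C0 * _) (box _ _ _) (B x) (m x) =>
    a b c d e a0.
  by rewrite !ler_norml => /andP[? ?] /andP[? ?]; apply/andP; split; lra.
have hm : `|\sum_(1 <= x < X.+1) m x - mu * (pi ^+ 2 / 12) * (s * l)| <= 14 * s.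
  have -> : \sum_(1 <= x < X.+1) m x = mu / 2 * s *
     (zeta2_sum R X * l - 4 * \sum_(1 <= x < X.+1) (ln x%:R / x%:R ^+ 2)).
    rewrite /zeta2_sum mulr_suml mulr_sumr -sumrB mulr_sumr.
    by apply: eq_bigr => x _; rewrite /m; ring.
  have lX : l <= 4 * X%:R.
    apply: (@le_trans _ _ (4 * ln (X.+1%:R : R))).
      rewrite /l -r4 lnXn; last lra.
      rewrite -[_ *+ 4]mulr_natl ler_pM2l// ler_ln ?posrE ?ltr0n ?(ltW rX)//;
        lra.
    rewrite ler_pM2l// -natr1 addrC; apply: le_ln1Dx.
    by rewrite (lt_le_trans (ltrN10 _)).
  have /andP[b1 b2] := basel R X0.
  set Z := zeta2_sum R X in b1 b2 *.
  have S6 := sum_ln_sqr X.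
  have S0 : 0 <= \sum_(1 <= x < X.+1) (ln x%:R / x%:R ^+ 2) :> R.
    rewrite big_nat sumr_ge0// => x /andP[x0 _].
    by rewrite divr_ge0 ?exprn_ge0// ln_ge0// ler1n.
  move: (\sum_(_ <= _ < _) _) S6 S0 => S S6 S0.
  have -> : mu / 2 * s * (Z * l - 4 * S) - mu * (pi ^+ 2 / 12) * (s * l) =
    - (mu / 2 * s * ((pi ^+ 2 / 6 - Z) * l + 4 * S)) by field.
  have X0' : 0 < X%:R :> R by rewrite ltr0n.
  have d0 : 0 <= (pi ^+ 2 / 6 - Z) * l by rewrite mulr_ge0// subr_ge0.
  have d4 : (pi ^+ 2 / 6 - Z) * l <= 4.
    apply: (@le_trans _ _ (X%:R^-1 * (4 * X%:R))).
      by apply: ler_pM => //; [rewrite subr_ge0|lra].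
    by rewrite mulrCA mulVf ?mulr1// gt_eqF.
  move: ((pi ^+ 2 / 6 - Z) * l) d0 d4 => D d0 d4.
  have f0 : 0 <= mu / 2 * s by rewrite mulr_ge0// divr_ge0.
  have f1 : mu / 2 * s <= 1 / 2 * s by rewrite ler_wpM2r// ler_wpM2r// invr_ge0.
  have g0 : 0 <= D + 4 * S by lra.
  rewrite normrN ger0_norm; last exact: mulr_ge0.
  apply: (@le_trans _ _ (1 / 2 * s * (4 + 4 * 6))); last lra.
  by apply: ler_pM => //; lra.
have hTm : `|quad_count n - \sum_(1 <= x < X.+1) m x| <= 2 * (E * s).
  rewrite TX -sumrB; apply: le_trans (ler_norm_sum _ _ _) _.
  apply: (@le_trans _ _ (\sum_(1 <= x < X.+1) E * s * (x%:R ^+ 2)^-1)).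
    by rewrite !big_nat; apply: ler_sum => x /andP[x0 xX]; exact: hB.
  by rewrite -mulr_sumr mulrC ler_wpM2r ?mulr_ge0// zeta2_sum_le2.
have : 2 * (E * s) <= s * (2 * C0 + 24 / z.-1%:R + 24 / z.-1%:R * l).
  have -> : s * (2 * C0 + 24 / z.-1%:R + 24 / z.-1%:R * l) =
    2 * ((C0 + 12 / z.-1%:R * (1 + l)) * s) by ring.
  rewrite ler_pM2l// ler_wpM2r// lerD2l ler_wpM2l// divr_ge0// ltW//.
move: hm hTm; rewrite -/l !ler_norml !mulrDr => /andP[? ?] /andP[? ?] ?.
by apply/andP; split; lra.
Qed.

Lemma quad_count_asymp (e : R) : 0 < e -> exists n0 :
  nat, forall n, (n0 <= n)%N ->
  `|quad_count n - C4 R * (Num.sqrt n%:R * ln n%:R)| <=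
  e * (Num.sqrt n%:R * ln n%:R).
Proof.
move=> e0; set P := limn (@C4_partial R).
have cP : @C4_partial R @ \oo --> P := @is_cvg_C4_partial R.
have e4 : 0 < e / 4 by rewrite divr_gt0.
have [z0 _ hz0] : \forall z \near \oo, `|P - C4_partial R z| <= e / 4.
  by move/cvgrPdist_le : cP => /(_ _ e4).
(* [z] is fixed before [n]: it makes both the truncation of the Euler product
   and the sieve error at most [e / 4] of the main term *)
pose z := (maxn z0 (Num.truncn (96 / e)).+2).
have z1 : (1 < z)%N by rewrite leq_max orbT.
have hz : `|P - C4_partial R z| <= e / 4 by apply: hz0; rewrite /= leq_maxl.
have z24 : 24 / z.-1%:R <= e / 4.
  have z10 : 0 < z.-1%:R :> R by rewrite ltr0n; lia.
  rewrite ler_pdivrMr// mulrC -ler_pdivrMr//.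
  have -> : 24 / (e / 4) = 96 / e by field; rewrite gt_eqF.
  apply: ltW; apply: lt_le_trans (truncnS_gt _) _.
  by rewrite ler_nat -ltnS prednK ?(ltnW z1)// leq_maxr.
have [C hC] := quad_count_sieve z1.
pose n0 := maxn z (Num.truncn (expR (4 * `|C| / e))).+1.
exists n0 => n; rewrite geq_max => /andP[zn Cn].
have n0' : (0 < n)%N by lia.
have := hC n n0' (leqW zn).
have s0 : 0 <= Num.sqrt (n%:R : R) by exact: sqrtr_ge0.
have lC : C <= e / 4 * ln n%:R.
  apply: (le_trans (ler_norm _)); rewrite mulrC -ler_pdivrMr//.
  have -> : `|C| / (e / 4) = 4 * `|C| / e by field; rewrite gt_eqF.
  rewrite -(expRK (4 * `|C| / e)) ler_ln ?posrE ?expR_gt0 ?ltr0n//.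
  by apply: ltW; apply: lt_le_trans (truncnS_gt _) _; rewrite ler_nat.
have l0 : 0 <= ln (n%:R : R) by rewrite ln_ge0// ler1n.
have pi2 : 0 <= (pi : R) ^+ 2 / 12 <= 1.
  rewrite divr_ge0 ?exprn_ge0 ?pi_ge0//=.
  by have := @basel R 1 isT; have := zeta2_sum_le2 1;
    rewrite /zeta2_sum big_nat1 expr1n invr1; lra.
rewrite /C4 -/P; set S := Num.sqrt _ * ln _.
have S0 : 0 <= S by rewrite mulr_ge0.
have hS : `|C4_partial R z * (pi ^+ 2 / 12) * S - pi ^+ 2 / 12 * P * S| <= e /
  4 * S.
  have -> : C4_partial R z * (pi ^+ 2 / 12) * S - pi ^+ 2 / 12 * P * S =
    - ((pi ^+ 2 / 12) * (P - C4_partial R z) * S) by ring.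
  case/andP: pi2 => p0 p1.
  rewrite normrN normrM [X in _ * X]ger0_norm// ler_wpM2r// normrM.
  by rewrite [X in X * _]ger0_norm// -[leRHS]mul1r ler_pM.
have hT : Num.sqrt n%:R * (C + 24 / z.-1%:R * ln n%:R) <= e / 2 * S.
  have -> : e / 2 * S = Num.sqrt n%:R * (e / 4 * ln n%:R + e / 4 * ln n%:R).
    by rewrite /S; field.
  by rewrite ler_wpM2l// lerD// ler_wpM2r.
have eS : 0 <= e * S by rewrite mulr_ge0// ltW.
move: hS hT eS; move: (quad_count n) (C4_partial R z * _ * S) => a b.
by rewrite !ler_norml => /andP[? ?] ? ? /andP[? ?]; apply/andP; split; lra.
Qed.

End asymptotics.

(** * The numerical value of the constant *)

Section euler.
Variable R : realType.
Implicit Types (K N p n : nat).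

(** [n] has no prime factor below [N]. *)
Definition rough N n : bool := all (fun p =>
  prime p ==> ~~ (p %| n)%N) (iota 0 N).

Lemma roughS N n : rough N.+1 n = rough N n && (prime N ==> ~~ (N %| n)%N).
Proof. by rewrite /rough -addn1 iotaD all_cat/= andbT. Qed.

Lemma rough1 N : rough N 1.
Proof.
by apply/allP => p _; apply/implyP => pp; rewrite dvdn1; case: p pp => [|[]].
Qed.

Lemma rough_ge N n : (1 < n)%N -> rough N n -> (N <= n)%N.
Proof.
move=> n1 /allP rn; rewrite leqNgt; apply/negP => nN.
have := rn (pdiv n); rewrite mem_iota add0n/= pdiv_prime// pdiv_dvd/=.
by rewrite (leq_ltn_trans (pdiv_leq (ltnW n1)) nN) => /(_ isT).
Qed.

Lemma rough_mull N p n : prime p -> (N <= p)%N -> rough N (p * n) = rough N n.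
Proof.
move=> pp Np; apply/allP/allP => h q qN; have := h q qN; apply: contraTT.
  by rewrite !(negb_imply, negbK) => /andP[-> qn]/=; exact: dvdn_mull.
rewrite !(negb_imply, negbK) => /andP[pq];
  rewrite pq/= Euclid_dvdM// => /orP[|//].
rewrite dvdn_prime2// => /eqP qp; move: qN; rewrite mem_iota add0n/= qp; lia.
Qed.

Definition euler2 N : R := \prod_(0 <= p < N | prime p) (1 - (p%:R ^+ 2)^-1).

Definition rough_sum N K : R := \sum_(1 <= n < K.+1 | rough N n) (n%:R ^+ 2)^-1.

Lemma rough_sumS N K : rough_sum N.+1 K = rough_sum N K -
  (if prime N then (N%:R ^+ 2)^-1 * rough_sum N (K %/ N) else 0).
Proof.
case: ifP => [pN|nN]; last first.
  by rewrite subr0 /rough_sum; apply: eq_bigl => n; rewrite roughS nN andbT.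
apply/eqP; rewrite -subr_eq opprK eq_sym; apply/eqP.
have -> : (N%:R ^+ 2)^-1 * rough_sum N (K %/ N) =
    \sum_(1 <= n < K.+1 | (N %| n)%N) (if rough N n then (n%:R ^+ 2)^-1 else 0).
  rewrite (sum_multiples _ K (prime_gt0 pN)) /rough_sum big_mkcond mulr_sumr.
  apply: eq_bigr => m _; rewrite rough_mull//; case: ifP; last by rewrite mulr0.
  by move=> _; rewrite natrM exprMn [RHS]invfM.
rewrite /rough_sum [LHS]big_mkcond [X in X + _]big_mkcond [X in _ +
  X]big_mkcond.
rewrite -big_split; apply: eq_bigr => n _ /=; rewrite roughS pN/=.
by case: (N %| n)%N => /=; rewrite ?andbT ?andbF ?add0r ?addr0.
Qed.

Let L : R := pi ^+ 2 / 6.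

Lemma zeta2_itv : 1 <= L <= 2.
Proof.
have /andP[h1 h2] := @basel R 1 isT; apply/andP; split.
  by apply: le_trans h1; rewrite /zeta2_sum big_nat1 expr1n invr1.
by apply: (le_trans h2); rewrite /zeta2_sum big_nat1 expr1n invr1.
Qed.

Lemma rough_sum_cvg N : exists2 c : R, 0 <= c &
  forall K, `|rough_sum N K - euler2 N * L| <= c / K.+1%:R.
Proof.
elim: N => [|N [c c0 IH]].
  exists 2 => // K; rewrite /euler2 big_geq// mul1r.
  have -> : rough_sum 0 K = zeta2_sum R K by [].
  case: K => [|K].
    by rewrite /zeta2_sum big_geq// sub0r normrN divr1 ger0_norm;
      case/andP: zeta2_itv => *; lra.
  have /andP[h1 h2] := @basel R K.+1 isT.
  rewrite ler0_norm ?subr_le0// opprB lerBlDl; apply: le_trans h2 _.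
  rewrite lerD2l ler_pdivlMr ?ltr0n// mulrC ler_pdivrMr ?ltr0n// -natrM
    ler_nat; lia.
rewrite /euler2 big_mkcond big_nat_recr//= -big_mkcond -/(euler2 N).
case: (boolP (prime N)) => pN; last first.
  by exists c => // K; rewrite rough_sumS (negbTE pN) subr0 mulr1.
have N0 := prime_gt0 pN; have N0' : 0 < N%:R :> R by rewrite ltr0n.
exists (c + c / N%:R) => [|K]; first by rewrite addr_ge0// divr_ge0.
rewrite rough_sumS pN.
have -> : rough_sum N K - (N%:R ^+ 2)^-1 * rough_sum N (K %/ N) -
   euler2 N * (1 - (N%:R ^+ 2)^-1) * L = (rough_sum N K - euler2 N * L) -
   (N%:R ^+ 2)^-1 * (rough_sum N (K %/ N) - euler2 N * L) by ring.
apply: le_trans (ler_normB _ _) _; rewrite mulrDl; apply: lerD => //.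
rewrite normrM ger0_norm ?invr_ge0 ?exprn_ge0//.
apply: le_trans (ler_wpM2l _ (IH _)) _; first by rewrite invr_ge0 exprn_ge0.
have -> : c / N%:R / K.+1%:R = (N%:R ^+ 2)^-1 * (c * (N%:R / K.+1%:R)).
  by field; rewrite !gt_eqF ?ltr0n.
rewrite ler_wpM2l ?invr_ge0 ?exprn_ge0// ler_wpM2l//.
rewrite ler_pdivlMr ?ltr0n// mulrC ler_pdivrMr ?ltr0n// -natrM ler_nat.
by rewrite mulnC ltn_ceil.
Qed.

(** Only [1] and integers [>= N] survive removing the multiples of all primes
below [N] from the sum of [n ^- 2]. *)
Lemma euler2_zeta2 N : (1 < N)%N -> 1 <= euler2 N * L <= 1 + N.-1%:R^-1.
Proof.
move=> N1; have [c c0 hc] := rough_sum_cvg N.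
have approx e : 0 < e -> exists2 K,
  (0 < K)%N & `|rough_sum N K - euler2 N * L| <= e.
  move=> e0; exists (Num.truncn (c / e)).+1 => //; apply: le_trans (hc _) _.
  rewrite ler_pdivrMr ?ltr0n// mulrC -ler_pdivrMr//.
  by apply: ltW; apply: lt_le_trans (truncnS_gt _) _; rewrite ler_nat.
have lo K : (0 < K)%N -> 1 <= rough_sum N K.
  move=> K0; rewrite /rough_sum big_ltn_cond// rough1 expr1n invr1 lerDl.
  by rewrite sumr_ge0// => n _; rewrite invr_ge0 exprn_ge0.
have hi K : (0 < K)%N -> rough_sum N K <= 1 + N.-1%:R^-1.
  move=> K0; rewrite /rough_sum big_ltn_cond// rough1 expr1n invr1 lerD2l.
  apply: le_trans (sum_inv2 R K.+1 N1).
  have [KN|NK] := leqP K.+1 N.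
    rewrite [leRHS]big_geq// big_nat_cond big1// => n /andP[/andP[n2 nK] rn].
    by have := rough_ge n2 rn; rewrite leqNgt (leq_trans nK).
  rewrite (big_cat_nat _ (n := N))//=; last exact: ltnW.
  rewrite [X in X + _]big_nat_cond [X in X + _]big1 ?add0r; last first.
    move=> n /andP[/andP[n2 nN] rn].
    by have := rough_ge n2 rn; rewrite leqNgt nN.
  by rewrite big_mkcond; apply: ler_sum => n _; case: ifP.
apply/andP; split; apply/ler_addgt0Pr => e /approx[K K0]; rewrite ler_norml.
  by have := lo K K0; lra.
by have := hi K K0; lra.
Qed.

(** [(1 - x)^3 (1 + 3 x) / (1 - x^2)^6 = 1 + O(x^3)]: dividing out the sixth
power of the Euler factor of [zeta 2] accelerates the convergence. *)
Definition ratio6 p : R :=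
  (p%:R + 3) * p%:R ^+ 8 / ((p%:R - 1) ^+ 3 * (p%:R + 1) ^+ 6).

Definition ratio6_prod N : R := \prod_(0 <= p < N | prime p) ratio6 p.

Lemma ratio6_prodS N :
  ratio6_prod N.+1 = ratio6_prod N * (if prime N then ratio6 N else 1).
Proof. by rewrite /ratio6_prod big_mkcond big_nat_recr//= -big_mkcond. Qed.

Lemma C4_factor_ratio6 p : prime p ->
  C4_factor R p = (1 - (p%:R ^+ 2)^-1) ^+ 6 * ratio6 p.
Proof.
move=> /prime_gt1 p1; rewrite /C4_factor /ratio6.
have : 1 < p%:R :> R by rewrite ltr1n.
move: (p%:R : R) => x x1.
by field; do !(apply/andP; split); apply/eqP; nra.
Qed.

Lemma C4_partial_ratio6 N : C4_partial R N = euler2 N ^+ 6 * ratio6_prod N.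
Proof.
rewrite /C4_partial /euler2 /ratio6_prod -prodrXl -big_split/=.
by apply: eq_bigr => p /C4_factor_ratio6.
Qed.

Lemma ratio6_den_gt0 p : (1 < p)%N -> 0 < (p%:R - 1) ^+ 3 * (p%:R + 1) ^+ 6 :>
  R.
Proof.
move=> p1; have : 1 < p%:R :> R by rewrite ltr1n.
by move=> x1; rewrite mulr_gt0 ?exprn_gt0; lra.
Qed.

Lemma ratio6_ge1 p : (1 < p)%N -> 1 <= ratio6 p.
Proof.
move=> p1; rewrite /ratio6 ler_pdivlMr ?ratio6_den_gt0// mul1r.
have x1 : 1 < p%:R :> R by rewrite ltr1n.
move: (p%:R : R) x1 => x x1; rewrite -subr_ge0.
have -> : (x + 3) * x ^+ 8 - (x - 1) ^+ 3 * (x + 1) ^+ 6 =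
  8 * x ^+ 3 * (x ^+ 3 - 1) + 6 * x ^+ 4 * (x - 1) + 3 * x + 1 by ring.
have x0 : 0 <= x by lra.
have x3 : 0 <= x ^+ 3 - 1 by rewrite subr_ge0 exprn_ege1// ltW.
by rewrite !addr_ge0 ?mulr_ge0 ?exprn_ge0//; lra.
Qed.

Lemma ratio6_le p : (10 <= p)%N -> ratio6 p <= 1 + 8 / p%:R ^+ 3.
Proof.
move=> p10; rewrite /ratio6 ler_pdivrMr ?ratio6_den_gt0//; last lia.
have x10 : 10 <= p%:R :> R by rewrite ler_nat.
move: (p%:R : R) x10 => x x10.
have x0 : 0 < x by lra.
have x3 : 0 < x ^+ 3 by exact: exprn_gt0.
rewrite -(ler_pM2r x3) -subr_ge0.
have -> : (1 + 8 / x ^+ 3) * ((x - 1) ^+ 3 * (x + 1) ^+ 6) * x ^+ 3 -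
    (x + 3) * x ^+ 8 * x ^+ 3 =
  x ^+ 5 * (x * (18 * x ^+ 2 - 56) + (6 * x ^+ 2 - 48)) +
  (x ^+ 3 * (45 * x + 63) - 24 * x - 8) by field; rewrite gt_eqF.
have x2 : 100 <= x ^+ 2 by rewrite expr2; nra.
have h1 : 0 <= x * (18 * x ^+ 2 - 56) by rewrite mulr_ge0//; lra.
have h2 : 0 <= x ^+ 5 * (x * (18 * x ^+ 2 - 56) + (6 * x ^+ 2 - 48)).
  by rewrite mulr_ge0 ?exprn_ge0//; lra.
have h3 : 1 <= x ^+ 3 by rewrite exprn_ege1//; lra.
have h4 : 45 * x + 63 <= x ^+ 3 * (45 * x + 63) by rewrite ler_peMl//; lra.
by lra.
Qed.

Lemma ratio6_prod_ge M N : (M <= N)%N -> ratio6_prod M <= ratio6_prod N.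
Proof.
elim: N => [|N IH]; first by rewrite leqn0 => /eqP->.
rewrite leq_eqVlt => /predU1P[->//|]; rewrite ltnS => /IH h.
have pos : 0 <= ratio6_prod N.
  apply: prodr_ge0 => p /prime_gt1 p1; apply: le_trans ler01 (ratio6_ge1 p1).
apply: (le_trans h); rewrite ratio6_prodS ler_peMr//; case: ifP => // pN.
by rewrite ratio6_ge1// prime_gt1.
Qed.

(** [1 + 8 / n^3 <= g n / g n.+1] for [g n = 1 + 5 / (n (n - 1))], so the tail
of the product telescopes. *)
Lemma ratio6_prod_le M N : (100 <= M)%N -> (M <= N)%N ->
  ratio6_prod N <= ratio6_prod M * (1 + 5 / (M%:R * (M%:R - 1))).
Proof.
move=> M100 MN; pose g (n : nat) : R := 1 + 5 / (n%:R * (n%:R - 1)).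
have g1 n : (1 < n)%N -> 1 <= g n.
  move=> n1; rewrite lerDl divr_ge0// mulr_ge0// subr_ge0 ler1n; lia.
have pos : 0 <= ratio6_prod M.
  apply: prodr_ge0 => p /prime_gt1 p1; apply: le_trans ler01 (ratio6_ge1 p1).
suff h : ratio6_prod N * g N <= ratio6_prod M * g M.
  apply: le_trans h; rewrite ler_peMr// ?g1//; last lia.
  apply: prodr_ge0 => p /prime_gt1 p1; apply: le_trans ler01 (ratio6_ge1 p1).
elim: N MN => [|N IH]; first by rewrite leqn0 => /eqP->.
rewrite leq_eqVlt => /predU1P[->//|]; rewrite ltnS => MN.
apply: le_trans (IH MN); rewrite ratio6_prodS -mulrA.
have N100 : (100 <= N)%N by lia.
apply: ler_wpM2l.
  apply: prodr_ge0 => p /prime_gt1 p1; apply: le_trans ler01 (ratio6_ge1 p1).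
have gg : (1 + 8 / N%:R ^+ 3) * g N.+1 <= g N.
  have x100 : 100 <= N%:R :> R by rewrite ler_nat.
  rewrite /g -[N.+1%:R]natr1 addrK; move: (N%:R : R) x100 => x x100.
  rewrite -subr_ge0.
  have -> : 1 + 5 / (x * (x - 1)) - (1 + 8 / x ^+ 3) * (1 + 5 / ((x + 1) * x)) =
    (2 * x ^+ 3 - 40 * x + 8 * x + 40) / (x ^+ 4 * (x - 1) * (x + 1)).
    by field; do !(apply/andP; split); apply/eqP; lra.
  apply: divr_ge0; last by rewrite !mulr_ge0 ?exprn_ge0//; lra.
  have : 10000 * x <= x ^+ 3 by rewrite exprSr ler_wpM2r ?expr2//; nra.
  lra.
have gN := g1 N.+1; have : 1 <= g N.+1 by apply: gN; lia.
move=> g1'; apply: le_trans gg; apply: ler_wpM2r; first lra.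
case: ifP => [pN|_]; first by apply: ratio6_le; lia.
by rewrite lerDl divr_ge0// exprn_ge0.
Qed.

Lemma zeta2_tail_ub (x : R) : 1 <= x ->
  ((x + 1) ^+ 2)^-1 <= (x^-1 - (2 * x ^+ 2)^-1 + (6 * x ^+ 3)^-1) -
   ((x + 1)^-1 - (2 * (x + 1) ^+ 2)^-1 + (6 * (x + 1) ^+ 3)^-1).
Proof.
move=> x1; rewrite -subr_ge0.
have -> : (x^-1 - (2 * x ^+ 2)^-1 + (6 * x ^+ 3)^-1) -
   ((x + 1)^-1 - (2 * (x + 1) ^+ 2)^-1 + (6 * (x + 1) ^+ 3)^-1) -
   ((x + 1) ^+ 2)^-1 = (6 * x ^+ 3 * (x + 1) ^+ 3)^-1.
  by field; do !(apply/andP; split); apply/eqP; lra.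
by rewrite invr_ge0 !mulr_ge0 ?exprn_ge0//; lra.
Qed.

Lemma zeta2_tail_lb (x : R) : 1 <= x ->
  (x^-1 - (2 * x ^+ 2)^-1 + (6 * x ^+ 3)^-1 - (30 * x ^+ 5)^-1) -
   ((x + 1)^-1 - (2 * (x + 1) ^+ 2)^-1 + (6 * (x + 1) ^+ 3)^-1
      - (30 * (x + 1) ^+ 5)^-1) <= ((x + 1) ^+ 2)^-1.
Proof.
move=> x1; rewrite -subr_ge0.
have -> : ((x + 1) ^+ 2)^-1 -
   ((x^-1 - (2 * x ^+ 2)^-1 + (6 * x ^+ 3)^-1 - (30 * x ^+ 5)^-1) -
   ((x + 1)^-1 - (2 * (x + 1) ^+ 2)^-1 + (6 * (x + 1) ^+ 3)^-1
      - (30 * (x + 1) ^+ 5)^-1)) =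
  (1 + 5 * x + 5 * x ^+ 2) / (30 * x ^+ 5 * (x + 1) ^+ 5).
  by field; do !(apply/andP; split); apply/eqP; lra.
by rewrite divr_ge0 ?addr_ge0 ?mulr_ge0 ?exprn_ge0//; lra.
Qed.

(** The truncated Euler-Maclaurin expansions of the tail of the series, whose
differences at consecutive integers lie on either side of the terms.  The two
bounds differ by [1 / (30 K^5)],
  which is about [10 ^ -8] already for [K = 20]. *)
Lemma zeta2_Euler_Maclaurin K : (0 < K)%N ->
  zeta2_sum R K + (K%:R^-1 - (2 * K%:R ^+ 2)^-1 + (6 * K%:R ^+ 3)^-1
     - (30 * K%:R ^+ 5)^-1) <= pi ^+ 2 / 6 <=
  zeta2_sum R K + (K%:R^-1 - (2 * K%:R ^+ 2)^-1 + (6 * K%:R ^+ 3)^-1).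
Proof.
pose fu (n : nat) : R := n%:R^-1 - (2 * n%:R ^+ 2)^-1 + (6 * n%:R ^+ 3)^-1.
pose fl (n : nat) : R := fu n - (30 * n%:R ^+ 5)^-1.
move=> K0; rewrite -/(fu K) -/(fl K).
have mono n : (K <= n)%N -> zeta2_sum R K + fl K <= zeta2_sum R n + fl n /\
    zeta2_sum R n + fu n <= zeta2_sum R K + fu K.
  elim: n => [|n IH]; first by rewrite leqn0 => /eqP E; rewrite E in K0.
  rewrite leq_eqVlt => /predU1P[->//|]; rewrite ltnS => Kn.
  have [lo hi] := IH Kn; have n1 : 1 <= n%:R :> R by rewrite ler1n; lia.
  rewrite zeta2_sumS; split.
    apply: (le_trans lo); have := zeta2_tail_lb n1.
    rewrite natr1 -/(fu n) -/(fu n.+1) -/(fl n) -/(fl n.+1).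
    move: (fl n) (fl n.+1) (zeta2_sum R n) (n.+1%:R ^- 2) => ? ? ? ?; lra.
  apply: le_trans hi; have := zeta2_tail_ub n1.
  rewrite natr1 -/(fu n) -/(fu n.+1).
  move: (fu n) (fu n.+1) (zeta2_sum R n) (n.+1%:R ^- 2) => ? ? ? ?; lra.
have fl1 n : (0 < n)%N -> fl n <= 2 / n%:R /\ 0 <= fu n /\ fl n <= fu n.
  move=> n0; have n1 : 1 <= n%:R :> R by rewrite ler1n.
  rewrite /fl /fu; move: (n%:R : R) n1 => x x1.
  have i2 : (x ^+ 2)^-1 <= x^-1 by rewrite lef_pV2 ?posrE ?exprn_gt0
    ?ler_eXnr//; lra.
  have i3 : (x ^+ 3)^-1 <= x^-1 by rewrite lef_pV2 ?posrE ?exprn_gt0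
    ?ler_eXnr//; lra.
  have p2 : 0 <= (x ^+ 2)^-1 by rewrite invr_ge0 exprn_ge0//; lra.
  have p3 : 0 <= (x ^+ 3)^-1 by rewrite invr_ge0 exprn_ge0//; lra.
  have p5 : 0 <= (x ^+ 5)^-1 by rewrite invr_ge0 exprn_ge0//; lra.
  by rewrite !invfM; do ?split; lra.
have approx (e : R) : 0 < e -> exists2 n, (K <= n)%N & 2 / n%:R <= e.
  move=> e0; pose m := maxn K (Num.truncn (2 / e)).+1.
  exists m; first exact: leq_maxl.
  have m0 : (0 < m)%N by rewrite leq_max orbT.
  rewrite ler_pdivrMr ?ltr0n// mulrC -ler_pdivrMr//.
  by apply: ltW; apply: lt_le_trans (truncnS_gt _) _; rewrite ler_nat leq_maxr.
apply/andP; split; apply/ler_addgt0Pr => e /approx[n Kn hn].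
  have n0 : (0 < n)%N by lia.
  have [lo _] := mono n Kn; have [h1 _] := fl1 n n0.
  have /andP[b1 _] := basel R n0; lra.
have n0 : (0 < n)%N by lia.
have [_ hi] := mono n Kn; have [_ [h1 _]] := fl1 n n0.
have /andP[_ b2] := basel R n0.
have : n%:R^-1 <= 2 / n%:R :> R by rewrite -[leLHS]mul1r ler_wpM2r ?invr_ge0//;
  lra.
lra.
Qed.

End euler.

(** * Certified evaluation in fixed-point arithmetic *)

Section fixpoint_arithmetic.
Variable R : realType.

Local Notation BN := BinNums.N.
Local Notation of_nat := BinNat.N.of_nat.
Local Notation nat_of := BinNat.N.to_nat.

Lemma nat_of_pow a b : nat_of (BinNat.N.pow a b) = (nat_of a ^ nat_of b)%N.
Proof.
rewrite Nnat.N2Nat.inj_pow; elim: (nat_of b) => [|n IH] //=.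
by rewrite IH expnS multE.
Qed.

Lemma nat_of_div_bounds (x b : BN) : (0 < nat_of b)%N ->
  (nat_of (BinNat.N.div x b) * nat_of b <= nat_of x
   < (nat_of (BinNat.N.div x b)).+1 * nat_of b)%N.
Proof.
move=> b0; have b0' : b <> BinNums.N0 by move=> E; rewrite E in b0.
have := BinNat.N.mul_div_le x b b0'.
have := BinNat.N.mul_succ_div_gt x b b0'.
move: (BinNat.N.div x b) => q h1 h2; nia.
Qed.

Definition zeta2_step (m : nat) (b : BN * BN) : BN * BN :=
  let q := BinNat.N.div (BinNat.N.pow (of_nat 10) (of_nat 14))
    (BinNat.N.pow (of_nat m.+1) (of_nat 2)) in
  (BinNat.N.add b.1 q, BinNat.N.succ (BinNat.N.add b.2 q)).

(** Two-sided bounds by directed rounding, in units of [10 ^- 14]. *)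
Definition zeta2_bounds (n : nat) : BN * BN :=
  iteri n zeta2_step (BinNums.N0, BinNums.N0).

Lemma zeta2_boundsP n :
  (nat_of (zeta2_bounds n).1)%:R <= 10 ^+ 14 * zeta2_sum R n <=
  (nat_of (zeta2_bounds n).2)%:R.
Proof.
elim: n => [|n]; first by rewrite /zeta2_sum big_geq// mulr0 lexx.
rewrite zeta2_sumS /zeta2_bounds iteriS -/(zeta2_bounds n) /zeta2_step.
case: (zeta2_bounds n) => lo hi; rewrite [_.1]/= [_.2]/=.
set d := BinNat.N.pow _ (of_nat 2); set x := BinNat.N.pow (of_nat 10) _.
have dE : nat_of d = (n.+1 ^ 2)%N by rewrite nat_of_pow !Nnat.Nat2N.id.
have d0 : (0 < nat_of d)%N by rewrite dE expn_gt0.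
have := nat_of_div_bounds x d0; set q := BinNat.N.div x d => /andP[q1 q2].
have d0' : 0 < n.+1%:R ^+ 2 :> R by rewrite exprn_gt0// ltr0n.
have xE : (nat_of x)%:R = 10 ^+ 14 :> R by rewrite nat_of_pow !Nnat.Nat2N.id
  natrX.
clearbody q d x.
have lo' : (nat_of q)%:R <= 10 ^+ 14 / n.+1%:R ^+ 2 :> R.
  by rewrite ler_pdivlMr// -xE -natrX -natrM ler_nat -dE.
have hi' : 10 ^+ 14 / n.+1%:R ^+ 2 <= (nat_of q).+1%:R :> R.
  by rewrite ler_pdivrMr// -xE -natrX -natrM ler_nat -dE ltnW.
rewrite Nnat.N2Nat.inj_add Nnat.N2Nat.inj_succ Nnat.N2Nat.inj_add !plusE.
rewrite mulrDr -addnS !natrD => /andP[h1 h2].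
by apply/andP; split; apply: lerD.
Qed.

Definition ratio6_step (m : nat) (b : BN * BN) : BN * BN :=
  if prime m then
    let p := of_nat m in
    let num := BinNat.N.mul (BinNat.N.add p (of_nat 3))
      (BinNat.N.pow p (of_nat 8)) in
    let den := BinNat.N.mul (BinNat.N.pow (BinNat.N.pred p) (of_nat 3))
      (BinNat.N.pow (BinNat.N.succ p) (of_nat 6)) in
    (BinNat.N.div (BinNat.N.mul b.1 num) den,
     BinNat.N.succ (BinNat.N.div (BinNat.N.mul b.2 num) den))
  else b.

(** Two-sided bounds by directed rounding, in units of [10 ^- 16]. *)
Definition ratio6_bounds (n : nat) : BN * BN :=
  let one := BinNat.N.pow (of_nat 10) (of_nat 16) in
  iteri n ratio6_step (one, one).

Lemma ratio6_boundsP n :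
  (nat_of (ratio6_bounds n).1)%:R <= 10 ^+ 16 * ratio6_prod R n <=
  (nat_of (ratio6_bounds n).2)%:R.
Proof.
elim: n => [|n].
  have E : (nat_of (BinNat.N.pow (of_nat 10) (of_nat 16)))%:R = 10 ^+ 16 :> R.
    by rewrite nat_of_pow !Nnat.Nat2N.id natrX.
  by rewrite /ratio6_prod big_geq// mulr1 -E; apply/andP; split; exact: lexx.
rewrite ratio6_prodS /ratio6_bounds iteriS -/(ratio6_bounds n).
rewrite /ratio6_step; case: (ratio6_bounds n) => lo hi; case: ifP => [pn|_];
  last by rewrite mulr1.
have n1 := prime_gt1 pn; have := ratio6_den_gt0 R n1.
cbv zeta; rewrite [(lo, hi).1]/= [(lo, hi).2]/=.
set p := of_nat n; set a := BinNat.N.mul (BinNat.N.add p (of_nat 3)) _.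
set b := BinNat.N.mul (BinNat.N.pow (BinNat.N.pred p) (of_nat 3)) _ =>
  b0 /andP[lo1 hi1].
have pE : nat_of p = n by exact: Nnat.Nat2N.id.
have aE : (nat_of a)%:R = (n%:R + 3) * n%:R ^+ 8 :> R.
  rewrite Nnat.N2Nat.inj_mul multE natrM nat_of_pow natrX pE Nnat.Nat2N.id.
  by rewrite Nnat.N2Nat.inj_add pE plusE natrD Nnat.Nat2N.id.
have bE : (nat_of b)%:R = (n%:R - 1) ^+ 3 * (n%:R + 1) ^+ 6 :> R.
  rewrite Nnat.N2Nat.inj_mul multE natrM !nat_of_pow !natrX !Nnat.Nat2N.id.
  rewrite Nnat.N2Nat.inj_succ Nnat.N2Nat.inj_pred pE -natr1.
  have -> : PeanoNat.Nat.pred n = (n - 1)%N by lia.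
  by rewrite natrB// ltnW.
have b0' : (0 < nat_of b)%N by rewrite -(ltr0n R) bE.
have [/andP[q1 _] /andP[_ q2]] := (nat_of_div_bounds (BinNat.N.mul lo a) b0',
  nat_of_div_bounds (BinNat.N.mul hi a) b0').
have rE : ratio6 R n = (nat_of a)%:R / (nat_of b)%:R by rewrite aE bE.
have a0 : 0 <= (nat_of a)%:R :> R by [].
rewrite rE !mulrA; apply/andP; split.
  rewrite ler_pdivlMr ?ltr0n//.
  apply: le_trans (_ : (nat_of lo)%:R * (nat_of a)%:R <= _);
    last by rewrite ler_wpM2r.
  by rewrite -!natrM ler_nat (leq_trans q1)// Nnat.N2Nat.inj_mul.
rewrite ler_pdivrMr ?ltr0n//.
apply: (@le_trans _ _ ((nat_of hi)%:R * (nat_of a)%:R));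
  first by rewrite ler_wpM2r.
rewrite -!natrM ler_nat Nnat.N2Nat.inj_succ.
by move/ltnW: q2; rewrite Nnat.N2Nat.inj_mul.
Qed.

(** Numerals in base 1000 keep each literal small, [nat] being unary. *)
Definition base1000 (s : seq nat) : BN :=
  foldl (fun x d => BinNat.N.add (BinNat.N.mul x (of_nat 1000)) (of_nat d))
    BinNums.N0 s.

Lemma base1000E s : (nat_of (base1000 s))%:R =
  foldl (fun (x : R) d => x * 1000%:R + d%:R) 0 s.
Proof.
rewrite /base1000; have : (nat_of BinNums.N0)%:R = 0 :> R by [].
elim: s BinNums.N0 0 => [//|d s IH] m x mx; apply: IH.
rewrite Nnat.N2Nat.inj_add Nnat.N2Nat.inj_mul !Nnat.Nat2N.id plusE multE.
by rewrite natrD natrM mx.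
Qed.

Lemma base1000_le s b (x : R) : BinNat.N.leb (base1000 s) b ->
  (nat_of b)%:R <= x -> foldl (fun (x : R) d => x * 1000%:R + d%:R) 0 s <= x.
Proof.
move=> /BinNat.N.leb_le sb; apply: le_trans.
by rewrite -base1000E ler_nat; lia.
Qed.

Lemma base1000_ge s b (x : R) : BinNat.N.leb b (base1000 s) ->
  x <= (nat_of b)%:R -> x <= foldl (fun (x : R) d => x * 1000%:R + d%:R) 0 s.
Proof.
move=> /BinNat.N.leb_le sb /le_trans; apply.
by rewrite -base1000E ler_nat; lia.
Qed.

End fixpoint_arithmetic.

Section numerics.
Variable R : realType.

Local Notation L := (pi ^+ 2 / 6 : R).

Lemma zeta2_num : 1644 / 10 ^+ 3 + 934 / 10 ^+ 6 + 60 / 10 ^+ 9 <= L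
  <= 1644 / 10 ^+ 3 + 934 / 10 ^+ 6 + 80 / 10 ^+ 9.
Proof.
have /andP[lo hi] := zeta2_boundsP R 20.
have lo' : BinNat.N.leb (base1000 [:: 159%N; 616%N; 324%N; 391%N; 0%N])
    (zeta2_bounds 20).1.
  vm_compute; exact isT.
have hi' : BinNat.N.leb (zeta2_bounds 20).2
    (base1000 [:: 159%N; 616%N; 324%N; 392%N; 0%N]).
  vm_compute; exact isT.
have := base1000_le lo' lo; have := base1000_ge hi' hi; rewrite /foldl.
clear lo hi lo' hi'.
have /andP[] := @zeta2_Euler_Maclaurin R 20 isT.
by move: (zeta2_sum R 20) (pi ^+ 2 / 6) => x y *; apply/andP; split; lra.
Qed.

Lemma ratio6_num : 2275 / 10 ^+ 3 + 886 / 10 ^+ 6 + 829 / 10 ^+ 9 <=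
    ratio6_prod R (30 * 100) <=
  2275 / 10 ^+ 3 + 886 / 10 ^+ 6 + 830 / 10 ^+ 9.
Proof.
have /andP[lo hi] := ratio6_boundsP R (30 * 100).
have lo' : BinNat.N.leb (base1000 [:: 22%N; 758%N; 868%N; 290%N; 0%N; 0%N])
    (ratio6_bounds (30 * 100)).1.
  vm_compute; exact isT.
have hi' : BinNat.N.leb (ratio6_bounds (30 * 100)).2
    (base1000 [:: 22%N; 758%N; 868%N; 300%N; 0%N; 0%N]).
  vm_compute; exact isT.
have := base1000_le lo' lo; have := base1000_ge hi' hi; rewrite /foldl.
clear lo hi lo' hi'.
by move: (ratio6_prod R _) => x *; apply/andP; split; lra.
Qed.

(** Multiplied by [zeta(2) ^ 6], the partial product becomes the product of the
[ratio6 p], up to the tail of the Euler product of [zeta(2)]. *)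
Lemma C4_partial_zeta2 M N : (100 <= M)%N -> (M <= N)%N ->
  ratio6_prod R M <= C4_partial R N * L ^+ 6 <=
  ratio6_prod R M * (1 + 5 / (M%:R * (M%:R - 1))) * (1 + N.-1%:R^-1) ^+ 6.
Proof.
move=> M100 MN; have N1 : (1 < N)%N by lia.
have -> : C4_partial R N * L ^+ 6 = (euler2 R N * L) ^+ 6 * ratio6_prod R N.
  by rewrite C4_partial_ratio6 [in RHS]exprMn mulrAC.
have /andP[e1 e2] := euler2_zeta2 R N1.
have pos m : 0 <= ratio6_prod R m.
  by apply: prodr_ge0 => p /prime_gt1 p1;
    apply: le_trans ler01 (ratio6_ge1 R p1).
have e0 : 0 <= euler2 R N * L by lra.
apply/andP; split.
  apply: le_trans (ratio6_prod_ge R MN) _.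
  by rewrite ler_peMl// exprn_ege1.
rewrite mulrC; apply: ler_pM => //; first exact: exprn_ge0.
  exact: ratio6_prod_le.
by rewrite lerXn2r ?nnegrE ?addr_ge0 ?invr_ge0.
Qed.

Lemma pow6_le (t : R) : 0 <= t -> t <= 1 / 10 -> (1 + t) ^+ 6 <= 1 + 10 * t.
Proof.
move=> t0 t1; have h2 : (1 + t) ^+ 2 <= 1 + 21 / 10 * t by rewrite expr2; nra.
have h20 : 0 <= (1 + t) ^+ 2 by rewrite sqr_ge0.
rewrite (exprM _ 2 3); apply: (@le_trans _ _ ((1 + 21 / 10 * t) ^+ 3)).
  by rewrite lerXn2r ?nnegrE//; lra.
have h4 : (1 + 21 / 10 * t) ^+ 2 <= 1 + 5 * t by rewrite expr2; nra.
rewrite exprS; apply: le_trans (ler_wpM2l _ h4) _; nra.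
Qed.

(** As [C4] is [zeta(2) / 2] times the infinite product, it is [X / (2 zeta(2) ^
5)], where [X] is the limit of the products of the [ratio6 p]. *)
Lemma C4_num : 944 / 10 ^+ 4 + 883 / 10 ^+ 7 <= C4 R < 944 / 10 ^+ 4 + 884 / 10
  ^+ 7.
Proof.
have /andP[l1 l2] := zeta2_num; have /andP[r1 r2] := ratio6_num.
set P := limn (@C4_partial R).
have cP := @is_cvg_C4_partial R.
have CE : C4 R = L / 2 * P by rewrite /C4 -/P; field.
have L0 : 0 < L by lra.
have M0 : (100 <= 30 * 100)%N by [].
set M := (30 * 100)%N in r1 r2 M0.
have ME : M%:R = 3000 :> R by rewrite /M natrM; ring.
have ME1 : M%:R - 1 = 2999 :> R by rewrite ME; ring.
have lo : 2275 / 10 ^+ 3 + 886 / 10 ^+ 6 + 829 / 10 ^+ 9 <= P * L ^+ 6.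
  rewrite -ler_pdivrMr ?exprn_gt0//; apply: limr_ge => //.
  exists M => // N /= MN; rewrite ler_pdivrMr ?exprn_gt0//.
  by have /andP[h _] := C4_partial_zeta2 M0 MN; apply: le_trans h.
have hi : P * L ^+ 6 <= 2275 / 10 ^+ 3 + 888 / 10 ^+ 6 + 100 / 10 ^+ 9.
  rewrite -ler_pdivlMr ?exprn_gt0//; apply: limr_le => //.
  exists (maxn M (Num.truncn (10 ^+ 10 : R)).+2) => // N /=.
  rewrite geq_max => /andP[MN]; case: N MN => // N MN tN.
  rewrite ler_pdivlMr ?exprn_gt0//.
  have /andP[_ h] := C4_partial_zeta2 M0 MN; apply: le_trans h _.
  have N0 : 10 ^+ 10 <= N%:R :> R.
    by apply: ltW; apply: lt_le_trans (truncnS_gt _) _; rewrite ler_nat.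
  rewrite [N.+1.-1]/=.
  have i0 : 0 <= N%:R^-1 :> R by rewrite invr_ge0.
  have i1 : N%:R^-1 <= (10 ^+ 10)^-1 :> R.
    by rewrite lef_pV2 ?posrE ?exprn_gt0// (lt_le_trans _ N0)// exprn_gt0.
  move: (ratio6_prod R M) (N%:R^-1 : R) r1 r2 i0 i1 => x t r1 r2 i0 i1.
  rewrite ME1 ME; clear - r1 r2 i0 i1.
  have i2 : t <= 1 / 10 ^+ 10 by lra.
  have h6 : (1 + t) ^+ 6 <= 1 + 10 * t by apply: pow6_le => //; lra.
  have h60 : 0 <= (1 + t) ^+ 6 by rewrite exprn_ge0//; lra.
  pose a : R := 2275 / 10 ^+ 3 + 886 / 10 ^+ 6 + 830 / 10 ^+ 9.
  pose b : R := 1 + 5 / (3000 * 2999); pose c : R := 1 / 10 ^+ 10.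
  have x0 : 0 <= x by lra.
  have b0 : 0 <= b by rewrite /b; lra.
  apply: (@le_trans _ _ (a * b * (1 + 10 * c))); last by rewrite /a /b /c; lra.
  apply: ler_pM; [exact: mulr_ge0|exact: h60|exact: ler_wpM2r|].
  by apply: (le_trans h6); rewrite lerD2l ler_wpM2l.
have L5 : 0 < 2 * L ^+ 5 by rewrite mulr_gt0// exprn_gt0.
have CE' : C4 R = P * L ^+ 6 / (2 * L ^+ 5).
  rewrite CE; move: (L) L0 => l l0; field; by rewrite gt_eqF.
have : 12 + 43 / 10 ^+ 3 + 215 / 10 ^+ 6 + 70 / 10 ^+ 8 <= L ^+ 5 <=
  12 + 43 / 10 ^+ 3 + 216 / 10 ^+ 6 + 50 / 10 ^+ 8.
  move: (L) l1 l2 => l l1 l2; clear - l1 l2.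
  have a2 : 2 + 705 / 10 ^+ 3 + 808 / 10 ^+ 6 + 6 / 10 ^+ 8 <= l * l.
    by apply: le_trans (ler_pM _ _ l1 l1); lra.
  have b2 : l * l <= 2 + 705 / 10 ^+ 3 + 808 / 10 ^+ 6 + 13 / 10 ^+ 8.
    by apply: le_trans (ler_pM _ _ l2 l2) _; lra.
  have a4 : 7 + 321 / 10 ^+ 3 + 397 / 10 ^+ 6 + 25 / 10 ^+ 8 <= (l * l) * (l *
    l).
    by apply: le_trans (ler_pM _ _ a2 a2); lra.
  have b4 : (l * l) * (l * l) <= 7 + 321 / 10 ^+ 3 + 397 / 10 ^+ 6 + 64 / 10 ^+
    8.
    by apply: le_trans (ler_pM _ _ b2 b2) _; lra.
  have -> : l ^+ 5 = (l * l) * (l * l) * l by ring.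
  apply/andP; split.
    by apply: le_trans (ler_pM _ _ a4 l1); lra.
  by apply: le_trans (ler_pM _ _ b4 l2) _; lra.
rewrite CE' ler_pdivlMr// ltr_pdivrMr//.
move: (P * L ^+ 6) (L ^+ 5) lo hi => x y lo hi /andP[lo5 hi5].
clear - lo hi lo5 hi5.
by apply/andP; split; lra.
Qed.

End numerics.

(** * Matchings and the extremal functions *)

Section extremal.
Implicit Types (d n : nat).

Lemma f2_le_F2 d n : (f2 d n <= F2 d n)%N.
Proof.
apply/bigmax_leqP => A /asboolP [A0 hA].
apply: (@leq_bigmax_cond _ _ (fun A : {set 'I_n.+1} => #|A|) A).
apply/asboolP; split=> // -[a [b [aA bA _ ab]]]; apply: hA; by exists a, b.
Qed.

(** An admissible set misses at least one end of each edge of a matching made of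
forbidden pairs, and these ends are distinct. *)
Lemma matching_bound d n (I : finType) (S : {set I}) (a b : I -> nat) :
  (forall i, i \in S -> (0 < a i <= n)%N && (0 < b i <= n)%N) ->
  {in S &, injective a} -> {in S &, injective b} ->
  {in S &, forall i j, a i <> b j} ->
  (forall i, i \in S -> pos_power d (a i * b i)) ->
  (F2 d n + #|S| <= n)%N.
Proof.
move=> ab ia ib dab pw.
have key (A : {set 'I_n.+1}) : F2_admissible d A -> (#|A| + #|S| <= n)%N.
  move=> [A0 hA].
  pose g i : 'I_n.+1 := if inord (a i) \in A then inord (b i) else inord (a i).
  have av i : i \in S -> val (inord (a i) : 'I_n.+1) = a i.
    by move=> /ab /andP[/andP[_ h] _]; rewrite /= inordK.
  have bv i : i \in S -> val (inord (b i) : 'I_n.+1) = b i.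
    by move=> /ab /andP[_ /andP[_ h]]; rewrite /= inordK.
  have gv i : i \in S -> val (g i) = if inord (a i) \in A then b i else a i.
    by move=> iS; rewrite /g; case: ifP => _; [rewrite bv|rewrite av].
  have gI : {in S &, injective g}.
    move=> i j iS jS /(congr1 val); rewrite !gv//.
    case: ifP => _; case: ifP => _; [exact: ib| | |exact: ia] => e.
      by case: (dab j i jS iS).
    by case: (dab i j iS jS).
  have gA i : i \in S -> g i \notin A.
    move=> iS; rewrite /g; case: ifPn => // aA; apply/negP => bA; apply: hA.
    exists (inord (a i)), (inord (b i)); split => //.
      by move/(congr1 val); rewrite av// bv//; exact: dab.
    by rewrite (av i iS) (bv i iS); exact: pw.
  have g0 i : i \in S -> g i != ord0.
    move=> iS; rewrite -val_eqE gv//= -lt0n.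
    by have /andP[/andP[a0 _] /andP[b0 _]] := ab i iS; case: ifP.
  have dis : A :&: g @: S = finset.set0.
    apply/finset.setP => k; rewrite !inE;
      apply/negP => /andP[kA /imsetP[i iS ke]].
    by move: (gA i iS); rewrite -ke kA.
  have : A :|: g @: S \subset predC1 ord0.
    apply/fintype.subsetP => k; rewrite !inE => /orP[kA|/imsetP[i iS ->]].
      by apply: contraNneq A0 => <-.
    exact: g0.
  move/subset_leq_card; rewrite cardC1 card_ord /= cardsU.
  by rewrite dis cards0 subn0 card_in_imset.
have S_le : (#|S| <= n)%N.
  have := key finset.set0; rewrite cards0; apply; split; first by rewrite inE.
  by move=> [x [y []]]; rewrite inE.
rewrite addnC -leq_subRL//; apply/bigmax_leqP => A /asboolP/key.
by rewrite addnC leq_subRL.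
Qed.

Lemma locE p u v w : prime p -> (0 < u)%N -> (0 < v)%N -> (0 < w)%N ->
  loc p u v w = (logn p u + logn p v + logn p w <= 1)%N.
Proof.
move=> pp u0 v0 w0; rewrite /loc.
have d1 m : (0 < m)%N -> (p %| m)%N = (1 <= logn p m)%N.
  by move=> m0; rewrite -pfactor_dvdn// expn1.
by rewrite !pfactor_dvdn// !d1//; lia.
Qed.

Lemma goodP u v w : (0 < u)%N -> (0 < v)%N -> (0 < w)%N ->
  reflect (forall p, prime p -> (logn p u + logn p v + logn p w <= 1)%N)
    (good u v w).
Proof.
move=> u0 v0 w0; apply: (iffP (asboolP _)) => h p pp.
  by rewrite -locE// h.
by rewrite locE// h.
Qed.

Lemma logn_eq m n : (0 < m)%N -> (0 < n)%N ->
  (forall p, prime p -> logn p m = logn p n) -> m = n.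
Proof.
move=> m0 n0 h; apply: eqn_from_log => // p.
case: (boolP (prime p)) => [/h//|np].
by rewrite [LHS]lognE [RHS]lognE (negbTE np).
Qed.

Definition quartic (u v w x : nat) : nat := (u * v ^ 2 * w ^ 3 * x ^ 4)%N.

Lemma logn_quartic p u v w x : (0 < u)%N -> (0 < v)%N -> (0 < w)%N ->
  (0 < x)%N -> logn p (quartic u v w x) =
  (logn p u + 2 * logn p v + 3 * logn p w + 4 * logn p x)%N.
Proof.
move=> u0 v0 w0 x0.
have h A B C D : (0 < A)%N -> (0 < B)%N -> (0 < C)%N -> (0 < D)%N ->
    logn p (A * B * C * D) = (logn p A + logn p B + logn p C + logn p D)%N.
  by move=> A0 B0 C0 D0; rewrite !lognM ?muln_gt0 ?A0 ?B0 ?C0.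
by rewrite /quartic h ?expn_gt0 ?u0 ?v0 ?w0 ?x0// !lognX.
Qed.

Lemma quartic_gt0 u v w x : (0 < u)%N -> (0 < v)%N -> (0 < w)%N ->
  (0 < x)%N -> (0 < quartic u v w x)%N.
Proof.
have h A B C D : (0 < A)%N -> (0 < B)%N -> (0 < C)%N -> (0 < D)%N ->
    (0 < A * B * C * D)%N by move=> A0 B0 C0 D0; rewrite !muln_gt0 A0 B0 C0.
by move=> u0 v0 w0 x0; apply: h; rewrite ?expn_gt0 ?v0 ?w0 ?x0.
Qed.

(** Induction on the number of prime factors of [a]: a further factor [p] moves
one step along [1 -> u -> v -> w -> x]. *)
Lemma quartic_decomposition a : (0 < a)%N -> exists u v w x : nat,
  [/\ a = quartic u v w x, good u v w & [&& 0 < u, 0 < v, 0 < w & 0 < x]%N].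
Proof.
elim/ltn_ind: a => a IH a0; have [a1|a1] := leqP a 1.
  exists 1%N, 1%N, 1%N, 1%N; split => //; first by rewrite /quartic; lia.
  by apply/goodP => // p _; rewrite logn1.
pose p := pdiv a; have pp : prime p := pdiv_prime a1.
have p0 := prime_gt0 pp.
have /dvdnP[b eb] := pdiv_dvd a; rewrite -/p mulnC in eb.
have b0 : (0 < b)%N by rewrite lt0n; apply: contraTneq a0 => b0;
  rewrite eb b0 muln0.
have ba : (b < a)%N by rewrite eb ltn_Pmull// prime_gt1.
have [u [v [w [x [e g /and4P[u0 v0 w0 x0]]]]]] := IH b ba b0.
have G := elimT (goodP u0 v0 w0) g.
have lp q m : prime q -> (0 < m)%N -> logn q (p * m)%N = ((q == p) + logn q
  m)%N.
  by move=> qp m0; rewrite lognM// [logn q p]logn_prime.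
have [/dvdnP[w' ew]|nw] := boolP (p %| w)%N.
  rewrite mulnC in ew; have w'0 : (0 < w')%N by move: w0;
    rewrite ew muln_gt0 => /andP[].
  exists u, v, w', (p * x)%N; split; last by rewrite u0 v0 w'0 muln_gt0 p0 x0.
    by rewrite eb e ew /quartic !expnMn !expnS; ring.
  by apply/goodP => // q qp; have := G q qp; rewrite ew lp//; lia.
have [/dvdnP[v' ev]|nv] := boolP (p %| v)%N.
  rewrite mulnC in ev; have v'0 : (0 < v')%N by move: v0;
    rewrite ev muln_gt0 => /andP[].
  exists u, v', (p * w)%N, x; split; last by rewrite u0 v'0 muln_gt0 p0 w0 x0.
    by rewrite eb e ev /quartic !expnMn !expnS; ring.
  apply/goodP => //; first by rewrite muln_gt0 p0.
  by move=> q qp; have := G q qp; rewrite ev !lp//; lia.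
have [/dvdnP[u' eu]|nu] := boolP (p %| u)%N.
  rewrite mulnC in eu; have u'0 : (0 < u')%N by move: u0;
    rewrite eu muln_gt0 => /andP[].
  exists u', (p * v)%N, w, x; split; last by rewrite u'0 muln_gt0 p0 v0 w0 x0.
    by rewrite eb e eu /quartic !expnMn !expnS; ring.
  apply/goodP => //; first by rewrite muln_gt0 p0.
  by move=> q qp; have := G q qp; rewrite eu !lp//; lia.
exists (p * u)%N, v, w, x; split; last by rewrite muln_gt0 p0 u0 v0 w0 x0.
  by rewrite eb e /quartic; ring.
apply/goodP => //; first by rewrite muln_gt0 p0.
move=> q qp; have := G q qp; rewrite lp//; case: (q =P p) => [->|_] //.
have l0 m : (0 < m)%N -> ~~ (p %| m)%N -> logn p m = 0%N.
  by move=> m0 nd; apply/eqP; rewrite -leqn0 leqNgt -pfactor_dvdn ?expn1.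
by rewrite !l0.
Qed.

(** At each prime the valuations modulo 4 of the two factors are in [{0, 1, 2,
3}] and add up to [0] or [4], so [1] is paired with [3], [2] with itself. *)
Lemma quartic_mul_pow4 u v w x u' v' w' x' t :
  [&& 0 < u, 0 < v, 0 < w & 0 < x]%N -> [&& 0 < u', 0 < v',
    0 < w' & 0 < x']%N ->
  good u v w -> good u' v' w' -> (0 < t)%N ->
  (quartic u v w x * quartic u' v' w' x')%N = (t ^ 4)%N -> u' = w /\ w' = u.
Proof.
move=> /and4P[u0 v0 w0 x0] /and4P[u'0 v'0 w'0 x'0] /goodP G /goodP G' t0 e.
have h p : prime p -> logn p u' = logn p w /\ logn p w' = logn p u.
  move=> pp; have := congr1 (logn p) e.
  rewrite lognM ?quartic_gt0// !logn_quartic// lognX.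
  have := G u0 v0 w0 p pp; have := G' u'0 v'0 w'0 p pp; lia.
by split; apply: logn_eq => // p /h[].
Qed.

Lemma quartic_inj u v w x u' v' w' x' :
  [&& 0 < u, 0 < v, 0 < w & 0 < x]%N -> [&& 0 < u', 0 < v',
    0 < w' & 0 < x']%N ->
  good u v w -> good u' v' w' ->
  quartic u v w x = quartic u' v' w' x' -> [/\ u = u', v = v', w = w' & x = x'].
Proof.
move=> /and4P[u0 v0 w0 x0] /and4P[u'0 v'0 w'0 x'0] /goodP G /goodP G' e.
have h p : prime p -> [/\ logn p u = logn p u', logn p v = logn p v',
    logn p w = logn p w' & logn p x = logn p x'].
  move=> pp; have := congr1 (logn p) e; rewrite !logn_quartic//.
  have := G u0 v0 w0 p pp; have := G' u'0 v'0 w'0 p pp => h1 h2 h3.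
  by split; lia.
by split; apply: logn_eq => // p /h[].
Qed.

Lemma good_sym u v w : (0 < u)%N -> (0 < v)%N -> (0 < w)%N ->
  good u v w -> good w v u.
Proof.
by move=> u0 v0 w0 /goodP G; apply/goodP => // p /(G u0 v0 w0); lia.
Qed.

Definition quad_pred n (t : 'I_n.+1 * ('I_n.+1 * ('I_n.+1 * 'I_n.+1))) : bool :=
  let: (x, (w, (u, v))) := t in
  [&& [&& 0 < u, 0 < v, 0 < w & 0 < x], u < w, good u v w &
      quartic u v w x <= n]%N.

Definition quads n := finset (@quad_pred n).

(** Exchanging [u] and [w] when [u < w] gives a smaller integer, and the product
of both is [(u v w x^2)^4]. *)
Lemma quads_matching n : (F2 4 n + #|quads n| <= n)%N.
Proof.
pose a (t : 'I_n.+1 * ('I_n.+1 * ('I_n.+1 * 'I_n.+1))) :=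
  let: (x, (w, (u, v))) := t in quartic u v w x.
pose b (t : 'I_n.+1 * ('I_n.+1 * ('I_n.+1 * 'I_n.+1))) :=
  let: (x, (w, (u, v))) := t in quartic w v u x.
apply: (@matching_bound 4 n _ (quads n) a b).
- move=> [x [w [u v]]]; rewrite inE => /and4P[/and4P[u0 v0 w0 x0] uw g le].
  rewrite /a /b !quartic_gt0// le (leq_trans _ le)// /quartic.
  rewrite !leq_mul2r; apply/orP; right.
  have -> : (w * v ^ 2 * u ^ 3 = (w * u * v ^ 2) * u ^ 2)%N by ring.
  have -> : (u * v ^ 2 * w ^ 3 = (w * u * v ^ 2) * w ^ 2)%N by ring.
  by rewrite leq_mul2l leq_exp2r// (ltnW uw) orbT.
- move=> [x [w [u v]]] [x' [w' [u' v']]]; rewrite !inE.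
  move=> /and4P[p _ g _] /and4P[p' _ g' _] /(quartic_inj p p' g g')[].
  by move=> /val_inj-> /val_inj-> /val_inj-> /val_inj->.
- move=> [x [w [u v]]] [x' [w' [u' v']]]; rewrite !inE.
  move=> /and4P[/and4P[u0 v0 w0 x0] _ g _] /and4P[/and4P[u'0 v'0 w'0 x'0] _ g'
    _].
  move=> e; have [] := quartic_inj _ _ (good_sym u0 v0 w0 g) (good_sym u'0 v'0
    w'0 g') e.
  + by rewrite u0 v0 w0 x0.
  + by rewrite u'0 v'0 w'0 x'0.
  by move=> /val_inj-> /val_inj-> /val_inj-> /val_inj->.
- move=> [x [w [u v]]] [x' [w' [u' v']]]; rewrite !inE.
  move=> /and4P[p uw g _] /and4P[/and4P[u'0 v'0 w'0 x'0] uw' g' _] e.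
  have [] := quartic_inj p _ g (good_sym u'0 v'0 w'0 g') e.
    by rewrite u'0 v'0 w'0 x'0.
  by move=> E1 _ E2 _; move: uw; rewrite E1 E2; lia.
- move=> [x [w [u v]]]; rewrite inE => /and4P[/and4P[u0 v0 w0 x0] _ _ _].
  exists (u * v * w * x ^ 2)%N; split; last by rewrite /a /b /quartic; ring.
  by rewrite (muln_gt0 _ (x ^ 2)) expn_gt0 x0 !muln_gt0 u0 v0 w0.
Qed.

(** The admissible set consists of the integers with [u > w], no two of which
can be obtained from each other by exchanging [u] and [w]. The others are listed
by [quads n], except those with [u = w]; then [u = w = 1] by coprimality and the
integer is a square. *)
Lemma quads_f2 n s : (n < s.+1 ^ 2)%N -> (n <= f2 4 n + #|quads n| + s)%N.
Proof.
move=> ns.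
pose dec (a : 'I_n.+1) u v w x :=
  [/\ val a = quartic u v w x, good u v w & [&& 0 < u, 0 < v, 0 < w & 0 < x]%N].
pose A : {set 'I_n.+1} :=
  finset (fun a => `[< exists u v w x, dec a u v w x /\ (w < u)%N >]).
have memA a : a \in A -> exists u v w x, dec a u v w x /\ (w < u)%N.
  by rewrite inE => /asboolP.
have hA : f2_admissible 4 A.
  split.
    apply/negP => /memA[u [v [w [x [[e _ /and4P[u0 v0 w0 x0]] _]]]]].
    by have := quartic_gt0 u0 v0 w0 x0; rewrite -e.
  move=> [a [b [/memA[u [v [w [x [[ea ga pa] wu]]]]] /memA + +]]].
  move=> [u' [v' [w' [x' [[eb gb pb] wu']]]]] [t [t0 et]].
  have [] := quartic_mul_pow4 pa pb ga gb t0; first by rewrite -ea -eb.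
  by move=> E1 E2; move: wu'; rewrite E1 E2; lia.
have fA : (#|A| <= f2 4 n)%N.
  by apply: (@leq_bigmax_cond _ _ (fun A : {set 'I_n.+1} => #|A|));
    apply/asboolP.
pose q (t : 'I_n.+1 * ('I_n.+1 * ('I_n.+1 * 'I_n.+1))) : 'I_n.+1 :=
  let: (x, (w, (u, v))) := t in inord (quartic u v w x).
pose sq (y : 'I_s.+1) : 'I_n.+1 := inord (y ^ 2).
have cover : 'I_n.+1 \subset A :|: (q @: quads n :|: sq @: 'I_s.+1).
  apply/fintype.subsetP => a _; rewrite !inE.
  have [a0|a0] := posnP a.
    apply/orP; right; apply/orP; right; apply/imsetP; exists ord0;
      rewrite ?inE//.
    by apply/val_inj; rewrite /= inordK// a0.
  have [u [v [w [x [e g p]]]]] := quartic_decomposition a0.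
  have an : (quartic u v w x <= n)%N by rewrite -e -ltnS ltn_ord.
  have /and4P[u0 v0 w0 x0] := p.
  have [uw|wu|uw] := ltngtP u w.
  - apply/orP; right; apply/orP; left; apply/imsetP.
    have le m : (m %| quartic u v w x)%N -> (m < n.+1)%N.
      by move=> h; rewrite ltnS (leq_trans _ an)// dvdn_leq// quartic_gt0.
    have lu : (u < n.+1)%N by apply: le; rewrite /quartic -!mulnA dvdn_mulr.
    have lv : (v < n.+1)%N.
      by apply: le; rewrite /quartic -!mulnA dvdn_mull// dvdn_mulr// dvdn_exp.
    have lw : (w < n.+1)%N.
      by apply: le; rewrite /quartic -mulnA dvdn_mull// dvdn_mulr// dvdn_exp.
    have lx : (x < n.+1)%N by apply: le; rewrite /quartic dvdn_mull// dvdn_exp.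
    exists (Ordinal lx, (Ordinal lw, (Ordinal lu, Ordinal lv))).
      by rewrite inE /quad_pred /= p uw g an.
    by apply/val_inj; rewrite /q /= inordK// e.
  - apply/orP; left; apply/asboolP; exists u, v, w, x; split => //.
  - apply/orP; right; apply/orP; right; apply/imsetP.
    have u1 : u = 1%N.
      apply: logn_eq => // r rp; have := elimT (goodP u0 v0 w0) g r rp.
      by rewrite logn1 -uw; lia.
    have e2 : nat_of_ord a = ((v * x ^ 2) ^ 2)%N.
      by rewrite e /quartic -uw u1; ring.
    have ys : (v * x ^ 2 < s.+1)%N.
      by rewrite -(ltn_exp2r _ _ (e := 2))// -e2 (leq_ltn_trans _ ns)// -ltnS.
    exists (Ordinal ys); rewrite ?inE//; apply/val_inj.
    by rewrite /sq /= inordK// -e2.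
have := subset_leq_card cover; rewrite card_ord => h.
have h1 : (#|A :|: (q @: quads n :|: sq @: 'I_s.+1)| <=
    #|A| + (#|quads n| + s.+1))%N.
  apply: leq_trans (leq_card_setU _ _) _; rewrite leq_add2l.
  apply: leq_trans (leq_card_setU _ _) _; apply: leq_add;
    first exact: leq_imset_card.
  by apply: leq_trans (leq_imset_card _ _) _; rewrite card_ord.
move: h h1 fA; move: (f2 4 n) #|quads n| #|A| #|_| => f c k m; lia.
Qed.

End extremal.

Section quad_card.
Variable R : realType.

Lemma sum_ord_pos (V : nmodType) n (F : nat -> V) :
  \sum_(1 <= i < n.+1) F i = \sum_(i < n.+1) (if (0 < i)%N then F i else 0).
Proof.
rewrite -(big_mkord xpredT (fun i => if (0 < i)%N then F i else 0)).
by rewrite big_ltn// add0r !big_nat; apply: eq_bigr => i /andP[-> _].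
Qed.

Lemma sum_pair (V : nmodType) (I J : finType) (F : I * J -> V) :
  \sum_t F t = \sum_i \sum_j F (i, j).
Proof. by rewrite pair_bigA; apply: eq_bigr => -[]. Qed.

Lemma card_quads n : #|quads n|%:R = quad_count R n.
Proof.
rewrite -sum1_card natr_sum big_mkcond/= /quad_count sum_ord_pos.
rewrite sum_pair; apply: eq_bigr => x _; rewrite sum_pair.
case: ifPn => [x0|nx]; last first.
  rewrite big1// => w _; rewrite big1// => -[u v] _.
  by rewrite inE /= (negbTE nx) !andbF.
rewrite /box sum_ord_pos; apply: eq_bigr => w _.
rewrite sum_pair.
case: ifPn => [w0|nw]; last first.
  rewrite big1// => u _; rewrite big1// => v _.
  by rewrite inE /= (negbTE nw) !andbF.
rewrite sum_ord_pos; apply: eq_bigr => u _.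
case: ifPn => [u0|nu]; last first.
  by rewrite big1// => v _; rewrite inE /= (negbTE nu).
rewrite sum_ord_pos; apply: eq_bigr => v _.
case: (boolP (0 < v)%N) => [v0|nv]; last by rewrite inE /= (negbTE nv) !andbF.
rewrite inE /= u0 v0 w0 x0 /reg.
have -> : ((u * w ^ 3 * v ^ 2)%:R <= n%:R / x%:R ^+ 4 :> R) =
    (quartic u v w x <= n)%N.
  rewrite ler_pdivlMr ?exprn_gt0 ?ltr0n// -natrX -natrM ler_nat /quartic.
  by congr (_ <= _)%N; ring.
by case: (_ < _)%N; case: (good _ _ _); case: (_ <= _)%N;
  rewrite ?mul0r ?mulr0 ?mul1r.
Qed.

End quad_card.

(** * The exponents [d >= 5] *)

Section product_boxes.
Variable R : realType.
Variable r : nat -> R.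
Hypothesis r_itv : forall v, (0 < v)%N -> 1 <= r v <= v%:R.
Implicit Types (K N V M z : nat).

(** A box of area [N^2 / v] for each [v]. The parameter [r] serves to balance
its sides so that the two integers built from [(u, v, w)] have the same bound.
*)
Definition uside N v : R := N%:R * r v.
Definition wside N v : R := N%:R / (r v * v%:R).

(** The value [v = 1] is left out: for it, exchanging [u] and [w] exchanges the
two members of the pair, so pairs would be counted twice. *)
Definition breg N V (u v w : nat) : bool :=
  (1 < v <= V)%N && ((u%:R <= uside N v) && (w%:R <= wside N v)).

Lemma r_gt0 v : (0 < v)%N -> 0 < r v.
Proof. by move=> /r_itv/andP[]; lra. Qed.

Lemma uside_ge0 N v : (0 < v)%N -> 0 <= uside N v.
Proof. by move=> /r_gt0 r0; rewrite mulr_ge0// ltW. Qed.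

Lemma wside_ge0 N v : (0 < v)%N -> 0 <= wside N v.
Proof. by move=> /r_gt0 r0; rewrite divr_ge0// mulr_ge0// ltW. Qed.

Lemma side_mul N v : (0 < v)%N -> wside N v * uside N v = N%:R ^+ 2 * v%:R^-1.
Proof.
move=> v0; have r0 := r_gt0 v0; have v0' : 0 < v%:R :> R by rewrite ltr0n.
by rewrite /wside /uside; field; rewrite !gt_eqF.
Qed.

Lemma uside_le N V v : (0 < v <= V)%N -> uside N v <= (N * V)%:R.
Proof.
move=> /andP[v0 vV]; have /andP[_ rv] := r_itv v0.
by rewrite /uside natrM ler_wpM2l// (le_trans rv)// ler_nat.
Qed.

Lemma wside_le N v : (0 < v)%N -> wside N v <= N%:R.
Proof.
move=> v0; have /andP[r1 _] := r_itv v0.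
rewrite /wside ler_pdivrMr ?mulr_gt0 ?r_gt0 ?ltr0n// ler_peMr//.
by rewrite mulr_ege1// ler1n.
Qed.

Lemma box_exchange K P (h : nat -> nat -> nat -> R) :
  box K P h = \sum_(1 <= v < K.+1) \sum_(1 <= w < K.+1) \sum_(1 <= u < K.+1)
    (P u v w)%:R * h u v w.
Proof.
rewrite /box [RHS]exchange_big; apply: eq_bigr => w _.
by rewrite [RHS]exchange_big.
Qed.

Lemma box_breg K N V (h : nat -> nat -> nat -> R) : (V <= K)%N ->
  box K (breg N V) h = \sum_(2 <= v < V.+1)
    \sum_(1 <= w < K.+1 | w%:R <= wside N v)
      \sum_(1 <= u < K.+1 | u%:R <= uside N v) h u v w.
Proof.
move=> VK; rewrite box_exchange.
rewrite (big_nat_widen 2 V.+1 K.+1)//= (big_nat_widenl 2 1)//= [RHS]big_mkcond.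
apply: eq_bigr => v _; rewrite /breg ltnS andbC; case: (_ && _) => /=;
  last first.
  by rewrite big1// => w _; rewrite big1// => u _; rewrite mul0r.
rewrite [RHS]big_mkcond; apply: eq_bigr => w _.
case: ifP => _; last by rewrite big1// => u _; rewrite andbF mul0r.
rewrite [RHS]big_mkcond; apply: eq_bigr => u _; rewrite andbT.
by case: ifP => _; rewrite ?mul1r ?mul0r.
Qed.

Lemma box_breg_multiples K N V d1 d2 d3 : (V <= K)%N ->
  (0 < d1)%N -> (0 < d2)%N -> (0 < d3)%N ->
  box K (breg N V) (@dvd3 R d1 d2 d3) <=
  N%:R ^+ 2 * harm R V / (d1%:R * d2%:R * d3%:R).
Proof.
move=> VK d10 d20 d30; rewrite box_breg//.
have d1' : 0 < d1%:R :> R by rewrite ltr0n.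
have d2' : 0 < d2%:R :> R by rewrite ltr0n.
have d3' : 0 < d3%:R :> R by rewrite ltr0n.
pose c : R := N%:R ^+ 2 / (d1%:R * d3%:R).
have c0 : 0 <= c by rewrite divr_ge0 ?exprn_ge0// mulr_ge0// ltW.
apply: (@le_trans _ _ (\sum_(1 <= v < V.+1 | (d2 %| v)%N) c * v%:R^-1));
  last first.
  rewrite -mulr_sumr; apply: le_trans (ler_wpM2l c0 (harm_multiples _ V d20)) _.
  by apply: eq_ler; rewrite /c; field; rewrite !gt_eqF.
rewrite (big_nat_widenl 2 1)//= big_mkcond [leRHS]big_mkcond !big_nat.
apply: ler_sum => v /andP[v0 _].
have [d2v|nd2v] := boolP (d2 %| v)%N; last first.
  case: ifP => // _; rewrite big1// => w _; rewrite big1// => u _.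
  by rewrite /dvd3 (negbTE nd2v) andbF.
case: ifP => _; last by rewrite mulr_ge0 ?invr_ge0.
have U0 := uside_ge0 N v0; have W0 := wside_ge0 N v0.
have -> : c * v%:R^-1 = (wside N v / d3%:R) * (uside N v / d1%:R).
  by rewrite mulrACA side_mul// /c; field; rewrite !gt_eqF// ltr0n.
apply: (@le_trans _ _ ((\sum_(1 <= w < K.+1 | (d3 %| w)%N) (w%:R <= wside N v
  :> R)%:R) *
   (\sum_(1 <= u < K.+1 | (d1 %| u)%N) (u%:R <= uside N v :> R)%:R))).
  rewrite mulr_suml big_mkcond [leRHS]big_mkcond; apply: ler_sum => w _.
  case: (boolP (w%:R <= wside N v)) => hw; last by case: ifP => // _;
    rewrite mul0r.
  case: (boolP (d3 %| w)%N) => d3w; last first.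
    by rewrite big1// => u _; rewrite /dvd3 (negbTE d3w) !andbF.
  rewrite mul1r big_mkcond [leRHS]big_mkcond; apply: ler_sum => u _.
  by rewrite /dvd3 d2v d3w !andbT; case: (d1 %| u)%N; case: (u%:R <= uside N v).
apply: ler_pM; rewrite ?sumr_ge0//; exact: count_multiples_le.
Qed.

(** For [V] fixed and [N] large the terms linear in [N] are negligible: they
come from the boundaries of the boxes, when averaging over [u] and [w]. The
average over [v] is taken by summation by parts, and the missing [v = 1] costs
[N^2]. *)
Lemma box_breg_mean M (h : nat -> nat -> nat -> R) K N V : (0 < M)%N ->
  periodic3 M h -> (forall u v w, 0 <= h u v w <= 1) ->
  (0 < V)%N -> (0 < N)%N -> (N * V <= K)%N ->
  N%:R ^+ 2 * (mean3 M h * harm R V - (M%:R + 2)) -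
    (M%:R + 2) * (V%:R + 1) * V%:R * N%:R <= box K (breg N V) h.
Proof.
move=> M0 [pu pv pw] h01 V0 N0 NVK.
have VK : (V <= K)%N by apply: leq_trans NVK; rewrite leq_pmull.
have NK : (N <= K)%N by apply: leq_trans NVK; rewrite leq_pmulr.
pose a v w := mean M (fun u => h u v w).
pose A v := mean M (fun w => a v w).
have a01 v w : 0 <= a v w <= 1 by apply: mean_itv => i; exact: h01.
have A01 v : 0 <= A v <= 1 by apply: mean_itv => i; exact: a01.
have pa v : nat_periodic M (fun w => a v w).
  by move=> i; apply: eq_mean => u; exact: pw.
have pA : nat_periodic M A.
  by move=> i; apply: eq_mean => w; apply: eq_mean => u; exact: pv.
have muE : mean3 M h = mean M A.
  transitivity (mean M (fun w => mean M (fun v => a v w))).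
    by apply: eq_mean => w; exact: mean_exchange.
  exact: mean_exchange.
set mu := mean3 M h in muE *.
pose m2 : R := M%:R + 2; have m20 : 0 <= m2 by rewrite addr_ge0.
rewrite box_breg// -/m2.
have S v : (0 < v <= V)%N ->
    A v * (N%:R ^+ 2 * v%:R^-1) - m2 * (V%:R + 1) * N%:R <=
    \sum_(1 <= w < K.+1 | w%:R <= wside N v)
      \sum_(1 <= u < K.+1 | u%:R <= uside N v) h u v w.
  move=> vV; have /andP[v0 _] := vV.
  have U0 := uside_ge0 N v0; have W0 := wside_ge0 N v0.
  have UN := uside_le N vV; have WN := wside_le N v0.
  have UK : uside N v <= K%:R by rewrite (le_trans UN)// ler_nat.
  have WK : wside N v <= K%:R by rewrite (le_trans WN)// ler_nat.
  rewrite -side_mul//; set U := uside N v in U0 UN UK *.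
  set W := wside N v in W0 WN WK *.
  set T := \sum_(1 <= w < K.+1 | _) _.
  have h1 : `|T - \sum_(1 <= w < K.+1 | w%:R <= W) a v w * U| <= m2 * W.
    rewrite -sumrB; apply: le_trans (ler_norm_sum _ _ _) _.
    apply: (@le_trans _ _ (\sum_(1 <= w < K.+1 | w%:R <= W) m2)).
      by apply: ler_sum => w _; apply: periodic_count.
    rewrite big_mkcond; apply: le_trans (ler_wpM2l m20 (count_le K W0)).
    by rewrite mulr_sumr; apply: ler_sum => w _; case: ifP;
      rewrite ?mulr1 ?mulr0.
  have h2 : `|\sum_(1 <= w < K.+1 | w%:R <= W) a v w - A v * W| <= m2.
    exact: periodic_count.
  have h3 : `|\sum_(1 <= w < K.+1 | w%:R <= W) a v w * U - A v * (W * U)| <= m2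
    * U.
    by rewrite -mulr_suml mulrA -mulrBl normrM [`|U|]ger0_norm// ler_wpM2r.
  have h4 : m2 * W + m2 * U <= m2 * (V%:R + 1) * N%:R.
    rewrite -mulrDr -mulrA ler_wpM2l// mulrDl mul1r addrC lerD//.
    by rewrite mulrC -natrM.
  move: h1 h3; rewrite !ler_norml => /andP[? _] /andP[? _]; lra.
apply: (@le_trans _ _ (\sum_(2 <= v < V.+1)
    (A v * (N%:R ^+ 2 * v%:R^-1) - m2 * (V%:R + 1) * N%:R))); last first.
  by rewrite !big_nat; apply: ler_sum => v /andP[v2 vV]; apply: S; rewrite ltnW.
rewrite sumrB; apply: lerB; last first.
  rewrite big_const_nat iter_addr_0 -[_ *+ (V.+1 - 2)]mulr_natr -!mulrA.
  rewrite ler_wpM2l// ler_wpM2l ?addr_ge0// mulrC ler_wpM2r// ler_nat; lia.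
have -> : \sum_(2 <= v < V.+1) A v * (N%:R ^+ 2 * v%:R^-1) =
    N%:R ^+ 2 * \sum_(2 <= v < V.+1) A v * v%:R^-1.
  by rewrite mulr_sumr; apply: eq_bigr => v _; ring.
rewrite ler_wpM2l ?exprn_ge0//.
have e1 : \sum_(1 <= v < V.+1) A v * v%:R^-1 =
    A 1%N + \sum_(2 <= v < V.+1) A v * v%:R^-1.
  by rewrite big_ltn// invr1 mulr1.
have e2 : `|\sum_(1 <= v < V.+1) (A v - mu) * v%:R^-1| <= M%:R + 1.
  have := @abel_bound R (fun v => A v - mu) (fun v => v%:R^-1) (M%:R + 1).
  rewrite invr1 mulr1; apply.
  - by move=> k; rewrite muE; apply: periodic_discrepancy.
  - by move=> i _; rewrite invr_ge0.
  - by move=> i i0; rewrite lef_pV2 ?posrE ?ltr0n// ler_nat.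
have e3 : \sum_(1 <= v < V.+1) (A v - mu) * v%:R^-1 =
    \sum_(1 <= v < V.+1) A v * v%:R^-1 - mu * harm R V.
  by rewrite /harm mulr_sumr -sumrB; apply: eq_bigr => v _; rewrite mulrBl.
move: e2; rewrite e3 e1 ler_norml /m2 => /andP[? _].
by have /andP[_ A1] := A01 1%N; lra.
Qed.

Lemma C4_limit_gt0 : 0 < limn (@C4_partial R).
Proof.
have /andP[h _] := C4_num R; have : 0 < C4 R by apply: lt_le_trans h; lra.
by rewrite /C4 pmulr_rgt0// divr_gt0// exprn_gt0// pi_gt0.
Qed.

(** The harmonic sum over [v] makes the count of good triples outgrow [N^2]. The
sieve level [z] comes first, to make the density at least [P / 2] and the sieve
error at most [P / 4], where [P] is the full Euler product; then [V], to make
the harmonic sum large; then [N]. *)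
Lemma box_breg_unbounded (c : R) : exists V N0 : nat, forall N K,
  (N0 <= N)%N -> (N * V <= K)%N ->
  c * N%:R ^+ 2 <= box K (breg N V) (fun u v w => (good u v w)%:R).
Proof.
have P0 := C4_limit_gt0; set P := limn _ in P0.
have P4 : 0 < P / 2 by rewrite divr_gt0.
have cP : @C4_partial R @ \oo --> P := @is_cvg_C4_partial R.
have [z0 _ hz0] : \forall z \near \oo, `|P - C4_partial R z| <= P / 2.
  by move/cvgrPdist_le : cP => /(_ _ P4).
pose z := maxn z0 (Num.truncn (24 / P)).+2.
have z1 : (1 < z)%N by rewrite leq_max orbT.
have hz : P / 2 <= C4_partial R z.
  have := hz0 z; rewrite /= leq_maxl => /(_ isT).
  by rewrite ler_norml => /andP[? ?]; lra.
have z10 : 0 < z.-1%:R :> R by rewrite ltr0n; lia.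
have z6 : 6 / z.-1%:R <= P / 4.
  rewrite ler_pdivrMr// mulrC -ler_pdivrMr//; last by rewrite divr_gt0.
  have -> : 6 / (P / 4) = 24 / P by field; rewrite gt_eqF.
  apply: ltW; apply: lt_le_trans (truncnS_gt _) _.
  by rewrite ler_nat -ltnS prednK ?(ltnW z1)// leq_maxr.
pose M := modulus z; have M0 : (0 < M)%N := modulus_gt0 z.
pose b : R := (c + M%:R + 3) / (P / 4).
pose V := (Num.truncn (expR b)).+1.
have hV : b <= harm R V.
  apply: le_trans (ln_le_harm R V).
  rewrite -(expRK b) ler_ln ?posrE ?expR_gt0 ?ltr0n//.
  by apply: ltW; apply: lt_le_trans (truncnS_gt _) _; rewrite ler_nat.
pose D : R := (M%:R + 2) * (V%:R + 1) * V%:R.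
exists V, (maxn z (Num.truncn D).+1) => N K;
  rewrite geq_max => /andP[zN DN] NVK.
have N0 : (0 < N)%N by lia.
have VK : (V <= K)%N by apply: leq_trans NVK; rewrite leq_pmull.
have NK : (N <= K)%N by apply: leq_trans NVK; rewrite leq_pmulr.
pose B : R := N%:R ^+ 2 * harm R V.
have B0 : 0 <= B by rewrite mulr_ge0 ?exprn_ge0// harm_ge0.
have /andP[lo _] := @sieve_box R K (breg N V) z B z1 (leq_trans zN (leqW NK)) B0
  (fun d1 d2 d3 => box_breg_multiples N VK).
apply: le_trans lo; rewrite lerBrDr.
have h01 u v w : 0 <= ((sieve z u v w)%:R :
  R) <= 1 by rewrite ler0n lern1 leq_b1.
apply: le_trans (box_breg_mean M0 (sieve_periodic R z) h01 _ N0 NVK) => //.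
rewrite mean3_sieve -/D lerBrDr.
have DN' : D * N%:R <= N%:R ^+ 2.
  rewrite expr2 ler_wpM2r//; apply: ltW; apply: lt_le_trans (truncnS_gt _) _.
  by rewrite ler_nat.
have -> : 6 * B / z.-1%:R = N%:R ^+ 2 * (6 / z.-1%:R * harm R V).
  by rewrite /B; field; rewrite gt_eqF.
apply: (le_trans (lerD (lexx _) DN')).
rewrite [c * _]mulrC -{3}[N%:R ^+ 2]mulr1 -!mulrDr ler_wpM2l ?exprn_ge0//.
have H0 := harm_ge0 R V.
have q1 : 6 / z.-1%:R * harm R V <= P / 4 * harm R V by rewrite ler_wpM2r.
have q2 : P / 2 * harm R V <= C4_partial R z * harm R V by rewrite ler_wpM2r.
have q3 : c + M%:R + 3 <= P / 4 * harm R V.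
  by rewrite mulrC -ler_pdivrMr// divr_gt0.
lra.
Qed.

End product_boxes.

Section family.
Variables (R : realType) (k e : nat).
Hypotheses (k0 : (0 < k)%N) (e0 : (0 < e)%N).

Definition fam (u v w : nat) : nat :=
  (u ^ k.+1 * w ^ (k.+1 + e) * v ^ (k.+2 + e))%N.

Definition fam_conj (u v w : nat) : nat :=
  (u ^ (k.+1 + e) * w ^ k.+1 * v ^ k)%N.

Lemma logn_monomial p u v w a b c : (0 < u)%N -> (0 < v)%N -> (0 < w)%N ->
  logn p (u ^ a * w ^ b * v ^ c) = (a * logn p u + b * logn p w + c * logn p
    v)%N.
Proof.
move=> u0 v0 w0; have h A B C : (0 < A)%N -> (0 < B)%N -> (0 < C)%N ->
    logn p (A * B * C) = (logn p A + logn p B + logn p C)%N.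
  by move=> A0 B0 C0; rewrite !lognM ?muln_gt0 ?A0 ?B0.
by rewrite h ?expn_gt0 ?u0 ?v0 ?w0// !lognX.
Qed.

Lemma fam_gt0 u v w : (0 < u)%N -> (0 < v)%N -> (0 < w)%N ->
  (0 < fam u v w)%N && (0 < fam_conj u v w)%N.
Proof.
have h A B C : (0 < A)%N -> (0 < B)%N -> (0 < C)%N -> (0 < A * B * C)%N.
  by move=> A0 B0 C0; rewrite !muln_gt0 A0 B0.
by move=> u0 v0 w0; rewrite !h// expn_gt0 ?u0 ?v0 ?w0.
Qed.

Lemma natr_monomial u v w a b c : (u ^ a * w ^ b * v ^ c)%:R =
  u%:R ^+ a * w%:R ^+ b * v%:R ^+ c :> R.
Proof. by rewrite !natrM !natrX. Qed.

Lemma le1_cases a b c : (a + b + c <= 1)%N ->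
  [\/ [/\ a = 0, b = 0 & c = 0]%N, [/\ a = 1, b = 0 & c = 0]%N,
      [/\ a = 0, b = 1 & c = 0]%N | [/\ a = 0, b = 0 & c = 1]%N].
Proof.
case: a => [|[|a]]; case: b => [|[|b]]; case: c => [|[|c]] // _.
- exact: Or41.
- exact: Or44.
- exact: Or43.
- exact: Or42.
Qed.

(** The exponents [k + 1], [k + 1 + e], [k + 2 + e] of [u], [w], [v] differ, so
the valuations determine the triple. *)
Lemma fam_inj u v w u' v' w' : (0 < u)%N -> (0 < v)%N -> (0 < w)%N ->
  (0 < u')%N -> (0 < v')%N -> (0 < w')%N -> good u v w -> good u' v' w' ->
  fam u v w = fam u' v' w' -> [/\ u = u', v = v' & w = w'].
Proof.
move=> u0 v0 w0 u'0 v'0 w'0 /goodP G /goodP G' E.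
have h p : prime p -> [/\ logn p u = logn p u', logn p v = logn p v' &
    logn p w = logn p w'].
  move=> pp; have := congr1 (logn p) E; rewrite /fam !logn_monomial//.
  have [[-> -> ->]|[-> -> ->]|[-> -> ->]|[-> -> ->]] :=
    le1_cases (G u0 v0 w0 p pp);
  have [[-> -> ->]|[-> -> ->]|[-> -> ->]|[-> -> ->]] :=
    le1_cases (G' u'0 v'0 w'0 p pp); rewrite ?muln0 ?muln1 => H; split; lia.
by split; apply: logn_eq => // p /h[].
Qed.

Lemma fam_conj_inj u v w u' v' w' : (0 < u)%N -> (0 < v)%N -> (0 < w)%N ->
  (0 < u')%N -> (0 < v')%N -> (0 < w')%N -> good u v w -> good u' v' w' ->
  fam_conj u v w = fam_conj u' v' w' -> [/\ u = u', v = v' & w = w'].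
Proof.
move=> u0 v0 w0 u'0 v'0 w'0 /goodP G /goodP G' E.
have h p : prime p -> [/\ logn p u = logn p u', logn p v = logn p v' &
    logn p w = logn p w'].
  move=> pp; have := congr1 (logn p) E; rewrite /fam_conj !logn_monomial//.
  have [[-> -> ->]|[-> -> ->]|[-> -> ->]|[-> -> ->]] :=
    le1_cases (G u0 v0 w0 p pp);
  have [[-> -> ->]|[-> -> ->]|[-> -> ->]|[-> -> ->]] :=
    le1_cases (G' u'0 v'0 w'0 p pp); rewrite ?muln0 ?muln1 => H; split; lia.
by split; apply: logn_eq => // p /h[].
Qed.

(** At a prime dividing [v], the valuation [k + 2 + e] of [fam u v w] exceeds
all the exponents of [fam_conj]. *)
Lemma fam_neq u v w u' v' w' : (0 < u)%N -> (1 < v)%N -> (0 < w)%N ->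
  (0 < u')%N -> (0 < v')%N -> (0 < w')%N -> good u v w -> good u' v' w' ->
  fam u v w <> fam_conj u' v' w'.
Proof.
move=> u0 v1 w0 u'0 v'0 w'0 /goodP G /goodP G' E; have v0 := ltnW v1.
have pp := pdiv_prime v1; set p := pdiv v in pp.
have lv : (0 < logn p v)%N by rewrite -pfactor_dvdn// expn1 pdiv_dvd.
have := congr1 (logn p) E; rewrite /fam /fam_conj !logn_monomial//.
have := le1_cases (G u0 v0 w0 p pp); move: lv => /[swap].
move=> [[-> -> ->]|[-> -> ->]|[-> -> ->]|[-> -> ->]] // _;
  have [[-> -> ->]|[-> -> ->]|[-> -> ->]|[-> -> ->]] :=
    le1_cases (G' u'0 v'0 w'0 p pp); rewrite ?muln0 ?muln1; lia.
Qed.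

Lemma fam_mul u v w :
  (fam u v w * fam_conj u v w = (u * w * v) ^ (k + e + k.+2))%N.
Proof.
rewrite /fam /fam_conj !expnMn.
rewrite (_ : k + e + k.+2 = k.+1 + (k.+1 + e))%N; last lia.
rewrite {3}(_ : k.+1 + (k.+1 + e) = k.+2 + e + k)%N; last lia.
by rewrite !expnD; ring.
Qed.

(** At the corner [u = N r], [w = N / (r v)] both integers equal
[N ^ (2 k + 2 + e)]. *)
Lemma fam_le (N u v w : nat) (r : R) : (0 < v)%N -> 1 <= r -> r ^+ e = v%:R ->
  u%:R <= N%:R * r -> w%:R <= N%:R / (r * v%:R) ->
  (fam u v w <= N ^ (k + e + k.+2))%N && (fam_conj u v w <= N ^ (k + e +
    k.+2))%N.
Proof.
move=> v0 r1 re uN wN; have r0 : 0 < r by lra.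
have v0' : 0 < v%:R :> R by rewrite ltr0n.
have wrv : w%:R * (r * v%:R) <= N%:R by rewrite -ler_pdivlMr// mulr_gt0.
have wrv0 : 0 <= w%:R * (r * v%:R) by rewrite !mulr_ge0// ltW.
have Nr0 : 0 <= N%:R * r by rewrite mulr_ge0// ltW.
rewrite -!(ler_nat R) /fam /fam_conj !natr_monomial natrX; apply/andP; split.
  rewrite -(ler_pM2r (exprn_gt0 (k.+1 + e) r0)).
  have -> : u%:R ^+ k.+1 * w%:R ^+ (k.+1 + e) * v%:R ^+ (k.+2 + e) * r ^+ (k.+1
    + e) =
      u%:R ^+ k.+1 * (w%:R * (r * v%:R)) ^+ (k.+1 + e) * v%:R.
    by rewrite !exprMn addSn [v%:R ^+ _]exprS; ring.
  have -> : N%:R ^+ (k + e + k.+2) * r ^+ (k.+1 + e) =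
      (N%:R * r) ^+ k.+1 * N%:R ^+ (k.+1 + e) * v%:R.
    rewrite -re exprMn (_ : k + e + k.+2 = k.+1 + (k.+1 + e))%N; last lia.
    by rewrite !exprD; ring.
  rewrite ler_pM2r//; apply: ler_pM; rewrite ?exprn_ge0//.
    by rewrite lerXn2r ?nnegrE.
  by rewrite lerXn2r ?nnegrE.
have rv0 : 0 < (r * v%:R) ^+ k.+1 by rewrite exprn_gt0// mulr_gt0.
rewrite -(ler_pM2r rv0).
have -> : u%:R ^+ (k.+1 + e) * w%:R ^+ k.+1 * v%:R ^+ k * (r * v%:R) ^+ k.+1 =
    u%:R ^+ (k.+1 + e) * (w%:R * (r * v%:R)) ^+ k.+1 * v%:R ^+ k.
  by rewrite !exprMn; ring.
have -> : N%:R ^+ (k + e + k.+2) * (r * v%:R) ^+ k.+1 =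
    (N%:R * r) ^+ (k.+1 + e) * N%:R ^+ k.+1 * v%:R ^+ k.
  rewrite !exprMn (exprD r) re (_ : k + e + k.+2 = k.+1 + e + k.+1)%N; last lia.
  by rewrite exprD [v%:R ^+ k.+1]exprS; ring.
rewrite ler_pM2r ?exprn_gt0//; apply: ler_pM; rewrite ?exprn_ge0//.
  by rewrite lerXn2r ?nnegrE.
by rewrite lerXn2r ?nnegrE.
Qed.

Variable r : nat -> R.
Hypothesis r_itv : forall v, (0 < v)%N -> 1 <= r v <= v%:R.
Hypothesis r_exp : forall v, r v ^+ e = v%:R.

Lemma box_breg_F2 N V (n := (N ^ (k + e + k.+2))%N) :
  box n (breg r N V) (fun u v w => (good u v w)%:R) <=
  n%:R - (F2 (k + e + k.+2) n)%:R :> R.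
Proof.
pose pr (t : 'I_n.+1 * ('I_n.+1 * 'I_n.+1)) : bool := let: (w, (u, v)) := t in
  [&& (0 < w)%N, (0 < u)%N, (0 < v)%N, breg r N V u v w & good u v w].
pose a (t : 'I_n.+1 * ('I_n.+1 * 'I_n.+1)) := let:
  (w, (u, v)) := t in fam u v w.
pose b (t : 'I_n.+1 * ('I_n.+1 * 'I_n.+1)) :=
  let: (w, (u, v)) := t in fam_conj u v w.
have cardE : #|finset pr|%:R =
    box n (breg r N V) (fun u v w => (good u v w)%:R) :> R.
  rewrite -sum1_card natr_sum big_mkcond/= sum_pair /box sum_ord_pos.
  apply: eq_bigr => w _; rewrite sum_pair.
  case: (boolP (0 < w)%N) => [w0|nw]; last first.
    rewrite big1// => u _; rewrite big1// => v _.
    by rewrite inE /= (negbTE nw).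
  rewrite sum_ord_pos; apply: eq_bigr => u _.
  case: (boolP (0 < u)%N) => [u0|nu]; last first.
    by rewrite big1// => v _; rewrite inE /= (negbTE nu) !andbF.
  rewrite sum_ord_pos; apply: eq_bigr => v _.
  case: (boolP (0 < v)%N) => [v0|nv]; last by rewrite inE /= (negbTE nv) !andbF.
  rewrite inE /= u0 v0 w0 /=.
  by case: (breg _ _ _ _ _ _); case: (good _ _ _); rewrite ?mul0r ?mul1r.
rewrite -cardE lerBrDr -natrD ler_nat addnC.
apply: (@matching_bound _ n _ (finset pr) a b).
- move=> [w [u v]]; rewrite inE => /and5P[w0 u0 v0 /andP[_ /andP[uN wN]] _].
  have /andP[r1 _] := r_itv v0.
  have /andP[-> ->] := fam_gt0 u0 v0 w0.
  exact: fam_le v0 r1 (r_exp v) uN wN.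
- move=> [w [u v]] [w' [u' v']]; rewrite !inE.
  move=> /and5P[w0 u0 v0 _ g] /and5P[w'0 u'0 v'0 _ g'] E.
  have [] := fam_inj u0 v0 w0 u'0 v'0 w'0 g g' E.
  by move=> /val_inj-> /val_inj-> /val_inj->.
- move=> [w [u v]] [w' [u' v']]; rewrite !inE.
  move=> /and5P[w0 u0 v0 _ g] /and5P[w'0 u'0 v'0 _ g'] E.
  have [] := fam_conj_inj u0 v0 w0 u'0 v'0 w'0 g g' E.
  by move=> /val_inj-> /val_inj-> /val_inj->.
- move=> [w [u v]] [w' [u' v']]; rewrite !inE.
  move=> /and5P[w0 u0 _ /andP[/andP[v1 _] _] g] /and5P[w'0 u'0 v'0 _ g'].
  exact: fam_neq.
- move=> [w [u v]]; rewrite inE => /and5P[w0 u0 v0 _ _].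
  by exists (u * w * v)%N; rewrite !muln_gt0 u0 v0 w0 /a /b fam_mul.
Qed.

Lemma F2_not_O_square (c : R) (m : nat) :
  exists2 N, (m <= N)%N & let d := (k + e + k.+2)%N in
  c * N%:R ^+ 2 <= (N ^ d)%:R - (F2 d (N ^ d))%:R.
Proof.
have [V [N0 h]] := box_breg_unbounded r_itv c.
exists (maxn m (maxn N0 V)); first exact: leq_maxl.
set N := maxn m _ => d; apply: le_trans (box_breg_F2 N V); apply: h.
  by rewrite /N !leq_max leqnn orbT.
have VN : (V <= N)%N by rewrite /N !leq_max leqnn !orbT.
apply: (@leq_trans (N ^ 2)); first by rewrite -mulnn leq_mul2l VN orbT.
have [->|N1] := posnP N; first by rewrite exp0n.
by rewrite leq_pexp2l//; lia.
Qed.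

End family.

(** * From the counts to the extremal functions *)

Section conclusion.
Variable R : realType.

Lemma missing_bounds n :
  [/\ quad_count R n <= n%:R - (F2 4 n)%:R,
      n%:R - (F2 4 n)%:R <= n%:R - (f2 4 n)%:R :> R &
      n%:R - (f2 4 n)%:R <= quad_count R n + Num.sqrt n%:R].
Proof.
rewrite -card_quads; split.
- by rewrite lerBrDr -natrD ler_nat addnC quads_matching.
- by rewrite lerB// ler_nat f2_le_F2.
have s0 : 0 <= Num.sqrt (n%:R : R) by exact: sqrtr_ge0.
have /andP[s1 s2] := truncn_itv s0; set s := Num.truncn _ in s1 s2.
have ns : (n < s.+1 ^ 2)%N.
  by rewrite -(ltr_nat R) natrX -(sqrtS_natrK R n) ltrXn2r ?nnegrE.
rewrite lerBlDr; apply: (@le_trans _ _ (#|quads n|%:R + s%:R + (f2 4 n)%:R)).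
  by rewrite -!natrD ler_nat; have := quads_f2 ns; lia.
by rewrite lerD2r lerD2l.
Qed.

Lemma ln_nat_ge (A : R) : exists n0 :
  nat, forall n, (n0 <= n)%N -> A <= ln n%:R.
Proof.
exists (Num.truncn (expR A)).+1 => n An; have n0 : (0 < n)%N by lia.
rewrite -[leLHS]expRK ler_ln ?posrE ?expR_gt0 ?ltr0n//.
by apply: ltW; apply: lt_le_trans (truncnS_gt _) _; rewrite ler_nat.
Qed.

Lemma C4_gt0 : 0 < C4 R.
Proof. by have /andP[h _] := C4_num R; apply: lt_le_trans h; lra. Qed.

Lemma missing_asymp (e : R) : 0 < e -> exists n0 : nat, forall n, (n0 <= n)%N ->
  `|n%:R - (f2 4 n)%:R - C4 R * (Num.sqrt n%:R * ln n%:R)| <=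
  e * (Num.sqrt n%:R * ln n%:R).
Proof.
move=> e0; have e2 : 0 < e / 2 by rewrite divr_gt0.
have [n1 h1] := quad_count_asymp e2; have [n2 h2] := ln_nat_ge (2 / e).
exists (maxn n1 n2) => n; rewrite geq_max => /andP[/h1 + /h2].
have [b1 b2 b3] := missing_bounds n => h l.
have s0 : 0 <= Num.sqrt (n%:R : R) by exact: sqrtr_ge0.
have : Num.sqrt n%:R <= e / 2 * (Num.sqrt n%:R * ln n%:R) :> R.
  rewrite mulrCA ler_peMr// -ler_pdivrMl//.
  by rewrite mulr1 invf_div.
move: h b1 b2 b3; rewrite !ler_norml => /andP[? ?] *.
by apply/andP; split; lra.
Qed.

Lemma missing_lb : exists n0 : nat, forall n, (n0 <= n)%N ->
  C4 R / 2 * (Num.sqrt n%:R * ln n%:R) <= n%:R - (f2 4 n)%:R.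
Proof.
have [n0 h] := missing_asymp (divr_gt0 C4_gt0 (ltr0Sn R 1)).
by exists n0 => n /h; rewrite ler_norml => /andP[? _]; lra.
Qed.

Lemma not_vinogradov4 :
  ~ vinogradov (fun n : nat => n%:R - (f2 4 n)%:R : R)
      (fun n : nat => n%:R `^ (2 / 4%:R)).
Proof.
move=> [c [c0 [m _ hm]]]; have [n1 h1] := missing_lb.
have [n2 h2] := ln_nat_ge (2 * (c + 1) / C4 R).
pose n := (maxn m (maxn n1 n2)).+1.
have C0 := C4_gt0.
have /hm : (m <= n)%N by rewrite leqW// leq_maxl.
have -> : 2 / 4%:R = 2^-1 :> R by field.
rewrite /= powR12_sqrt//; apply/negP; rewrite -ltNge.
apply: lt_le_trans (h1 n _); last by rewrite leqW// !leq_max leqnn orbT.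
have s0 : 0 < Num.sqrt (n%:R : R) by rewrite sqrtr_gt0 ltr0n.
rewrite mulrCA mulrC ltr_pM2l//; apply: (@lt_le_trans _ _ (c + 1)); first lra.
have := h2 n; rewrite leqW ?leq_max ?leqnn ?orbT// => /(_ isT).
by rewrite ler_pdivrMr//; lra.
Qed.

Lemma not_vinogradov_ge5 d : (5 <= d)%N ->
  ~ vinogradov (fun n : nat => n%:R - (f2 d n)%:R : R)
      (fun n : nat => n%:R `^ (2 / d%:R)).
Proof.
move=> d5 [c [c0 [m _ hm]]].
suff [N Nm h] : exists2 N, (m.+1 <= N)%N &
    (c + 1) * N%:R ^+ 2 <= (N ^ d)%:R - (F2 d (N ^ d))%:R.
  have N0 : (0 < N)%N by lia.
  have /hm : (m <= N ^ d)%N.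
    by rewrite (leq_trans (ltnW Nm))// -{1}[N]expn1 leq_pexp2l//; lia.
  have -> : (N ^ d)%:R `^ (2 / d%:R) = N%:R ^+ 2 :> R.
    rewrite natrX -powR_mulrn// -powRrM mulrCA divff ?mulr1 ?powR_mulrn//.
    by rewrite pnatr_eq0; lia.
  apply/negP; rewrite -ltNge; apply: (@lt_le_trans _ _ ((c + 1) * N%:R ^+ 2)).
    by rewrite ltr_pM2r ?exprn_gt0 ?ltr0n//; lra.
  by apply: (le_trans h); rewrite lerB// ler_nat f2_le_F2.
(* [d = 2 k + 2 + e] with [e] = 1 or 2 by parity, so [r] is [v] or its square
   root *)
pose k := (d - 3)./2; have k0 : (0 < k)%N by rewrite /k half_gt0; lia.
have [d_odd|d_even] := boolP (odd d).
  have dE : d = (k + 1 + k.+2)%N by rewrite /k; lia.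
  rewrite dE; apply: (@F2_not_O_square R k 1 k0 isT (fun v => v%:R)) => v.
    by move=> v0; rewrite ler1n v0 lexx.
  by rewrite expr1.
have dE : d = (k + 2 + k.+2)%N by rewrite /k; lia.
rewrite dE; apply: (@F2_not_O_square R k 2 k0 isT (fun v =>
  Num.sqrt v%:R)) => v.
  move=> v0; rewrite sqrt_nat_ge1//= -{2}(sqrtS_natrK R v) expr2.
  by rewrite ler_peMr ?sqrtr_ge0// sqrt_nat_ge1.
exact: sqrtS_natrK.
Qed.

End conclusion.

Theorem corollary1p4 (R : realType) :
  [/\ (fun n : nat => n%:R - (F2 4 n)%:R : R) ~_\oo
        (fun n : nat => n%:R - (f2 4 n)%:R : R),
      (fun n : nat => n%:R - (f2 4 n)%:R : R) ~_\oo
        (fun n : nat => C4 R * Num.sqrt n%:R * ln n%:R),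
      944 / 10 ^+ 4 + 883 / 10 ^+ 7 <= C4 R < 944 / 10 ^+ 4 + 884 / 10 ^+ 7 &
      forall d : nat, (4 <= d)%N ->
        ~ [/\ vinogradov (fun n : nat => n%:R `^ (2 / d%:R))
                (fun n : nat => n%:R - (F2 d n)%:R : R),
              (forall n : nat,
                 n%:R - (F2 d n)%:R <= n%:R - (f2 d n)%:R :> R) &
              vinogradov (fun n : nat => n%:R - (f2 d n)%:R : R)
                (fun n : nat => n%:R `^ (2 / d%:R))]].
Proof.
have C0 := C4_gt0 R.
split.
- apply/eqaddoP => e e0.
  have [n1 h1] := missing_lb R.
  have [n2 h2] := ln_nat_ge (2 / (e * C4 R)).
  exists (maxn n1 n2) => // n; rewrite /= geq_max => /andP[/h1 + /h2 l].
  have [b1 b2 b3] := missing_bounds R n => h.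
  have s0 : 0 <= Num.sqrt (n%:R : R) by exact: sqrtr_ge0.
  rewrite !fctE; set a := n%:R - (F2 4 n)%:R in b1 b2 *.
  set b := n%:R - (f2 4 n)%:R in b2 b3 h *.
  have sl : Num.sqrt n%:R <= e * (C4 R / 2 * (Num.sqrt n%:R * ln n%:R)) :> R.
    have -> : e * (C4 R / 2 * (Num.sqrt n%:R * ln n%:R)) =
      Num.sqrt n%:R * (e * C4 R / 2 * ln n%:R) by field.
    rewrite ler_peMr// mulrAC ler_pdivlMr// mul1r mulrC.
    by rewrite -ler_pdivrMr// mulr_gt0.
  apply: (@le_trans _ _ (Num.sqrt n%:R)); first by rewrite ler_norml; lra.
  apply: (le_trans sl); rewrite ler_pM2l//; apply: (le_trans h).
  exact: ler_norm.
- apply/eqaddoP => e e0.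
  have [n1 h1] := missing_asymp (mulr_gt0 e0 C0).
  exists (maxn n1 1) => // n; rewrite /= geq_max => /andP[/h1 h n0].
  rewrite !fctE -mulrA; apply: (le_trans h).
  rewrite -mulrA ler_pM2l//; exact: ler_norm.
- exact: C4_num.
move=> d d4 [_ _]; move: d4; rewrite leq_eqVlt => /predU1P[<-|d5].
  exact: not_vinogradov4.
exact: not_vinogradov_ge5.
Qed.
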